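(* Let $d$ be one of the square-free positive integers $23,31,59,83,107,139,211,283,307,331,379,499,547,643,883,907$ (these are exactly the $d$ for which $E=\mathbb{Q}(\sqrt{-d})$ has class number $3$; all satisfy $d\equiv 3\pmod 4$). Let $\mathfrak{U}_2,\mathfrak{U}_3$ be the integral ideals and $k$ the positive integer given in the list below (so $\mathfrak{U}_j\overline{\mathfrak{U}_j}=k\mathcal{O}$ and $\mathcal{O},\mathfrak{U}_2,\mathfrak{U}_3$ represent the three ideal classes). For a positive integer $r_1$ let $L_1^{r_1}=\mathcal{O}v_1^{r_1}$ with $h(v_1^{r_1})=r_1$, and for $j=2,3$ and a positive integer $r_j$ let $L_j^{r_j}=\mathfrak{U}_jv_j^{r_j}$ with $h(v_j^{r_j})=r_j/k$. Then a positive definite integral unary Hermitian lattice over $\mathcal{O}$ belongs to $\mathfrak{S}_d(1)$ if and only if it is isometric to some $L_1^{r_1}$ with $r_1\geq1$, or to some $L_j^{r_j}$ with $j\in\{2,3\}$ and $r_j\in R_d$, where $R_d$ is listed below; moreover $g_d(1)$ is as listed: \begin{itemize} \item $d=23$: $\mathfrak{U}_2=(2,\omega)$, $\mathfrak{U}_3=(2,-1+\omega)$, $k=2$, $R_d=\{r\geq2\}$, $g_d(1)=3$. \item $d=31$: $(2,\omega)$, $(2,-1+\omega)$, $k=2$, $R_d=\{r\geq2,\ r\neq3\}$, $g_d(1)=4$. \item $d=59$: $(3,\omega)$, $(3,-1+\omega)$, $k=3$, $R_d=\{r\geq3,\ r\neq4\}$, $g_d(1)=4$. \item $d=83$: $(3,\omega)$,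 $(3,-1+\omega)$, $k=3$, $R_d=\{r\geq3,\ r\neq4,5,8\}$, $g_d(1)=4$. \item $d=107$: $(3,\omega)$, $(3,-1+\omega)$, $k=3$, $R_d=\{r\geq3,\ r\neq4,5,7,8,10\}$, $g_d(1)=4$. \item $d=139$: $(5,\omega)$, $(5,-1+\omega)$, $k=5$, $R_d=\{r\geq5,\ r\neq6,8,9\}$, $g_d(1)=4$. \item $d=211$: $(5,1+\omega)$, $(5,-2+\omega)$, $k=5$, $R_d=\{r\geq5,\ r\neq6,7,8,9,12,14,17\}$, $g_d(1)=4$. \item $d=283$: $(7,2+\omega)$, $(7,-3+\omega)$, $k=7$, $R_d=\{r\geq7,\ r\neq8,9,10,12,15,16,17,19\}$, $g_d(1)=4$. \item $d=307$: $(7,\omega)$, $(7,-1+\omega)$, $k=7$, $R_d=\{r\geq7,\ r\neq8,9,10,12,13,15,16,20,23,27\}$, $g_d(1)=4$. \item $d=331$: $(5,1+\omega)$, $(5,-2+\omega)$, $k=5$, $R_d=\{r\geq5,\ r\neq6,7,8,9,11,12,13,14,16,18,21,23,26,28,33\}$, $g_d(1)=4$. \item $d=379$: $(5,\omega)$, $(5,-1+\omega)$, $k=5$, $R_d=\{r\geq5,\ r\neq6,7,8,9,11,12,13,14,16,17,18,21,22,26,27,31,32,36\}$, $g_d(1)=4$. \item $d=499$: $(5,\omega)$, $(5,-1+\omega)$, $k=5$, $R_d=\{r\geq5,\ r\neq6,7,8,9,11,12,13,14,16,17,18,19,21,22,23,24,26,27,28,32,33,37,38,42\}$, $g_d(1)=4$.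 \item $d=547$: $(11,2+\omega)$, $(11,-3+\omega)$, $k=11$, $R_d=\{r\geq11,\ r\neq12,14,15,16,17,18,20,21,23,25,27,28,31,34,36\}$, $g_d(1)=4$. \item $d=643$: $(7,\omega)$, $(7,-1+\omega)$, $k=7$, $R_d=\{r\geq7,\ r\neq8,9,10,11,12,13,15,16,17,18,19,20,22,24,25,26,27,32,33,34,39,40,41,47,48,55\}$, $g_d(1)=4$. \item $d=883$: $(13,\omega)$, $(13,-1+\omega)$, $k=13$, $R_d=\{r\geq13,\ r\neq14,15,16,18,19,20,21,22,23,24,25,27,28,32,33,35,36,37,38,40,41,45,49,50,53,54,66\}$, $g_d(1)=4$. \item $d=907$: $(13,4+\omega)$, $(13,-5+\omega)$, $k=13$, $R_d=\{r\geq13,\ r\neq14,15,16,17,18,20,21,22,24,25,27,28,29,30,31,33,34,35,37,40,43,44,47,48,50,56,63\}$, $g_d(1)=5$. \end{itemize}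
   Context: $E=\mathbb{Q}(\sqrt{-d})$ with $d$ a square-free positive integer, $\mathcal{O}=\mathbb{Z}+\mathbb{Z}\omega$ its ring of integers, where $\omega=\sqrt{-d}$ if $d\equiv1,2\pmod 4$ and $\omega=(1+\sqrt{-d})/2$ if $d\equiv3\pmod 4$; $(a,b)$ denotes the ideal $a\mathcal{O}+b\mathcal{O}$. A Hermitian space is an $E$-vector space $V$ with a form $h:V\times V\to E$, $E$-linear in the first variable and with $h(v,w)=\overline{h(w,v)}$; write $h(v)=h(v,v)\in\mathbb{Q}$. A Hermitian lattice is a finitely generated $\mathcal{O}$-submodule of such a space; it is positive definite integral if $h(v)\in\mathbb{Z}_{>0}$ for all nonzero $v$ in it and $h(v,w)\in\mathcal{O}$ for all $v,w$ in it. A unary lattice $\mathfrak{U}v$ ($\mathfrak{U}$ a fractional ideal) lies in the one-dimensional space $Ev$. A lattice $L$ is represented by $K$ if there is an injective $\mathcal{O}$-linear map $L\to K$ preserving $h$; isometric means such a map is bijective. For $m\geq1$, $I_m$ is the free Hermitian lattice of rank $m$ with an orthonormal basis. $\mathfrak{S}_d(1)$ is the set of positive definite integral unary Hermitian lattices over $\mathcal{O}$ which are represented by $I_m$ for some $m\geq1$, and $g_d(1)$ is the smallest positive integer $g$ such that every lattice in $\mathfrak{S}_d(1)$ is represented by $I_g$. *)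

(* Defs.v *)
From HB Require Import structures.
From mathcomp Require Import all_boot all_order all_algebra all_field ring.
From mathcomp Require Import sesquilinear classical_sets.

Set Implicit Arguments.
Unset Strict Implicit.
Unset Printing Implicit Defensive.

Import Order.TTheory GRing.Theory Num.Theory.
Local Open Scope ring_scope.
Local Open Scope classical_set_scope.

(* The square root of -d in the upper half plane. *)
Definition sqrtN (d : nat) : algC := 'i * sqrtC d%:R.

(* Q + Q sqrt(-d), as a decidable subset of algC. *)
Definition Qsqrt (d : nat) : pred algC := Crat_span [:: 1; sqrtN d].

Lemma QsqrtP (d : nat) (x : algC) :
  reflect (exists a b : rat, x = ratr a + ratr b * sqrtN d) (x \in Qsqrt d).
Proof.
apply: (iffP (Crat_spanP _ _)) => [[a ->]|[a [b ->]]].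
  by exists (a ord0), (a (lift ord0 ord0)); rewrite !big_ord_recl big_ord0 /= mulr1 addr0.
exists [ffun i : 'I_2 => if i == ord0 then a else b].
by rewrite !big_ord_recl big_ord0 !ffunE /= mulr1 addr0.
Qed.

Lemma sqrtN_sqr (d : nat) : sqrtN d ^+ 2 = - d%:R.
Proof. by rewrite exprMn sqrCi sqrtCK mulN1r. Qed.

Lemma conj_sqrtN (d : nat) : (sqrtN d)^* = - sqrtN d.
Proof.
rewrite rmorphM /= conjCi mulNr.
by congr (- (_ * _)); apply/CrealP/ger0_real; rewrite sqrtC_ge0 ler0n.
Qed.

Lemma conj_comb (d : nat) (a b : rat) :
  (ratr a + ratr b * sqrtN d)^* = ratr a - ratr b * sqrtN d.
Proof.
have cQ (c : rat) : (ratr c : algC)^* = ratr c by exact: fmorph_rat.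
by rewrite rmorphD (rmorphM _ (ratr b)) /= conj_sqrtN !cQ mulrN.
Qed.

Lemma Qsqrt_conj (d : nat) (x : algC) : x \in Qsqrt d -> x^* \in Qsqrt d.
Proof.
move=> /QsqrtP[a [b ->]]; apply/QsqrtP; exists a, (- b).
by rewrite conj_comb rmorphN mulNr.
Qed.

Fact Qsqrt_divring_closed (d : nat) : divring_closed (Qsqrt d).
Proof.
have clM (x y : algC) : x \in Qsqrt d -> y \in Qsqrt d -> x * y \in Qsqrt d.
  move=> /QsqrtP[a [b ->]] /QsqrtP[a' [b' ->]]; apply/QsqrtP.
  exists (a * a' - b * b' * d%:R), (a * b' + b * a').
  rewrite rmorphB rmorphD !(rmorphM (@ratr algC)) /= rmorph_nat.
  by ring: (sqrtN_sqr d).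
have cl1 : 1 \in Qsqrt d by apply/mem_Crat_span; rewrite inE eqxx.
split=> // [x y Hx Hy|x y Hx Hy]; first by rewrite rpredB.
apply: (clM) => //; have [->|y0] := eqVneq y 0; first by rewrite invr0 rpred0.
have -> : y^-1 = y^* * (y * y^*)^-1.
  by rewrite invfM mulrCA divff ?mulr1 // conjC_eq0.
apply: (clM); first exact: Qsqrt_conj.
case/QsqrtP: Hy => a [b ->].
apply/QsqrtP; exists (a ^+ 2 + b ^+ 2 * d%:R)^-1, 0.
rewrite rmorph0 mul0r addr0 fmorphV; congr (_^-1).
rewrite conj_comb rmorphD !(rmorphM (@ratr algC)) /= rmorph_nat.
by ring: (sqrtN_sqr d).
Qed.

HB.instance Definition _ (d : nat) :=
  GRing.isDivringClosed.Build algC (Qsqrt d) (Qsqrt_divring_closed d).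

Record imquad (d : nat) := ImQuad { imquad_val : algC; _ : imquad_val \in Qsqrt d }.

HB.instance Definition _ (d : nat) := [isSub for @imquad_val d].
HB.instance Definition _ (d : nat) := [Choice of imquad d by <:].
HB.instance Definition _ (d : nat) :=
  [SubChoice_isSubIntegralDomain of imquad d by <:].
HB.instance Definition _ (d : nat) :=
  [SubIntegralDomain_isSubField of imquad d by <:].

Section ImQuad.
Variable d : nat.
Local Notation E := (imquad d).

Definition conjE (x : E) : E := ImQuad (Qsqrt_conj (valP x)).

Fact conjE_is_zmod_morphism : zmod_morphism conjE.
Proof. by move=> x y; apply/val_inj; rewrite /= !rmorphB. Qed.
Fact conjE_is_monoid_morphism : monoid_morphism conjE.
Proof.
by split=> [|x y]; apply/val_inj; rewrite /= ?rmorph1 ?rmorphM.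
Qed.
HB.instance Definition _ :=
  GRing.isZmodMorphism.Build E E conjE conjE_is_zmod_morphism.
HB.instance Definition _ :=
  GRing.isMonoidMorphism.Build E E conjE conjE_is_monoid_morphism.

Lemma conjEK : involutive conjE.
Proof. by move=> x; apply/val_inj; rewrite /= conjCK. Qed.

Fact sqrtN_in : sqrtN d \in Qsqrt d.
Proof. by apply/mem_Crat_span; rewrite !inE eqxx orbT. Qed.
Definition sqrtNE : E := ImQuad sqrtN_in.

Definition omega : E :=
  if (d %% 4 == 3)%N then (1 + sqrtNE) / 2%:R else sqrtNE.

Definition ringO : set E :=
  [set x | exists a b : int, x = a%:~R + b%:~R * omega].

Definition ideal2 (a b : E) : set E :=
  [set x | exists s t : E, [/\ ringO s, ringO t & x = s * a + t * b]].

Definition fg_submodule (V : lmodType E) (L : set V) : Prop :=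
  exists (n : nat) (g : 'I_n -> V),
    L = [set x | exists c : 'I_n -> E,
           (forall i, ringO (c i)) /\ x = \sum_(i < n) c i *: g i].

Definition fractional_ideal (U : set E) : Prop :=
  fg_submodule (U : set E^o) /\ exists2 x, U x & x != 0.

Definition scaled (V : lmodType E) (U : set E) (v : V) : set V :=
  [set a *: v | a in U].

Definition unary (V : lmodType E) (L : set V) : Prop :=
  exists (U : set E) (v : V), [/\ fractional_ideal U, v != 0 & L = scaled U v].

Definition posdef_integral (V : lmodType E) (h : {hermitian V for false & conjE})
    (L : set V) : Prop :=
  (forall v, L v -> v != 0 -> exists2 n : nat, (0 < n)%N & h v v = n%:R) /\
  (forall v w, L v -> L w -> ringO (h v w)).

(* Only the restriction of f to L is constrained, so f stands for a map L -> K. *)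
Definition representation (V W : lmodType E)
    (hV : {hermitian V for false & conjE}) (L : set V)
    (hW : {hermitian W for false & conjE}) (K : set W) (f : V -> W) : Prop :=
  [/\ forall x, L x -> K (f x),
      forall x y, L x -> L y -> f (x + y) = f x + f y,
      forall a x, ringO a -> L x -> f (a *: x) = a *: f x,
      forall x y, L x -> L y -> f x = f y -> x = y &
      forall x y, L x -> L y -> hW (f x) (f y) = hV x y].

Definition represented (V W : lmodType E)
    (hV : {hermitian V for false & conjE}) (L : set V)
    (hW : {hermitian W for false & conjE}) (K : set W) : Prop :=
  exists f : V -> W, representation hV L hW K f.

Definition isometric (V W : lmodType E)
    (hV : {hermitian V for false & conjE}) (L : set V)
    (hW : {hermitian W for false & conjE}) (K : set W) : Prop :=
  exists2 f : V -> W, representation hV L hW K f &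
    forall y, K y -> exists2 x, L x & f x = y.

Definition std_form (m : nat) (x y : 'rV[E]_m) : E :=
  \sum_(i < m) x 0 i * conjE (y 0 i).

Fact std_form_bilinear (m : nat) :
  bilinear_for ( *%R : GRing.Scale.law E E)
    (conjE \; *%R : GRing.Scale.law E E) (@std_form m).
Proof.
split=> u a x y; rewrite /std_form /= mulr_sumr -big_split /=;
  apply: eq_bigr => i _; rewrite !mxE.
  by rewrite mulrDl mulrA.
by rewrite rmorphD rmorphM mulrDr mulrCA.
Qed.
HB.instance Definition _ (m : nat) :=
  bilinear_isBilinear.Build E 'rV[E]_m 'rV[E]_m E _ _ (@std_form m)
    (@std_form_bilinear m).
Fact std_form_hermitian (m : nat) (x y : 'rV[E]_m) :
  std_form x y = (-1) ^+ false * conjE (std_form y x).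
Proof.
rewrite mul1r rmorph_sum; apply: eq_bigr => i _.
by rewrite rmorphM /= conjEK mulrC.
Qed.
HB.instance Definition _ (m : nat) :=
  @isHermitianSesquilinear.Build E 'rV[E]_m false conjE (@std_form m)
    (@std_form_hermitian m).

(* O^m with std_form is I_m. *)
Definition std_lattice (m : nat) : set 'rV[E]_m :=
  [set x | forall i, ringO (x 0 i)].

(* E^o with line_form c is the one-dimensional space E v with v = 1, h(v) = c. *)
Definition line_form (c : rat) (x y : E^o) : E := ratr c * (x * conjE y).

Fact line_form_bilinear (c : rat) :
  bilinear_for ( *%R : GRing.Scale.law E E)
    (conjE \; *%R : GRing.Scale.law E E) (line_form c).
Proof.
by split=> u a x y; rewrite /line_form /= ?rmorphD ?rmorphM /GRing.scale /=; ring.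
Qed.
HB.instance Definition _ (c : rat) :=
  bilinear_isBilinear.Build E E^o E^o E _ _ (line_form c)
    (line_form_bilinear c).
Fact line_form_hermitian (c : rat) (x y : E^o) :
  line_form c x y = (-1) ^+ false * conjE (line_form c y x).
Proof.
have cQ : conjE (ratr c) = ratr c by exact: fmorph_rat.
by rewrite mul1r [RHS]rmorphM (rmorphM _ y) /= cQ conjEK; congr (_ * _); exact: mulrC.
Qed.
HB.instance Definition _ (c : rat) :=
  @isHermitianSesquilinear.Build E E^o false conjE (line_form c)
    (line_form_hermitian c).

(* L belongs to S_d(1). *)
Definition in_S1 (V : lmodType E) (h : {hermitian V for false & conjE})
    (L : set V) : Prop :=
  [/\ unary L, posdef_integral h L &
      exists2 m : nat, (1 <= m)%N & represented h L (@std_form m) (@std_lattice m)].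

Definition S1_represented_by (g : nat) : Prop :=
  forall (V : lmodType E) (h : {hermitian V for false & conjE}) (L : set V),
    in_S1 h L -> represented h L (@std_form g) (@std_lattice g).

(* The relation g_d(1) = g. *)
Definition is_g1 (g : nat) : Prop :=
  [/\ (0 < g)%N, S1_represented_by g &
      forall g' : nat, (0 < g')%N -> S1_represented_by g' -> (g <= g')%N].

End ImQuad.

(* class3_data d k a2 a3 r0 ex g: U_2 = (k, a2 + omega), U_3 = (k, a3 + omega),
   R_d = {r >= r0 | r not in ex}, g_d(1) = g. *)
Inductive class3_data : nat -> nat -> int -> int -> nat -> seq nat -> nat -> Prop :=
| data23 : class3_data 23 2 0 (-1) 2 [::] 3
| data31 : class3_data 31 2 0 (-1) 2 [:: 3]%N 4
| data59 : class3_data 59 3 0 (-1) 3 [:: 4]%N 4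
| data83 : class3_data 83 3 0 (-1) 3 [:: 4; 5; 8]%N 4
| data107 : class3_data 107 3 0 (-1) 3 [:: 4; 5; 7; 8; 10]%N 4
| data139 : class3_data 139 5 0 (-1) 5 [:: 6; 8; 9]%N 4
| data211 : class3_data 211 5 1 (-2) 5 [:: 6; 7; 8; 9; 12; 14; 17]%N 4
| data283 : class3_data 283 7 2 (-3) 7 [:: 8; 9; 10; 12; 15; 16; 17; 19]%N 4
| data307 : class3_data 307 7 0 (-1) 7
    [:: 8; 9; 10; 12; 13; 15; 16; 20; 23; 27]%N 4
| data331 : class3_data 331 5 1 (-2) 5
    [:: 6; 7; 8; 9; 11; 12; 13; 14; 16; 18; 21; 23; 26; 28; 33]%N 4
| data379 : class3_data 379 5 0 (-1) 5
    [:: 6; 7; 8; 9; 11; 12; 13; 14; 16; 17; 18; 21; 22; 26; 27; 31; 32; 36]%N 4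
| data499 : class3_data 499 5 0 (-1) 5
    [:: 6; 7; 8; 9; 11; 12; 13; 14; 16; 17; 18; 19; 21; 22; 23; 24; 26; 27; 28;
        32; 33; 37; 38; 42]%N 4
| data547 : class3_data 547 11 2 (-3) 11
    [:: 12; 14; 15; 16; 17; 18; 20; 21; 23; 25; 27; 28; 31; 34; 36]%N 4
| data643 : class3_data 643 7 0 (-1) 7
    [:: 8; 9; 10; 11; 12; 13; 15; 16; 17; 18; 19; 20; 22; 24; 25; 26; 27; 32;
        33; 34; 39; 40; 41; 47; 48; 55]%N 4
| data883 : class3_data 883 13 0 (-1) 13
    [:: 14; 15; 16; 18; 19; 20; 21; 22; 23; 24; 25; 27; 28; 32; 33; 35; 36; 37;
        38; 40; 41; 45; 49; 50; 53; 54; 66]%N 4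
| data907 : class3_data 907 13 4 (-5) 13
    [:: 14; 15; 16; 17; 18; 20; 21; 22; 24; 25; 27; 28; 29; 30; 31; 33; 34; 35;
        37; 40; 43; 44; 47; 48; 50; 56; 63]%N 5.

(* Main.v *)
(** Write w for omega and N(a + w) = a^2 + a + (d + 1) / 4. If k c = N(a + w), the unary lattice
    (k, a + w) v with h(v) = r / k is represented by I_m if and only if r is a sum of m values of
    the binary form k z^2 - (2 a + 1) z y + c y^2. Scaling a fractional ideal by a vector of
    minimal norm brings it to the form (a, t + w) with a^2 <= N(t + w) and |2 t + 1| <= a, which
    leaves finitely many candidates, here exactly the three listed classes.

    It remains to find the sums of g values of these forms. Since k is a value, r = m k + i is
    such a sum as soon as some value u k + i makes m - u a sum of three squares. This holds when
    m - u is 1 mod 4 or 4 mod 16, because every K = 1 mod 4 is x^2 + 4 y^2 + 4 z^2, and only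
    finitely many r are left. The numbers outside R_d and the minimality of g are finite checks;
    for d = 23, where g = 3, explicit identities replace the argument for large r.

    For the three-square statement, work with series in a nilpotent t. With the odd Lambert
    factor g(e) = (1 + t^(4e)) / (1 - t^(4e)), a telescoping argument gives C th3 = P th2 and
    F th4 = P H. Comparing the first identity with the divisor sums in C and P proves Jacobi's
    two-square theorem by induction on the exponent, that is C = th2 th3 and P = th3^2. Twisting
    t by an eighth root of unity gives H = th2 th4, hence F = th2 th3^2, and the coefficients of
    F at exponents 1 mod 4 are positive by inspection. *)
From Stdlib Require Import ZArith.
From HB Require Import structures.
Require Import Defs.
From mathcomp Require Import all_boot all_order all_algebra all_field.
From mathcomp Require Import sesquilinear classical_sets.
From mathcomp Require Import zify ssrZ ring lra qpoly boolp.
Set Implicit Arguments.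
Unset Strict Implicit.
Unset Printing Implicit Defensive.
Import Order.TTheory GRing.Theory Num.Theory.
Local Open Scope ring_scope.

(** * Symmetric sums over the integers *)

(** An embedding of (k, a + w) v into I_m is multiplication of one vector whose coordinates all lie
    in the inverse ideal, the conjugate ideal divided by k. The norm there is the binary form
    divided by k, and this is where sums of m values come from. Conjugating the ideal changes only
    the sign of the middle coefficient, so the two nonprincipal classes share R_d. As m is unbounded
    in the definition of S_d(1), no search over sums of m values can exclude a number r.

    With four values, one of them has to fix r mod k, and the other three are k times squares.
    Varying the first one moves m - u among residue classes, so only one class of sums of three
    squares has to be understood; there a generating function with nonnegative coefficients decides
    existence. For d = 907 four values still reach every large r, and g = 5 comes from small r such
    as 81.

    All series are finite sums in a commutative ring with t^N = 0, so no convergence enters and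
    every factor 1 + t s can be cancelled. *)

Section SymmetricSums.
Variable R : comNzRingType.
Implicit Types (f g : int -> R) (B N : nat).

Definition bsum B f : R :=
  f 0 + \sum_(i < B) (f i.+1%:Z + f (- i.+1%:Z)).

Lemma bsum0 f : bsum 0 f = f 0.
Proof. by rewrite /bsum big_ord0 addr0. Qed.

Lemma bsumS B f : bsum B.+1 f = bsum B f + f B.+1%:Z + f (- B.+1%:Z).
Proof. by rewrite /bsum big_ord_recr /= !addrA. Qed.

Lemma eq_bsum B f g : f =1 g -> bsum B f = bsum B g.
Proof. by move=> fg; rewrite /bsum fg; congr (_ + _); apply: eq_bigr => i _; rewrite !fg. Qed.

Lemma bsumD B f g : bsum B (fun i => f i + g i) = bsum B f + bsum B g.
Proof.
elim: B => [|B IH]; first by rewrite !bsum0.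
by rewrite !bsumS IH; ring.
Qed.

Lemma bsumMl B (a : R) f : bsum B (fun i => a * f i) = a * bsum B f.
Proof.
elim: B => [|B IH]; first by rewrite !bsum0.
by rewrite !bsumS IH; ring.
Qed.

Lemma bsumN B f : bsum B (fun i => - f i) = - bsum B f.
Proof. by rewrite -mulN1r -bsumMl; apply: eq_bsum => i; rewrite mulN1r. Qed.

Lemma bsumB B f g : bsum B (fun i => f i - g i) = bsum B f - bsum B g.
Proof. by rewrite bsumD bsumN. Qed.

Lemma bsum_exchange A B (f : int -> int -> R) :
  bsum A (fun i => bsum B (f i)) = bsum B (fun j => bsum A (fun i => f i j)).
Proof.
elim: A => [|A IH].
  by rewrite bsum0; apply: eq_bsum => j; rewrite bsum0.
rewrite bsumS IH -!bsumD; apply: eq_bsum => j; by rewrite bsumS.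
Qed.

Lemma bsum_opp B f : bsum B (fun i => f (- i)) = bsum B f.
Proof.
elim: B => [|B IH]; first by rewrite !bsum0 oppr0.
by rewrite !bsumS IH opprK; ring.
Qed.

Definition oddf f := f 0 = 0 /\ forall i, f (- i) = - f i.

Lemma bsum_odd B f : oddf f -> bsum B f = 0.
Proof.
case=> f0 fN; elim: B => [|B IH]; first by rewrite bsum0.
by rewrite bsumS IH fN add0r subrr.
Qed.

Definition supp N f := forall i, (N <= `|i|)%N -> f i = 0.

Lemma bsum_widen N B f : supp N f -> (N <= B)%N -> bsum B f = bsum N f.
Proof.
move=> fN; elim: B => [|B IH]; first by rewrite leqn0 => /eqP ->.
rewrite leq_eqVlt => /orP[/eqP <- //|]; rewrite ltnS => NB.
by rewrite bsumS IH // !fN ?addr0 //; lia.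
Qed.

Lemma bsum_succ B f : bsum B (fun i => f (i + 1)) = bsum B f + f (B%:Z + 1) - f (- B%:Z).
Proof.
elim: B => [|B IH]; first by rewrite !bsum0 add0r oppr0; ring.
rewrite !bsumS IH.
have -> : - B.+1%:Z + 1 = - B%:Z by lia.
have -> : B%:Z + 1 = B.+1%:Z by lia.
ring.
Qed.

Lemma bsum_shift N B (c : int) f : supp N f -> (N + `|c| <= B)%N ->
  bsum B (fun i => f (i + c)) = bsum N f.
Proof.
wlog: c f / 0 <= c => [H fN NB|].
  case: (lerP 0 c) => c0; first exact: H.
  rewrite -bsum_opp.
  rewrite -[RHS]bsum_opp -(H (- c) (fun i => f (- i))) //; first 2 last.
  - by move=> i iN; apply: fN; lia.
  - lia.
  - by apply: eq_bsum => i; congr f; lia.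
  - lia.
case: c => // n _ fN; elim: n => [|n IH] NB.
  rewrite -(bsum_widen fN (B := B)); last lia.
  by apply: eq_bsum => i; rewrite addr0.
have -> : bsum B (fun i => f (i + n.+1%:Z)) =
          bsum B (fun i => (fun j : int => f (j + n%:Z)) (i + 1)).
  by apply: eq_bsum => i; congr f; lia.
rewrite (bsum_succ B (fun j : int => f (j + n%:Z))) IH; last lia.
by rewrite (fN (B%:Z + 1 + n%:Z)) ?(fN (- B%:Z + n%:Z)) ?addr0 ?subr0 //; lia.
Qed.

Lemma bsum_reflect N B (c : int) f : supp N f -> (N + `|c| <= B)%N ->
  bsum B (fun i => f (c - i)) = bsum N f.
Proof.
move=> fN NB; rewrite -(bsum_shift fN NB) -bsum_opp.
by apply: eq_bsum => i; congr f; lia.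
Qed.

(** The value at the origin is kept, so the extension is odd only if [f 0 = 0]. *)
Definition oddx (f : nat -> R) (e : int) : R :=
  match e with Posz n => f n | Negz n => - f n.+1 end.

Lemma oddxN (f : nat -> R) e : f 0%N = 0 -> oddx f (- e) = - oddx f e.
Proof. by move=> f0; case: e => [[|n]|n] //=; rewrite ?opprK // f0 oppr0. Qed.

Lemma oddx_odd (f : nat -> R) : f 0%N = 0 -> oddf (oddx f).
Proof. by move=> f0; split=> // e; rewrite oddxN. Qed.

End SymmetricSums.

(** * Theta and Lambert series in a nilpotent variable *)

(** The nontrivial Dirichlet character modulo 4; its square serves below as the indicator of odd
    numbers. *)
Definition chi (n : nat) : int :=
  if (n %% 4 == 1)%N then 1 else if (n %% 4 == 3)%N then -1 else 0.

Lemma chi_odd n : chi n != 0 -> odd n.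
Proof. by rewrite /chi; case: (n %% 4 == 1)%N / eqP => [|_]; [lia|case: (n %% 4 == 3)%N / eqP => [|//]; lia]. Qed.

Lemma chi_even n : ~~ odd n -> chi n = 0.
Proof. by move=> n2; apply/eqP; apply: contraNT n2 => /chi_odd. Qed.

Lemma chiD2 n : chi n.+2 = - chi n.
Proof.
rewrite /chi; have : (n %% 4 < 4)%N by rewrite ltn_mod.
have -> : (n.+2 %% 4 = (n %% 4 + 2) %% 4)%N by lia.
by case: (n %% 4)%N => [|[|[|[|]]]].
Qed.

Lemma chi_sqr n : odd n -> chi n ^+ 2 = 1.
Proof.
rewrite /chi => n2; case: (n %% 4 == 1)%N / eqP => [_|h1]; first by rewrite expr1n.
case: (n %% 4 == 3)%N / eqP => [_|h3]; last lia.
by rewrite sqrrN expr1n.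
Qed.

Section Theta.
Variables (R : comNzRingType) (t : R) (N : nat).
Hypothesis tN : t ^+ N = 0.
Hypothesis N0 : (0 < N)%N.

Lemma expt0 m : (N <= m)%N -> t ^+ m = 0.
Proof. by move=> Nm; rewrite -(subnKC Nm) exprD tN mul0r. Qed.

(* Since t ^ N = 0, every series is a finite sum: [lam e] is t^(4e) / (1 - t^(4e)), [gn e] is
   (1 + t^(4e)) / (1 - t^(4e)), [kapn e] is t^(2e) / (1 - t^(4e)) and [hn n] is the sum of
   t^(n^2 - 4 b^2) over 2 |b| < n. *)
Definition usq (n : int) : R := t ^+ (`|n| ^ 2)%N.
Definition lam (e : nat) : R := \sum_(k < N) t ^+ (4 * e * k.+1)%N.
Definition gn (e : nat) : R := if e == 0%N then 0 else 1 + 2 * lam e.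
Definition kapn (e : nat) : R := if odd e then t ^+ (2 * e)%N * (1 + lam e) else 0.
Definition hp (k : nat) : R :=
  bsum k (fun b => t ^+ ((2 * k + 1) ^ 2 - 4 * `|b| ^ 2)%N).
Definition hn (n : nat) : R := if odd n then hp n./2 else 0.
Definition chiR (n : nat) : R := (chi n)%:~R.
Definition cu (e : int) : R := oddx chiR e * usq e.

Notation g := (oddx gn).
Notation h := (oddx hn).

Lemma lamE e : (0 < e)%N -> lam e = t ^+ (4 * e)%N + t ^+ (4 * e)%N * lam e.
Proof.
move=> e0; rewrite /lam; set x := t ^+ (4 * e)%N.
have E k : t ^+ (4 * e * k)%N = x ^+ k by rewrite -exprM.
under eq_bigr do rewrite E; rewrite mulr_sumr.
under [in RHS]eq_bigr do rewrite -exprS.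
transitivity (\sum_(i < N.+1) x ^+ i.+1); last by rewrite big_ord_recl expr1.
by rewrite big_ord_recr /= -exprM expt0 ?addr0 //; nia.
Qed.

Lemma lam_big e : (N <= 4 * e)%N -> lam e = 0.
Proof. by move=> Ne; rewrite /lam big1 // => i _; rewrite expt0 //; nia. Qed.

Lemma gn_big e : (N <= e)%N -> gn e = 1.
Proof. by move=> Ne; rewrite /gn lam_big ?mulr0 ?addr0; [case: eqP => //|]; lia. Qed.

Lemma chiR0 : chiR 0 = 0. Proof. by []. Qed.

Lemma usq_big e : (N <= `|e|)%N -> usq e = 0.
Proof. by move=> Ne; rewrite /usq expt0 //; nia. Qed.

Lemma usqN e : usq (- e) = usq e.
Proof. by rewrite /usq abszN. Qed.

Lemma supp_cu : supp N cu.
Proof. by move=> e Ne; rewrite /cu usq_big ?mulr0. Qed.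

Lemma odd_cu : oddf cu.
Proof.
split=> [|e]; first by rewrite /cu /= chiR0 mul0r.
by rewrite /cu (oddxN _ chiR0) usqN mulNr.
Qed.

Lemma supp_oddx (f : nat -> R) : (forall n, (N <= n)%N -> f n = 0) -> supp N (oddx f).
Proof. by move=> H [n|n] /= Nn; rewrite H ?oppr0 //. Qed.

Lemma supp_kap : supp N (oddx kapn).
Proof.
apply: supp_oddx => n Nn; rewrite /kapn; case: ifP => // _.
by rewrite expt0 ?mul0r //; lia.
Qed.

(** With n = 2 k + 1 every exponent in [hn n] is at least 2 n - 1. This keeps the natural
    subtraction exact and makes [hn n] vanish for n >= N. *)
Lemma hp_exp k (b : nat) : (b <= k)%N -> ((4 * k + 1) <= (2 * k + 1) ^ 2 - 4 * b ^ 2)%N.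
Proof. by move=> bk; nia. Qed.

Lemma bsum_eq0 B (f : int -> R) : (forall i, (`|i| <= B)%N -> f i = 0) -> bsum B f = 0.
Proof.
move=> H; elim: B H => [|B IH] H; first by rewrite bsum0 H.
by rewrite bsumS IH ?H ?addr0 // => i iB; apply: H; lia.
Qed.

Lemma eq_bsum_in B (f1 f2 : int -> R) :
  (forall i, (`|i| <= B)%N -> f1 i = f2 i) -> bsum B f1 = bsum B f2.
Proof.
move=> H; apply/eqP; rewrite -subr_eq0 -bsumB; apply/eqP/bsum_eq0 => i iB.
by rewrite H ?subrr.
Qed.

Lemma supp_h : supp N h.
Proof.
apply: supp_oddx => n Nn; rewrite /hn; case: ifP => // n2.
apply: bsum_eq0 => b bn; rewrite expt0 //.
by have := hp_exp bn; lia.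
Qed.

(** The old exponents grow by (2 k + 3)^2 - (2 k + 1)^2 = 8 k + 8; the two new terms are those of b
    = k + 1 and b = - (k + 1). *)
Lemma hpS k : hp k.+1 = t ^+ (8 * k + 8)%N * hp k + 2 * t ^+ (4 * k + 5)%N.
Proof.
rewrite /hp bsumS abszN absz_nat.
have -> : ((2 * k.+1 + 1) ^ 2 - 4 * k.+1 ^ 2 = 4 * k + 5)%N by nia.
rewrite -addrA -mulr2n mulr_natl; congr (_ + _).
rewrite -bsumMl; apply: eq_bsum_in => b bk; rewrite -exprD; congr (_ ^+ _).
by have := hp_exp bk; nia.
Qed.

Lemma hnSS n : odd n -> hn n.+2 = t ^+ (4 * n + 4)%N * hn n + 2 * t ^+ (2 * n + 3)%N.
Proof.
move=> n2; rewrite /hn /= negbK n2 hpS.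
by congr (t ^+ _ * _ + _ * t ^+ _); lia.
Qed.

Lemma h1 : hn 1 = t.
Proof. by rewrite /hn /= /hp bsum0 /= expr1. Qed.

Lemma hn_even n : ~~ odd n -> hn n = 0.
Proof. by rewrite /hn => /negbTE ->. Qed.

(** The functions used for [phi] vanish at even e, and for odd e the argument 2 m - e is odd. So the
    value 0 given to [g] at its pole never contributes; it only makes [g] odd. *)
Definition conv (phi : int -> R) (m : int) : R := bsum N (fun e => phi e * g (2 * m - e)).

Lemma convN phi m : oddf phi -> conv phi (- m) = conv phi m.
Proof.
case=> _ phiN; rewrite /conv -bsum_opp; apply: eq_bsum => e.
have -> : 2 * (- m) - (- e) = - (2 * m - e) by ring.
by rewrite phiN oddxN // mulrNN.
Qed.

(* g(f) (1 - t^(4f)) = 1 + t^(4f), so for f = 2 m - e the recurrence of [phi] cancels the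
   denominator and what remains sums to zero by oddness. *)
Lemma conv_succ phi psi (c : R) (m : nat) : supp N phi -> oddf phi -> supp N psi -> oddf psi ->
  (forall e : int, (phi (e + 2) - c * phi e) * g (2 * m%:Z - e) =
     phi (e + 2) + c * phi e + psi (2 * m%:Z - e)) ->
  conv phi m.+1 = c * conv phi m.
Proof.
move=> sphi ophi spsi opsi H; pose B := (N + 2 * m + 2)%N.
have s' k : supp N (fun e => phi e * g (2 * k - e)).
  by move=> e eN; rewrite sphi ?mul0r.
rewrite /conv -(bsum_shift (c := 2) (B := B) (s' _)); last by rewrite /B; lia.
rewrite -(bsum_widen (B := B) (s' _)); last by rewrite /B; lia.
apply/eqP; rewrite -subr_eq0 -bsumMl -bsumB.
have -> : bsum B (fun i => phi (i + 2) * g (2 * (m.+1)%:Z - (i + 2)) -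
             c * (phi i * g (2 * m%:Z - i))) =
          bsum B (fun e => phi (e + 2) + c * phi e + psi (2 * m%:Z - e)).
  apply: eq_bsum => e; rewrite -H mulrBl mulrA.
  by congr (_ * g _ - _); lia.
rewrite !bsumD bsumMl (bsum_shift sphi) ?(bsum_reflect spsi) ?(bsum_widen sphi) //; try (rewrite /B; lia).
by rewrite !bsum_odd // mulr0 !addr0.
Qed.

(** The factors ep t^(8 j + 4) for j < m multiply to ep^m t^(4 m^2), which is how a theta series in
    m arises. Negative m follow from evenness. *)
Lemma convE phi psi (ep : R) : supp N phi -> oddf phi ->
  (forall m, supp N (psi m) /\ oddf (psi m)) ->
  (forall (m : nat) (e : int),
     (phi (e + 2) - ep * t ^+ (8 * m + 4)%N * phi e) * g (2 * m%:Z - e) =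
     phi (e + 2) + ep * t ^+ (8 * m + 4)%N * phi e + psi m (2 * m%:Z - e)) ->
  forall m : int, conv phi m = ep ^+ `|m| * t ^+ (4 * `|m| ^ 2)%N * conv phi 0.
Proof.
move=> sphi ophi hpsi H.
have P (m : nat) : conv phi m = ep ^+ m * t ^+ (4 * m ^ 2)%N * conv phi 0.
  elim: m => [|m IH]; first by rewrite expr0 !mul1r.
  have [s1 o1] := hpsi m.
  rewrite (conv_succ sphi ophi s1 o1 (H m)) IH exprS.
  have -> : (4 * m.+1 ^ 2 = (8 * m + 4) + 4 * m ^ 2)%N by nia.
  rewrite [in RHS]exprD; ring.
case=> m; first exact: P.
by rewrite NegzE convN // P abszN.
Qed.

Lemma cuSS e : oddx chiR (e + 2) = - oddx chiR e.
Proof.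
case: e => [n|[|[|n]]].
- by rewrite /= /chiR -mulrNz -chiD2 addn2.
- by rewrite /= opprK.
- by rewrite /= opprK /chiR.
- have -> : Negz n.+2 + 2 = Negz n by lia.
  by rewrite /= /chiR chiD2 mulrNz opprK.
Qed.

Lemma gnE e : (0 < e)%N -> gn e = 1 + 2 * lam e.
Proof. by rewrite /gn; case: eqP => // ->. Qed.

Lemma oddx_chi_even (e : int) : ~~ odd `|e| -> oddx chiR e = 0.
Proof. by case: e => n /= n2; rewrite /chiR chi_even ?oppr0. Qed.

Lemma absz_sqrE (e : int) : ((`|e| ^ 2)%N)%:Z = e ^+ 2.
Proof. by rewrite -[RHS]real_normK ?num_real // -abszE. Qed.

Lemma gn_mul F : (0 < F)%N -> t ^+ (4 * F)%N * gn F = gn F - 1 - t ^+ (4 * F)%N.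
Proof.
move=> F0; rewrite gnE //; move: (lam F) (lamE F0) => l L.
have {}L : t ^+ (4 * F)%N * l = l - t ^+ (4 * F)%N by rewrite [X in _ = X - _]L addrAC subrr add0r.
by ring: L.
Qed.

Lemma odd_gap (m : nat) (e : int) : odd `|e| ->
  exists2 F : nat, odd F & e = 2 * m%:Z - F%:Z \/ e = 2 * m%:Z + F%:Z.
Proof.
move=> e2; exists `|(2 * m%:Z - e)%R|%N; first lia.
by case: (lerP 0 (2 * m%:Z - e)); [left|right]; lia.
Qed.

(** Put f = 2 m - e. Then (e + 2)^2 + 4 f = e^2 + 8 m + 4, so for f > 0 the left factor is
    [cu (e + 2)] times 1 - t^(4f), and the denominator of [g] cancels without remainder. For f < 0
    the other power is factored out. *)
Lemma cu_rec (m : nat) (e : int) :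
  (cu (e + 2) - (-1) * t ^+ (8 * m + 4)%N * cu e) * g (2 * m%:Z - e) =
  cu (e + 2) + (-1) * t ^+ (8 * m + 4)%N * cu e + 0.
Proof.
rewrite addr0 /cu cuSS.
have [e2|e2] := boolP (odd `|e|); last first. 
  by rewrite oddx_chi_even //; ring.
move: (oddx chiR e) => a; have [F F2 eF] := odd_gap m e2.
have F0 : (0 < F)%N by case: F F2 {eF}.
have := gn_mul F0; case: eF => -> G.
- have E : t ^+ (8 * m + 4)%N * usq (2 * m%:Z - F%:Z) =
           t ^+ (4 * F)%N * usq (2 * m%:Z - F%:Z + 2).
    rewrite /usq -!exprD; congr (t ^+ _).
    by apply/eqP; rewrite -eqz_nat !PoszD !absz_sqrE; apply/eqP; lia.
  have -> : 2 * m%:Z - (2 * m%:Z - F%:Z) = F by lia.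
  rewrite /=; move: G E.
  move: (gn F) (t ^+ (8 * m + 4)%N) (t ^+ (4 * F)%N) (usq _) (usq _) => G x y b c GE E.
  by ring: GE E.
- have E : usq (2 * m%:Z + F%:Z + 2) =
           t ^+ (4 * F)%N * (t ^+ (8 * m + 4)%N * usq (2 * m%:Z + F%:Z)).
    rewrite /usq -!exprD; congr (t ^+ _).
    by apply/eqP; rewrite -eqz_nat !PoszD !absz_sqrE; apply/eqP; lia.
  have -> : 2 * m%:Z - (2 * m%:Z + F%:Z) = - F%:Z by lia.
  rewrite oddxN //= E; move: G.
  move: (gn F) (t ^+ (8 * m + 4)%N) (t ^+ (4 * F)%N) (usq _) => G x y b GE.
  by ring: GE.
Qed.

(** For positive e and f = 2 m - e, the inhomogeneous term 2 t^(2 e + 3) of [hnSS] leaves 2 t^(2 e +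
    3) (g f - 1). Since 2 e + 2 f = 4 m, this is 4 t^(4 m + 3) [kapn f], which depends on e only
    through f and extends to an odd function of f. *)
Lemma h_rec (m : nat) (e : int) :
  (h (e + 2) - 1 * t ^+ (8 * m + 4)%N * h e) * g (2 * m%:Z - e) =
  h (e + 2) + 1 * t ^+ (8 * m + 4)%N * h e
    + 4 * t ^+ (4 * m + 3)%N * oddx kapn (2 * m%:Z - e).
Proof.
rewrite mul1r.
have [e2|e2] := boolP (odd `|e|); last first. 
  have hE (a : int) : ~~ odd `|a| -> h a = 0.
    by case: a => n n2 /=; rewrite hn_even ?oppr0.
  have kE (a : int) : ~~ odd `|a| -> oddx kapn a = 0.
    by case: a => n /= n2; rewrite /kapn /= (negbTE n2) ?oppr0.
  rewrite !hE ?kE //; first ring; lia.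
have [F F2 eF] := odd_gap m e2.
have F0 : (0 < F)%N by case: F F2 {eF}.
have fF : 2 * m%:Z - e = F \/ 2 * m%:Z - e = - F%:Z by lia.
have kF : kapn F = t ^+ (2 * F)%N * (1 + lam F) by rewrite /kapn F2.
have lF : lam F = t ^+ (2 * F)%N ^+ 2 * (1 + lam F).
  by rewrite [LHS]lamE // mulrDr mulr1 -exprM; congr (t ^+ _ + t ^+ _ * _); lia.
have gF := gnE F0.
have {}lF : t ^+ (2 * F)%N ^+ 2 * lam F = lam F - t ^+ (2 * F)%N ^+ 2.
  by rewrite [X in _ = X - _]lF; ring.
(* The recurrence [hnSS] links positive odd numbers only, so the step from e = -1 to e + 2 = 1 is a
   case of its own. *)
have [[n en]|[em|[n en]]] : (exists n : nat, e = n) \/ e = -1 \/ exists n, e = - (n.+2%:Z).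
  case: e {e2 eF fF} => [n|[|n]]; [by left; exists n|by right; left|right; right].
  by exists n; lia.
- have n2 : odd n by lia.
  have he2 : h (e + 2) = t ^+ (4 * n + 4)%N * hn n + 2 * t ^+ (2 * n + 3)%N.
    by rewrite -(hnSS n2) en; have -> : n%:Z + 2 = n.+2 by lia.
  rewrite he2; have -> : h e = hn n by rewrite en.
  case: eF fF => eF _.
  + have -> : 2 * m%:Z - e = F by lia.
    have -> : (8 * m + 4 = (4 * n + 4) + (2 * F) * 2)%N by lia.
    have -> : (4 * m + 3 = (2 * n + 3) + 2 * F)%N by lia.
    rewrite /= gF kF.
    move: (2 * F)%N (4 * n)%N (2 * n)%N lF => f n4 n2' lF.
    by rewrite !(exprD, exprM _ _ 2); ring: lF.
  + have -> : 2 * m%:Z - e = - F%:Z by lia.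
    have -> : (4 * n + 4 = (8 * m + 4) + (2 * F) * 2)%N by lia.
    have -> : (2 * n + 3 = (4 * m + 3) + 2 * F)%N by lia.
    rewrite !oddxN //= gF kF.
    move: (2 * F)%N (4 * m)%N (8 * m)%N lF => f n4 n2' lF.
    by rewrite !(exprD, exprM _ _ 2); ring: lF.
- have -> : 2 * m%:Z - e = F by lia.
  have -> : e + 2 = 1 by lia.
  rewrite em /= h1 gF kF.
  have -> : (8 * m + 4 = (2 * F) * 2)%N by lia.
  have -> : t ^+ (2 * F)%N = t ^+ (4 * m + 2)%N by congr (t ^+ _); lia.
  move: lF; have -> : (2 * F = 4 * m + 2)%N by lia.
  move: (4 * m)%N => m4; rewrite !(exprM _ _ 2) !exprD; move: (t ^+ m4) => x lF.
  have {}lF : x ^+ 2 * t ^+ 4 * lam F = lam F - x ^+ 2 * t ^+ 4 by move: lF; rewrite exprMn -exprM.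
  by ring: lF.
- have n2 : odd n by lia.
  have -> : 2 * m%:Z - e = F by lia.
  have -> : e + 2 = - n%:Z by lia.
  rewrite en !oddxN // /oddx hnSS //.
  rewrite gF kF.
  have -> : t ^+ (2 * F)%N = t ^+ (4 * m)%N * t ^+ (2 * n)%N * t ^+ 4.
    by rewrite -!exprD; congr (t ^+ _); lia.
  move: lF; have -> : t ^+ (2 * F)%N = t ^+ (4 * m)%N * t ^+ (2 * n)%N * t ^+ 4.
    by rewrite -!exprD; congr (t ^+ _); lia.
  have -> : (8 * m = 4 * m * 2)%N by lia.
  have -> : (4 * n = 2 * n * 2)%N by lia.
  move: (4 * m)%N (2 * n)%N => m4 n2'.
  rewrite !(exprD, exprM _ m4 2, exprM _ n2' 2); move: (t ^+ m4) (t ^+ n2') => x y lF.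
  have {}lF : x ^+ 2 * y ^+ 2 * t ^+ 8 * lam F = lam F - x ^+ 2 * y ^+ 2 * t ^+ 8.
    by have -> : x ^+ 2 * y ^+ 2 * t ^+ 8 = (x * y * t ^+ 4) ^+ 2 by ring.
  by ring: lF.
Qed.

Lemma signSz (m : int) : (-1) ^+ `|m - 1|%N = - (-1) ^+ `|m|%N :> R.
Proof.
rewrite -signr_odd -[in RHS]signr_odd.
have -> : odd `|m - 1|%N = ~~ odd `|m|%N by lia.
by case: (odd _); rewrite ?expr0 ?expr1 ?opprK.
Qed.

(** The terms do not decay, since [g] is 1 and -1 far out; the symmetric cutoff is what gives the
    alternating sum its value. *)
Definition altg (n : int) : R := bsum N (fun m => (-1) ^+ `|m|%N * g (2 * m - n)).
Definition Pser : R := 1 + 4 * \sum_(k < N) (-1) ^+ k * lam (2 * k + 1).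

Lemma g_big n : (N%:Z <= n) -> g n = 1.
Proof. by case: n => n Nn; [rewrite /= gn_big|lia]. Qed.

(** Shifting m by 1 flips the sign and leaves one boundary term at each end. There [g] is 1 and -1,
    the parities of m are opposite, and the terms cancel; the bound on n ensures that both ends are
    in the constant range of [g]. *)
Lemma altgSS n : (`|n| <= N)%N -> altg (n + 2) = - altg n.
Proof.
move=> nN; pose G (m : int) : R := (-1) ^+ `|m - 1|%N * g (2 * (m - 1) - n).
have -> : altg (n + 2) = - bsum N G.
  rewrite -bsumN; apply: eq_bsum => m; rewrite /G signSz mulNr opprK.
  by congr (_ * g _); lia.
have -> : altg n = bsum N (fun m => G (m + 1)).
  by apply: eq_bsum => m; rewrite /G addrK.
rewrite bsum_succ /G !signSz.
have -> : - N%:Z - 1 = - (N.+1)%:Z by lia.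
have -> : 2 * - (N.+1)%:Z - n = - (2 * (N.+1)%:Z + n) by lia.
rewrite addrK oddxN // !g_big; try lia.
have -> : `|(N%:Z + 1)%R|%N = N.+1 by lia.
by rewrite abszN absz_nat exprS; ring.
Qed.

Lemma altgN n : altg (- n) = - altg n.
Proof.
rewrite /altg -bsum_opp -bsumN; apply: eq_bsum => m.
have -> : 2 * - m - - n = - (2 * m - n) by ring.
by rewrite abszN oddxN // mulrN.
Qed.

(** The terms of m and 1 - m agree. The one left over, m = - N, carries (-1)^N and completes twice
    the finite sum 1 - 1 + 1 - ... to exactly 1. *)
Lemma altg1 : altg 1 = - Pser.
Proof.
have H M : bsum M (fun m => (-1) ^+ `|m|%N * g (2 * m - 1)) =
   - 2 * (\sum_(k < M) (-1) ^+ k * gn (2 * k + 1)) - (-1) ^+ M * gn (2 * M + 1).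
  elim: M => [|M IH]; first by rewrite bsum0 big_ord0 /=; ring.
  rewrite bsumS IH big_ord_recr abszN absz_nat.
  have -> : 2 * (M.+1)%:Z - 1 = (2 * M + 1)%N by lia.
  have -> : 2 * - (M.+1)%:Z - 1 = - (2 * M.+1 + 1)%N%:Z by lia.
  by rewrite oddxN //= exprS; ring.
have S1 M : 2 * (\sum_(k < M) (-1) ^+ k) + (-1) ^+ M = 1 :> R.
  elim: M => [|M IH]; first by rewrite big_ord0; ring.
  by rewrite big_ord_recr /= exprS -[RHS]IH; ring.
rewrite /altg H gn_big; last lia.
have -> : \sum_(k < N) (-1) ^+ k * gn (2 * k + 1) =
   (\sum_(k < N) (-1) ^+ k) + 2 * \sum_(k < N) (-1) ^+ k * lam (2 * k + 1) :> R.
  rewrite mulr_sumr -big_split /=; apply: eq_bigr => k _.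
  by rewrite gnE ?addn1 //; ring.
have -> : (-1) ^+ N = 1 - 2 * \sum_(k < N) (-1) ^+ k :> R.
  by rewrite -[X in X - _](S1 N) addrAC subrr add0r.
by rewrite /Pser; ring.
Qed.

Lemma altgE n : odd `|n| -> (`|n| <= N)%N -> altg n = - Pser * oddx chiR n.
Proof.
have P k : (2 * k + 1 <= N)%N -> altg (2 * k + 1)%N = - Pser * chiR (2 * k + 1).
  elim: k => [|k IH] kN; first by rewrite altg1 /chiR mulr1.
  have -> : (2 * k.+1 + 1)%N%:Z = (2 * k + 1)%N%:Z + 2 by lia.
  rewrite altgSS ?IH; try lia.
  have -> : (2 * k.+1 + 1 = (2 * k + 1).+2)%N by lia.
  by rewrite /chiR chiD2 mulrNz mulrN.
move=> n2 nN; case: (lerP 0 n) => n0.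
  have -> : n = (2 * (`|n|./2) + 1)%N by lia.
  by rewrite P //; lia.
have -> : n = - (2 * (`|n|./2) + 1)%N%:Z by lia.
rewrite altgN P; last lia.
by rewrite oddxN ?mulrN // /chiR.
Qed.

(* Evaluates the alternating sum of [conv phi m] over m in two ways: as a theta series times
   [conv phi 0] by [convE], and by summing over m first by [altgE]. *)
Lemma conv_alt phi psi (ep : R) : supp N phi -> oddf phi ->
  (forall e : int, ~~ odd `|e| -> phi e = 0) ->
  (forall m, supp N (psi m) /\ oddf (psi m)) ->
  (forall (m : nat) (e : int),
     (phi (e + 2) - ep * t ^+ (8 * m + 4)%N * phi e) * g (2 * m%:Z - e) =
     phi (e + 2) + ep * t ^+ (8 * m + 4)%N * phi e + psi m (2 * m%:Z - e)) ->
  bsum N (fun e => phi e * g e) * bsum N (fun m => (- ep) ^+ `|m| * t ^+ (4 * `|m| ^ 2)%N)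
   = Pser * bsum N (fun e => phi e * oddx chiR e).
Proof.
move=> sphi ophi ephi hpsi H; have VE := convE sphi ophi hpsi H.
have V0 : conv phi 0 = - bsum N (fun e => phi e * g e).
  rewrite /conv -bsumN; apply: eq_bsum => e.
  by rewrite mulr0 sub0r oddxN // mulrN.
transitivity (- bsum N (fun m => (-1) ^+ `|m| * conv phi m)).
  rewrite -bsumMl -bsumN; apply: eq_bsum => m; rewrite VE V0 (exprNn ep).
  by move: (t ^+ _) => x; ring.
rewrite /conv -bsumMl; under eq_bsum do rewrite -bsumMl.
rewrite bsum_exchange -bsumN; apply: eq_bsum_in => e eN.
transitivity (- (phi e * altg e)).
  by congr (- _); rewrite /altg -bsumMl; apply: eq_bsum => m; ring.
have [e2|e2] := boolP (odd `|e|); last by rewrite ephi //; ring.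
by rewrite altgE //; ring.
Qed.

Definition th2 : R := bsum N (fun e => if odd `|e| then usq e else 0).
Definition th3 : R := bsum N (fun m => t ^+ (4 * `|m| ^ 2)%N).
Definition th4 : R := bsum N (fun m => (-1) ^+ `|m| * t ^+ (4 * `|m| ^ 2)%N).
Definition Cser : R := bsum N (fun e => cu e * g e).
Definition Fser : R := bsum N (fun e => h e * g e).
Definition Hser : R := bsum N (fun e => h e * oddx chiR e).

Lemma Cser_th3 : Cser * th3 = Pser * th2.
Proof.
have -> : th3 = bsum N (fun m => (- (-1)) ^+ `|m| * t ^+ (4 * `|m| ^ 2)%N).
  by apply: eq_bsum => m; rewrite opprK expr1n mul1r.
rewrite (conv_alt (psi := fun _ _ => 0)) //; first last.
- exact: cu_rec.
- by move=> _; split=> //; split=> // i; rewrite oppr0.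
- by move=> e e2; rewrite /cu oddx_chi_even // mul0r.
- exact: odd_cu.
- exact: supp_cu.
congr (_ * _); apply: eq_bsum => e; rewrite /cu mulrAC -expr2.
have [e2|e2] := boolP (odd `|e|); last by rewrite oddx_chi_even // expr0n mul0r.
have -> : oddx chiR e ^+ 2 = chiR `|e| ^+ 2 by case: e {e2} => n //=; rewrite sqrrN.
by rewrite /chiR -rmorphXn /= chi_sqr // mul1r.
Qed.

Lemma Fser_th4 : Fser * th4 = Pser * Hser.
Proof.
rewrite /Fser /th4.
rewrite (conv_alt (psi := fun m f => 4 * t ^+ (4 * m + 3)%N * oddx kapn f)) //; first last.
- exact: h_rec.
- move=> m; split; first by move=> i iN; rewrite supp_kap ?mulr0.
  by split=> [|i]; rewrite ?mulr0 // oddxN // mulrN.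
- by case=> n /= n2; rewrite hn_even ?oppr0.
- exact: oddx_odd.
- exact: supp_h.
Qed.

End Theta.

(** Realised by Z[X]/(X^N). The third property includes m >= N, where t^m = 0 and every coefficient
    below N is 0. *)
Lemma truncated_ring N : (1 < N)%N ->
  exists (R : comNzRingType) (t : R) (cf : nat -> R -> int),
  [/\ t ^+ N = 0, forall K, zmod_morphism (cf K),
      forall m K, (K < N)%N -> cf K (t ^+ m) = (m == K)%:R &
      forall x, (forall K, (K < N)%N -> cf K x = 0) -> x = 0].
Proof.
move=> N1; pose P : {poly int} := 'X^N.
have NX : mk_monic P = 'X^N by rewrite /P mk_monic_Xn prednK //; apply: ltnW.
have sN : size (mk_monic P) = N.+1 by rewrite NX size_polyXn.
pose t : {poly %/ P} := in_qpoly P 'X.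
have tE m : t ^+ m = in_qpoly P 'X^m by rewrite [RHS]rmorphXn.
have small m : (m < N)%N -> t ^+ m = 'X^m :> {poly int}.
  by move=> mN; rewrite tE in_qpoly_small // size_polyXn sN.
have tN m : (N <= m)%N -> t ^+ m = 0.
  move=> Nm; rewrite -(subnKC Nm) exprD tE.
  suff -> : in_qpoly P 'X^N = 0 by rewrite mul0r.
  by apply: val_inj; rewrite /= NX Pdiv.RingMonic.rmodpp ?monicXn.
exists {poly %/ P}, t, (fun K (x : {poly %/ P}) => (polyn x)`_K); split.
- exact: tN.
- by move=> K x y; rewrite /= coefB.
- move=> m K KN; case: (ltnP m N) => mN; first by rewrite small // coefXn eq_sym.
  by rewrite tN // coef0; case: eqP => // E; rewrite -E ltnNge mN in KN.
- move=> x H; apply: val_inj; apply/polyP => K; rewrite [RHS]coef0.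
  case: (ltnP K N) => KN; first exact: H.
  rewrite nth_default //; apply: leq_trans KN.
  by rewrite -ltnS -sN; exact: size_mk_monic.
Qed.

(** * Collecting the coefficients of finite sums *)

Fixpoint zrange (B : nat) : seq int :=
  if B is B'.+1 then B'.+1%:Z :: - (B'.+1%:Z) :: zrange B' else [:: 0].

Lemma mem_zrange B (i : int) : (i \in zrange B) = (`|i| <= B)%N.
Proof.
elim: B => [|B IH]; first by rewrite inE; lia.
rewrite [zrange B.+1]/= !inE IH; lia.
Qed.

Lemma zrange_uniq B : uniq (zrange B).
Proof.
elim: B => [|B IH] //.
by rewrite [zrange B.+1]/= !cons_uniq !inE IH !mem_zrange; lia.
Qed.

Lemma bsumE (R : comNzRingType) B (f : int -> R) : bsum B f = \sum_(i <- zrange B) f i.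
Proof.
elim: B => [|B IH]; first by rewrite bsum0 big_seq1.
by rewrite bsumS IH [zrange B.+1]/= !big_cons; ring.
Qed.

Section Collect.
Variables (R : comNzRingType) (t : R) (N : nat).
Hypothesis tN : t ^+ N = 0.

Lemma collect (I : Type) (s : seq I) (c : I -> int) (e : I -> nat) :
  \sum_(i <- s) (c i)%:~R * t ^+ e i =
  \sum_(m < N) (\sum_(i <- s | e i == m) c i)%:~R * t ^+ m.
Proof.
transitivity (\sum_(i <- s) \sum_(m < N) (if e i == m then (c i)%:~R * t ^+ m else 0)).
  apply: eq_bigr => i _; rewrite -big_mkcond.
  case: (ltnP (e i) N) => eN; last first.
    rewrite big1 ?(expt0 tN) ?mulr0 // => j /eqP E.
    by have := ltn_ord j; rewrite -E ltnNge eN.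
  by rewrite (big_pred1 (Ordinal eN)) //= => j; rewrite -val_eqE /= eq_sym.
rewrite exchange_big; apply: eq_bigr => m _ /=.
rewrite [in RHS]big_mkcond /= rmorph_sum mulr_suml; apply: eq_bigr => i _.
by case: ifP => _; rewrite ?mul0r.
Qed.

Lemma lambert (c : nat -> nat -> int) :
  \sum_(1 <= d < N) \sum_(1 <= e < N) (c d e)%:~R * t ^+ (d * e)%N =
  \sum_(1 <= m < N) (\sum_(1 <= d < N | (d %| m)%N) c d (m %/ d)%N)%:~R * t ^+ m.
Proof.
transitivity (\sum_(1 <= d < N) \sum_(1 <= m < N | (d %| m)%N) (c d (m %/ d)%N)%:~R * t ^+ m).
  apply: eq_big_nat => d /andP[d1 dN].
  transitivity (\sum_(1 <= e < N) \sum_(1 <= m < N | m == (d * e)%N)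
                   (c d (m %/ d)%N)%:~R * t ^+ m).
    apply: eq_big_nat => e /andP[e1 eN].
    case: (ltnP (d * e) N) => deN; last first.
      rewrite big_nat_cond big1 ?(expt0 tN) ?mulr0 // => j /andP[/andP[_ jN] /eqP E]; lia.
    rewrite big_nat1_eq deN muln_gt0 d1 e1 /=.
    by rewrite mulKn.
  rewrite (exchange_big_dep (fun m => d %| m)%N) /=; last first.
    by move=> e m _ /eqP ->; rewrite dvdn_mulr.
  apply: congr_big_nat => // m /andP[dm /andP[m1 mN]].
  have [k km] := dvdnP dm.
  rewrite (big_nat_cond _ _ _ _ (fun e => m == d * e)%N).
  rewrite (eq_bigl (fun e => (1 <= e < N)%N && (e == k))); last first.
    move=> e; congr (_ && _); by rewrite km [(k * d)%N]mulnC eqn_pmul2l // eq_sym.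
  by rewrite -big_nat_cond big_nat1_eq; case: ifP => // H; nia.
rewrite (exchange_big_dep xpredT) //=; apply: eq_bigr => m _.
by rewrite rmorph_sum mulr_suml.
Qed.

End Collect.

(** * Jacobi's two-square theorem *)

Definition box (B : nat) : seq (int * int) := [seq (x, y) | x <- zrange B, y <- zrange B].

Lemma mem_box B p : (p \in box B) = (`|p.1| <= B)%N && (`|p.2| <= B)%N.
Proof.
case: p => x y; rewrite -!mem_zrange; apply/allpairsP/andP => [[[a b] /= [aB bB [-> ->]]]|[xB yB]]; first by split.
by exists (x, y).
Qed.

Lemma box_uniq B : uniq (box B).
Proof. by apply: allpairs_uniq; rewrite ?zrange_uniq // => -[a b] [c d] _ _ /= [-> ->]. Qed.

Definition reps2 (m : nat) : seq (int * int) :=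
  [seq p <- box m | p.1 ^+ 2 + p.2 ^+ 2 == m%:Z].

Definition reps4 (m : nat) : seq (int * int) :=
  [seq p <- box m | odd `|p.1| && (p.1 ^+ 2 + 4 * p.2 ^+ 2 == m%:Z)].

Lemma mem_reps2 m p : (p \in reps2 m) = (p.1 ^+ 2 + p.2 ^+ 2 == m%:Z).
Proof.
rewrite mem_filter mem_box; case: eqP => //= E; apply/idP; apply/andP.
by split; nia.
Qed.

Lemma mem_reps4 m p : (p \in reps4 m) = odd `|p.1| && (p.1 ^+ 2 + 4 * p.2 ^+ 2 == m%:Z).
Proof.
rewrite mem_filter mem_box; case: eqP => [E|]; last by rewrite andbF.
have h (z : int) : `|z|%N%:Z <= z ^+ 2 by nia.
case: (odd _) => //=; apply/idP; apply/andP; move: (h p.1) (h p.2) E.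
move: p.1 p.2 => x y h1 h2 E; split; nia.
Qed.

Lemma reps2_uniq m : uniq (reps2 m). Proof. exact/filter_uniq/box_uniq. Qed.
Lemma reps4_uniq m : uniq (reps4 m). Proof. exact/filter_uniq/box_uniq. Qed.

(** The map (x, y) -> (x + y, x - y) doubles x^2 + y^2, and it is onto because an even sum of two
    squares has coordinates of equal parity. *)
Lemma size_reps2_double m : size (reps2 (2 * m)) = size (reps2 m).
Proof.
rewrite -(size_map (fun p : int * int => (p.1 + p.2, p.1 - p.2)) (reps2 m)).
apply/perm_size/uniq_perm; first exact: reps2_uniq.
  rewrite map_inj_uniq ?reps2_uniq // => -[a b] [c d] /= [E1 E2].
  by congr (_, _); lia.
move=> [a b]; rewrite mem_reps2 /=; apply/eqP/mapP => [E|[[x y]]].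
  have [x xE] : exists x : int, a + b = 2 * x.
    by exists ((a + b) %/ 2)%Z; nia.
  exists (x, a - x); last by congr (_, _) => /=; lia.
  by rewrite mem_reps2 /=; apply/eqP; nia.
by rewrite mem_reps2 /= => /eqP E [-> ->]; nia.
Qed.

(** Exactly one coordinate is odd; it may stand first or second. *)
Lemma size_reps2_odd m : odd m -> size (reps2 m) = (2 * size (reps4 m))%N.
Proof.
move=> m2; pose f1 (p : int * int) := (p.1, 2 * p.2).
pose f2 (p : int * int) := (2 * p.2, p.1).
have -> : (2 * size (reps4 m))%N = size (map f1 (reps4 m) ++ map f2 (reps4 m)).
  by rewrite size_cat !size_map; lia.
apply/perm_size/uniq_perm; first exact: reps2_uniq.
  rewrite cat_uniq !map_inj_uniq ?reps4_uniq //=; first last.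
  - by move=> [a b] [c d] [E1 E2]; congr (_, _); lia.
  - by move=> [a b] [c d] [E1 E2]; congr (_, _); lia.
  rewrite andbT; apply/hasPn => z /mapP[[x y]]; rewrite mem_reps4 => /andP[/= x2 _] ->.
  apply/negP => /mapP[[x' y']]; rewrite mem_reps4 => /andP[/= x2' _] [E1 E2]; lia.
move=> [a b]; rewrite mem_cat mem_reps2; apply/eqP/orP => [/= E|[]/mapP[[x y]]].
- have m2' : m = (2 * m./2 + 1)%N by lia.
  have [[k [l [ek el]]]|[k [l [ek el]]]] : (exists k l : int, a = 2 * k + 1 /\ b = 2 * l) \/
      (exists k l : int, a = 2 * l /\ b = 2 * k + 1).
    have [[k ek]|[k ek]] : (exists k : int, a = 2 * k + 1) \/ (exists k : int, a = 2 * k).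
    + by case: (boolP (odd `|a|)) => h; [left; exists ((a - 1) %/ 2)%Z; lia|right; exists (a %/ 2)%Z; lia].
    + left; exists k; suff : ~~ odd `|b| by move=> h; exists (b %/ 2)%Z; lia.
      apply/negP => h; have [l el] : exists l : int, b = 2 * l + 1 by exists ((b - 1) %/ 2)%Z; lia.
      by move: E; rewrite ek el; lia.
    + right; suff : odd `|b| by move=> h; exists ((b - 1) %/ 2)%Z, k; lia.
      apply/negPn/negP => h; have [l el] : exists l : int, b = 2 * l by exists (b %/ 2)%Z; lia.
      by move: E; rewrite ek el; lia.
  + left; apply/mapP; exists (a, l); last by rewrite /f1 /= el.
    by rewrite mem_reps4 /=; apply/andP; split; [lia|apply/eqP; rewrite -E el; ring].
  + right; apply/mapP; exists (b, l); last by rewrite /f2 /= ek.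
    by rewrite mem_reps4 /=; apply/andP; split; [lia|apply/eqP; rewrite -E ek; ring].
- by rewrite mem_reps4 => /andP[/= _ /eqP E] [-> ->]; rewrite -E /=; ring.
- by rewrite mem_reps4 => /andP[/= _ /eqP E] [-> ->]; rewrite -E /=; ring.
Qed.

Lemma sqrz_mod (x : int) :
  (exists2 k : int, ~~ odd `|x| & x ^+ 2 = 4 * k) \/ (exists2 k : int, odd `|x| & x ^+ 2 = 8 * k + 1).
Proof.
case: (boolP (odd `|x|)) => x2; [right|left].
  have -> : x = 2 * ((x - 1) %/ 2)%Z + 1 by lia.
  move: ((x - 1) %/ 2)%Z => y; exists ((y * (y + 1)) %/ 2)%Z; first lia.
  have : (2 %| y * (y + 1))%Z.
    rewrite dvdzE abszM dvdn2 oddM; lia.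
  by move=> /dvdzP[k e]; rewrite e mulzK //; move: e; lia.
have -> : x = 2 * (x %/ 2)%Z by lia.
by move: (x %/ 2)%Z => y; exists (y ^+ 2); [lia|ring].
Qed.

Definition dchi (m : nat) : int := \sum_(1 <= d < m.+1 | (d %| m)%N) chi d.

Lemma dchiE m N : (0 < m < N)%N -> dchi m = \sum_(1 <= d < N | (d %| m)%N) chi d.
Proof.
move=> /andP[m0 mN]; rewrite (big_cat_nat _ (n := m.+1)) //= [X in _ = _ + X]big_nat_cond [X in _ = _ + X]big1 ?addr0 //.
by move=> d /andP[/andP[md _] /dvdn_leq]; lia.
Qed.

Lemma dchi_double m : (0 < m)%N -> dchi (2 * m) = dchi m.
Proof.
move=> m0; rewrite (@dchiE m (2 * m).+1); last lia.
rewrite /dchi big_mkcond [in RHS]big_mkcond /=; apply: eq_bigr => d _.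
have [d2|d2] := boolP (odd d); last by rewrite chi_even // !if_same.
by rewrite Gauss_dvdr // coprimen2.
Qed.

Section Sums.
Variable R : comNzRingType.

Lemma bsum_even B (f : int -> R) : (forall i, f (- i) = f i) ->
  bsum B f = f 0 + 2 * \sum_(1 <= n < B.+1) f n.
Proof.
move=> fN; rewrite /bsum big_add1 /= big_mkord mulr_sumr; congr (_ + _).
by apply: eq_bigr => i _; rewrite fN; ring.
Qed.

Lemma big_nat_trim (f : nat -> R) a N M : (a <= N <= M)%N ->
  (forall n, (N <= n < M)%N -> f n = 0) -> \sum_(a <= n < M) f n = \sum_(a <= n < N) f n.
Proof.
move=> /andP[aN NM] f0; rewrite (big_cat_nat _ (n := N)) //=.
by rewrite [X in _ + X]big_nat_cond [X in _ + X]big1 ?addr0 // => n /andP[/f0].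
Qed.

Lemma chi_sum (F : nat -> R) M :
  \sum_(k < M) (-1) ^+ k * F (2 * k + 1)%N = \sum_(0 <= d < 2 * M) (chi d)%:~R * F d.
Proof.
have chiE k : chi (2 * k + 1) = (-1) ^+ k.
  elim: k => [|k IH] //; have -> : (2 * k.+1 + 1 = (2 * k + 1).+2)%N by lia.
  by rewrite chiD2 IH exprS mulN1r.
elim: M => [|M IH]; first by rewrite big_ord0 big_geq.
rewrite big_ord_recr /= IH; have -> : (2 * M.+1 = (2 * M).+2)%N by lia.
rewrite !big_nat_recr //= [chi (2 * M)]chi_even; last lia.
by rewrite mul0r addr0 -[(2 * M).+1]addn1 chiE rmorphXn /= rmorphN1.
Qed.

Lemma big_by4 (f : nat -> R) M :
  \sum_(0 <= j < 4 * M) f j =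
  \sum_(0 <= k < M) (f (4 * k)%N + f (4 * k + 1)%N + f (4 * k + 2)%N + f (4 * k + 3)%N).
Proof.
elim: M => [|M IH]; first by rewrite !big_geq.
have -> : (4 * M.+1 = (4 * M).+4)%N by lia.
by rewrite !big_nat_recr //= IH !addrA !addn1 addn2 addn3.
Qed.

Lemma big_triangle (G : nat -> nat -> R) N :
  \sum_(1 <= d < N) \sum_(1 <= e < N) G d e =
  \sum_(1 <= d < N) (G d d + \sum_(d.+1 <= e < N) (G d e + G e d)).
Proof.
elim: N => [|N IH]; first by rewrite !big_geq.
case: N IH => [|N] IH; first by rewrite !big_geq.
rewrite big_nat_recr //= [RHS]big_nat_recr //=.
under eq_bigr do rewrite big_nat_recr //=.
rewrite big_split /= IH.
rewrite [X in _ = _ + (_ + X)]big_geq // addr0 [X in _ + X = _]big_nat_recr //=.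
rewrite [in RHS](eq_big_nat _ _ (F2 := fun d => (G d d + \sum_(d.+1 <= e < N.+1) (G d e + G e d)) + (G d N.+1 + G N.+1 d))); last first.
  by move=> d /andP[d1 dN]; rewrite big_nat_recr //= addrA.
rewrite [in RHS]big_split /= [X in _ = _ + X + _]big_split /=.
ring.
Qed.

End Sums.

Section Coefficients.
Variables (R : comNzRingType) (t : R) (N : nat).
Hypothesis tN : t ^+ N = 0.
Hypothesis N0 : (0 < N)%N.

Lemma PserE : Pser t N = 1 + 4 * \sum_(1 <= m < N) (dchi m)%:~R * t ^+ (4 * m)%N.
Proof.
rewrite /Pser; congr (_ + _ * _).
rewrite (chi_sum (fun e => lam t N e)) big_ltn; last lia.
rewrite mul0r add0r (@big_nat_trim _ _ 1 N); first last.
- by move=> n /andP[nN _]; rewrite lam_big ?mulr0 //; lia.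
- lia.
have t4N : (t ^+ 4) ^+ N = 0 by rewrite -exprM (expt0 tN) //; lia.
transitivity (\sum_(1 <= d < N) \sum_(1 <= e < N) (chi d)%:~R * (t ^+ 4) ^+ (d * e)%N).
  apply: eq_big_nat => d /andP[d1 dN]; rewrite -mulr_sumr; congr (_ * _).
  rewrite /lam -(big_mkord xpredT (fun k => t ^+ (4 * d * k.+1)%N)).
  case: N N0 tN dN => // n _ tn dn.
  rewrite big_nat_recr //= [X in _ + X](expt0 tn) ?addr0; last nia.
  by rewrite big_add1 /=; apply: eq_bigr => k _; rewrite -exprM mulnA.
rewrite (lambert t4N (fun d _ => chi d)); apply: eq_big_nat => m /andP[m1 mN].
by rewrite -exprM -dchiE // m1.
Qed.

(** For odd d and e the coefficients add up to chi d + chi e, which is 2 chi d if e = d mod 4 and 0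
    if e = d + 2 mod 4. The surviving exponents d (d + 4 j) with j > 0 form the Lambert series of
    d. *)
Lemma Cser_term (d : nat) : (0 < d)%N ->
  \sum_(d.+1 <= e < N) ((chi d * chi e ^+ 2)%:~R * t ^+ (d * e)%N
                       + (chi e * chi d ^+ 2)%:~R * t ^+ (e * d)%N) =
  (chi d)%:~R * t ^+ (d ^ 2)%N * (2 * lam t N d).
Proof.
move=> d0.
have [d2|d2] := boolP (odd d); last first.
  by rewrite (chi_even d2) !mul0r big1 // => e _; rewrite expr2 !(mulr0, mul0r) addr0.
pose f j : R := ((chi d * chi (d + j) ^+ 2)%:~R + (chi (d + j) * chi d ^+ 2)%:~R) * t ^+ (d * (d + j))%N.
(* A range whose length is a multiple of 4 splits into blocks of four consecutive j = e - d, of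
   which only the j divisible by 4 contribute. *)
pose M := (N + N)%N.
transitivity (\sum_(1 <= j < (4 * M)%N) f j).
  transitivity (\sum_(1 + d <= e < 4 * M + d) (chi d * chi e ^+ 2 + chi e * chi d ^+ 2)%:~R * t ^+ (d * e)%N).
    case: (leqP d.+1 N) => dN; last first.
      rewrite big_geq; last exact: ltnW.
      rewrite big_nat_cond big1 // => e /andP[/andP[de _] _].
      by rewrite (expt0 tN) ?mulr0 //; nia.
    rewrite [RHS](@big_nat_trim _ _ _ N); first last.
    - by move=> e /andP[Ne _]; rewrite (expt0 tN) ?mulr0 //; nia.
    - by rewrite dN /M; lia.
    by apply: eq_bigr => e _; rewrite [(e * d)%N]mulnC rmorphD mulrDl.
  rewrite big_addn addnK; apply: eq_bigr => j _.
  by rewrite /f addnC rmorphD.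
have chi3 : chi d ^+ 2 = 1 by apply: chi_sqr.
have fodd j : odd j -> f j = 0.
  move=> j2; rewrite /f [chi (d + j)]chi_even; last lia.
  by rewrite expr2 !mulr0 !mul0r addr0 mul0r.
have chi4 k : chi (d + 4 * k) = chi d.
  elim: k => [|k IH]; first by rewrite addn0.
  by have -> : (d + 4 * k.+1 = (d + 4 * k).+4)%N by lia; rewrite !chiD2 opprK.
have f2 k : f (4 * k + 2)%N = 0.
  have -> : f (4 * k + 2)%N = ((chi d * chi (d + 4 * k).+2 ^+ 2)%:~R + (chi (d + 4 * k).+2 * chi d ^+ 2)%:~R) * t ^+ (d * (d + (4 * k + 2)))%N.
    by rewrite /f; have -> : (d + (4 * k + 2) = (d + 4 * k).+2)%N by lia.
  by rewrite chiD2 chi4 sqrrN chi3 !mulr1 rmorphN /= subrr mul0r.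
have f4 k : f (4 * k)%N = (chi d)%:~R * (2 * t ^+ (d * (d + 4 * k))%N).
  by rewrite /f chi4 chi3 !mulr1; ring.
rewrite -[LHS]add0r.
transitivity (\sum_(0 <= j < 4 * M) f j - f 0%N).
  rewrite [in RHS]big_ltn; last by rewrite /M; lia.
  ring.
rewrite big_by4 big_ltn; last by rewrite /M; lia.
rewrite (f2 0%N) (fodd (4 * 0 + 1)%N) // (fodd (4 * 0 + 3)%N) // muln0 !addr0 addrAC subrr add0r.
rewrite /lam !mulr_sumr -(big_mkord xpredT (fun k =>
  (chi d)%:~R * t ^+ (d ^ 2)%N * (2 * t ^+ (4 * d * k.+1)%N))).
rewrite (@big_nat_trim _ _ _ N.+1); first last.
- move=> k /andP[Nk _]; rewrite f2 (fodd (4 * k + 1)%N) ?(fodd (4 * k + 3)%N); try lia.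
  by rewrite f4 !addr0 (expt0 tN) ?mulr0 //; nia.
- by rewrite /M; lia.
rewrite big_add1 /=; apply: eq_big_nat => k _.
rewrite f2 (fodd (4 * k.+1 + 1)%N) ?(fodd (4 * k.+1 + 3)%N); try lia.
rewrite f4 !addr0 -mulrA; congr (_ * _); rewrite mulrCA; congr (_ * _).
by rewrite -exprD; congr (t ^+ _); lia.
Qed.

Lemma Cser_eq : Cser t N = 2 * \sum_(1 <= n < N) (chi n)%:~R * t ^+ (n ^ 2)%N * (1 + 2 * lam t N n).
Proof.
rewrite /Cser bsum_even; last by move=> i; rewrite (odd_cu t).2 oddxN // mulrNN.
rewrite /= mulr0 add0r; congr (_ * _).
rewrite (@big_nat_trim _ _ 1 N); first last.
- by move=> n /andP[nN _]; rewrite (supp_cu tN) ?mul0r.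
- by rewrite N0 /=.
apply: eq_big_nat => n /andP[n1 _].
by rewrite gnE.
Qed.

(** In the double sum of chi d t^(d e) over odd d and e, the diagonal gives the squares t^(d^2) and
    the rest, folded along the diagonal, gives the tails of [Cser_term]. Grouping by m = d e instead
    gives divisor sums. *)
Lemma CserE : Cser t N = 2 * \sum_(1 <= m < N | odd m) (dchi m)%:~R * t ^+ m.
Proof.
rewrite Cser_eq; congr (_ * _).
transitivity (\sum_(1 <= d < N) \sum_(1 <= e < N) (chi d * chi e ^+ 2)%:~R * t ^+ (d * e)%N).
  rewrite (big_triangle (fun d e => (chi d * chi e ^+ 2)%:~R * t ^+ (d * e)%N)).
  apply: eq_big_nat => d /andP[d1 dN]; rewrite Cser_term // mulrDr mulr1; congr (_ + _).
  have [d2|d2] := boolP (odd d); last by rewrite chi_even // !mul0r.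
  by rewrite chi_sqr // mulr1 mulnn.
rewrite (lambert tN (fun d e => chi d * chi e ^+ 2)) [in RHS]big_mkcond.
apply: eq_big_nat => m /andP[m1 mN].
case: ifP => m2; last first.
  rewrite big1 ?mul0r // => d /dvdnP[k km].
  have [d2|d2] := boolP (odd d); last by rewrite (chi_even d2) mul0r.
  have d0 : (0 < d)%N by case: d d2 {km}.
  rewrite km mulnK // [chi k]chi_even ?expr0n ?mulr0 //.
  by move: m2; rewrite km oddM d2 andbT => ->.
rewrite (@dchiE m N) ?m1 //; congr (_%:~R * _); apply: eq_bigr => d /dvdnP[k km].
have d0 : (0 < d)%N by case: d km => [|//] km; lia.
by rewrite km mulnK // chi_sqr ?mulr1 //; move: m2; rewrite km oddM => /andP[].
Qed.

End Coefficients.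

Section ThetaProducts.
Variables (R : comNzRingType) (t : R) (N : nat).
Hypothesis tN : t ^+ N = 0.
Hypothesis N0 : (0 < N)%N.

Lemma collect1 (x : R) M (s : seq (int * int)) (e : int * int -> nat) : x ^+ M = 0 ->
  \sum_(p <- s) x ^+ e p = \sum_(m < M) (size [seq p <- s | e p == m])%:R * x ^+ m.
Proof.
move=> xM; transitivity (\sum_(p <- s) (1 : int)%:~R * x ^+ e p).
  by apply: eq_bigr => p _; rewrite mul1r.
rewrite (collect xM); apply: eq_bigr => m _; congr (_ * _).
by rewrite size_filter -sum1_count natr_sum rmorph_sum.
Qed.

Lemma th3_sqr : th3 t N ^+ 2 = \sum_(m < N) (size (reps2 m))%:R * t ^+ (4 * m)%N.
Proof.
have xN : (t ^+ 4) ^+ N = 0 by rewrite -exprM (expt0 tN) //; lia.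
transitivity (\sum_(p <- box N) (t ^+ 4) ^+ (`|p.1| ^ 2 + `|p.2| ^ 2)%N).
  rewrite big_allpairs /th3 expr2 !bsumE big_distrlr /=.
  by apply: eq_bigr => x _; apply: eq_bigr => y _; rewrite exprD !exprM.
rewrite (collect1 _ _ xN); apply: eq_bigr => m _; rewrite -exprM; congr (_%:R * _).
apply/perm_size/uniq_perm; rewrite ?reps2_uniq ?filter_uniq ?box_uniq // => p.
rewrite mem_reps2 mem_filter mem_box.
rewrite -eqz_nat PoszD !absz_sqrE; case: eqP => //= E.
by have := ltn_ord m; move: E; move: p.1 p.2 => x y E mN; apply/andP; split; nia.
Qed.

Lemma th23 : th2 t N * th3 t N = \sum_(m < N) (size (reps4 m))%:R * t ^+ m.
Proof.
transitivity (\sum_(p <- [seq p <- box N | odd `|p.1|]) t ^+ (`|p.1| ^ 2 + 4 * `|p.2| ^ 2)%N).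
  rewrite big_filter big_mkcond big_allpairs /th2 /th3 !bsumE big_distrlr /=.
  apply: eq_bigr => x _; apply: eq_bigr => y _; rewrite exprD.
  by case: ifP; rewrite ?mul0r.
rewrite (collect1 _ _ tN); apply: eq_bigr => m _; congr (_%:R * _).
apply/perm_size/uniq_perm; rewrite ?reps4_uniq ?filter_uniq ?box_uniq // => p.
rewrite mem_reps4 !mem_filter mem_box.
rewrite -eqz_nat PoszD PoszM !absz_sqrE.
rewrite andbA [odd _ && _]andbC; case: eqP => //= E; case: (odd _) => //=.
by have := ltn_ord m; move: E; move: p.1 p.2 => x y E mN; apply/andP; split; nia.
Qed.

Lemma th3_1t : exists s, th3 t N = 1 + t * s.
Proof.
exists (2 * \sum_(1 <= n < N.+1) t ^+ (4 * n ^ 2).-1).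
rewrite /th3 bsum_even; last by move=> i; rewrite abszN.
have -> : t ^+ (4 * `|(0 : int)| ^ 2)%N = 1 by [].
rewrite [t * _]mulrCA [t * _]mulr_sumr; congr (_ + _ * _).
by apply: eq_big_nat => n /andP[n1 _]; rewrite -exprS prednK //; lia.
Qed.

Lemma th4_1t : exists s, th4 t N = 1 + t * s.
Proof.
exists (2 * \sum_(1 <= n < N.+1) (-1) ^+ n * t ^+ (4 * n ^ 2).-1).
rewrite /th4 bsum_even; last by move=> i; rewrite abszN.
have -> : (-1) ^+ `|(0 : int)|%N * t ^+ (4 * `|(0 : int)| ^ 2)%N = 1 by rewrite mulr1.
rewrite [t * _]mulrCA [t * _]mulr_sumr; congr (_ + _ * _).
by apply: eq_big_nat => n /andP[n1 _]; rewrite mulrCA -exprS prednK //; lia.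
Qed.

Lemma unipotent_mulI (s x : R) : (1 + t * s) * x = 0 -> x = 0.
Proof.
move=> H; have E : x = (- (t * s)) * x by apply/eqP; rewrite -subr_eq0 -H; apply/eqP; ring.
have {}E M : x = (- (t * s)) ^+ M * x.
  by elim: M => [|M IH]; rewrite ?mul1r // exprSr -mulrA -E.
by rewrite (E N) -mulrN exprMn tN !mul0r.
Qed.

End ThetaProducts.

Section CoefficientMap.
Variables (R : comNzRingType) (cf : R -> int).
Hypothesis cfB : zmod_morphism cf.

Let f : {additive R -> int} := HB.pack cf (GRing.isZmodMorphism.Build R int cf cfB).

Lemma cf0 : cf 0 = 0. Proof. exact: (raddf0 f). Qed.

Lemma cfD x y : cf (x + y) = cf x + cf y. Proof. exact: (raddfD f). Qed.

Lemma cfMz c x : cf (c%:~R * x) = c * cf x.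
Proof. by rewrite mulrzl -[cf _]/(f _) raddfMz -mulrzl intz. Qed.

Lemma cf_sum I (s : seq I) (P : pred I) F :
  cf (\sum_(i <- s | P i) F i) = \sum_(i <- s | P i) cf (F i).
Proof. exact: (raddf_sum f). Qed.

End CoefficientMap.

Lemma dchi_reps4 (R : comNzRingType) (x : R) m : (0 < m)%N ->
  (size (reps2 m))%:Z = 4 * dchi m ->
  2 * (if odd m then (dchi m)%:~R * x else 0) = (size (reps4 m))%:R * x.
Proof.
move=> m0 E; case: ifP => m2; last first.
  case E4: (reps4 m) => [|p s]; first by rewrite mulr0 mul0r.
  have : p \in reps4 m by rewrite E4 mem_head.
  by rewrite mem_reps4 => /andP[p2 /eqP]; case: (sqrz_mod p.1) => -[k q ->]; [rewrite p2 in q|lia].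
move: E; rewrite size_reps2_odd // => E; rewrite mulrA; congr (_ * _).
have -> : (size (reps4 m))%:R = ((size (reps4 m))%:Z)%:~R :> R by [].
have -> : (size (reps4 m))%:Z = 2 * dchi m by lia.
by rewrite rmorphM.
Qed.

Lemma jacobi_two_squares n : (0 < n)%N -> (size (reps2 n))%:Z = 4 * dchi n.
Proof.
elim/ltn_ind: n => n IH n0.
have r0 : size (reps2 0) = 1%N by [].
have [n2|n2] := boolP (odd n); last first.
  have nE : n = (2 * n./2)%N by lia.
  rewrite nE dchi_double ?size_reps2_double ?IH //; lia.
have [N [NE N1]] : exists N, N = n.+1 /\ (1 < N)%N by exists n.+1; split => //; lia.
have [R [t [cf [tN cfB cft _]]]] := truncated_ring N1.
have N0 : (0 < N)%N by lia.
(* M is the defect at exponent n. Smaller exponents agree by induction, so modulo t^(n + 1) the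
   series C and th2 th3 differ by M t^n. The identity C th3 = P th2 then forces M = 0, as th3 has
   constant term 1. *)
pose M : int := 2 * dchi n - (size (reps4 n))%:Z.
have EC : Cser t N = th2 t N * th3 t N + M%:~R * t ^+ n.
  rewrite th23 // CserE // -(big_mkord xpredT (fun m => (size (reps4 m))%:R * t ^+ m)).
  rewrite NE big_mkcond !big_nat_recr //= n2 mulrDr -addrA.
  congr (_ + _); last by rewrite /M rmorphB rmorphM /=; ring.
  rewrite [RHS]big_ltn // mulr_sumr.
  have -> : size (reps4 0) = 0%N by [].
  rewrite mul0r add0r; apply: eq_big_nat => m /andP[m0 mn].
  by apply: dchi_reps4 => //; exact: IH.
(* Only powers t^(4 m) occur, so modulo t^(n + 1) the induction hypothesis for m < n is enough. *)
have EP : Pser t N = th3 t N ^+ 2.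
  rewrite th3_sqr // PserE // -(big_mkord xpredT (fun m => (size (reps2 m))%:R * t ^+ (4 * m)%N)).
  rewrite [RHS]big_ltn // r0 muln0 mulr1 mulr_sumr; congr (_ + _).
  apply: eq_big_nat => m /andP[m1 mN].
  case: (ltnP m n) => mn; last by rewrite (expt0 tN) ?mulr0 //; lia.
  have -> : (size (reps2 m))%:R = ((size (reps2 m))%:Z)%:~R :> R by [].
  by rewrite IH // rmorphM mulrA.
have := Cser_th3 tN N0; rewrite EC EP => H.
have {}H : (M%:~R * t ^+ n) * th3 t N = 0.
  by apply: (addrI (th2 t N * th3 t N * th3 t N)); rewrite -mulrDl H; ring.
have [s sE] := th3_1t t N0.
have {}H : M%:~R * t ^+ n = 0.
  rewrite -[RHS]H sE.
  have -> : M%:~R * t ^+ n * (1 + t * s) = M%:~R * t ^+ n + M%:~R * s * t ^+ N.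
    by rewrite NE exprS; ring.
  by rewrite tN mulr0 addr0.
have : cf n (M%:~R * t ^+ n) = 0 by rewrite H (cf0 (cfB n)).
rewrite (cfMz (cfB n)) cft ?NE // eqxx mulr1 /M => E.
by rewrite size_reps2_odd // PoszM; lia.
Qed.

Lemma Cser_th23 (R : comNzRingType) (t : R) N : t ^+ N = 0 -> (0 < N)%N ->
  Cser t N = th2 t N * th3 t N.
Proof.
move=> tN N0; rewrite th23 // CserE //.
rewrite -(big_mkord xpredT (fun m => (size (reps4 m))%:R * t ^+ m)).
rewrite [RHS]big_ltn // mulr_sumr.
have -> : size (reps4 0) = 0%N by [].
rewrite mul0r add0r -mulr_sumr big_mkcond mulr_sumr; apply: eq_big_nat => m /andP[m0 mn].
by apply: dchi_reps4 => //; exact: jacobi_two_squares.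
Qed.

Lemma Pser_th3 (R : comNzRingType) (t : R) N : t ^+ N = 0 -> (0 < N)%N ->
  Pser t N = th3 t N ^+ 2.
Proof.
move=> tN N0; rewrite th3_sqr // PserE //.
rewrite -(big_mkord xpredT (fun m => (size (reps2 m))%:R * t ^+ (4 * m)%N)).
have r0 : size (reps2 0) = 1%N by [].
rewrite [RHS]big_ltn // r0 muln0 mulr1 mulr_sumr; congr (_ + _).
apply: eq_big_nat => m /andP[m1 mN].
have -> : (size (reps2 m))%:R = ((size (reps2 m))%:Z)%:~R :> R by [].
by rewrite jacobi_two_squares // rmorphM mulrA.
Qed.

(** * Numbers congruent to 1 modulo 4 as x^2 + 4 y^2 + 4 z^2 *)

Section Hseries.
Variables (R : comNzRingType) (t : R) (N : nat).
Hypothesis tN : t ^+ N = 0.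
Hypothesis N0 : (0 < N)%N.

Lemma chi_shift d b : chi (d + 2 * b) = (-1) ^+ b * chi d.
Proof.
elim: b => [|b IH]; first by rewrite muln0 addn0 expr0 mul1r.
have -> : (d + 2 * b.+1 = (d + 2 * b).+2)%N by lia.
by rewrite chiD2 IH exprS; ring.
Qed.

Lemma hn_chi e : (chi e)%:~R * hn t e = (chi e)%:~R *
  (t ^+ (e ^ 2)%N + 2 * \sum_(1 <= b < N | (2 * b < e)%N) t ^+ (e ^ 2 - 4 * b ^ 2)%N).
Proof.
have [e2|e2] := boolP (odd e); last by rewrite chi_even // !mul0r.
congr (_ * _); rewrite /hn e2 /hp.
have -> : (2 * e./2 + 1 = e)%N by lia.
rewrite bsum_even; last by move=> i; rewrite abszN.
have -> : (e ^ 2 - 4 * `|(0 : int)| ^ 2 = e ^ 2)%N by rewrite /=; lia.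
congr (_ + _ * _).
rewrite [RHS]big_mkcond /=.
pose M := (N + e)%N.
transitivity (\sum_(1 <= b < M) (if (2 * b < e)%N then t ^+ (e ^ 2 - 4 * b ^ 2)%N else 0)).
  rewrite [RHS](@big_nat_trim _ _ _ e./2.+1); first last.
  - by move=> b bM; rewrite ifF //; lia.
  - by rewrite /M; lia.
  by apply: eq_big_nat => b bE; rewrite ifT //; lia.
apply: big_nat_trim; first by rewrite N0 /M; lia.
move=> b /andP[Nb _]; case: ifP => // be; rewrite (expt0 tN) //; nia.
Qed.

(** Substitute e = d + 2 b: the exponent e^2 - 4 b^2 becomes d^2 + 4 d b, and chi e becomes (-1)^b
    chi d. The result is [Cser_eq] with signs (-1)^b inserted. *)
Lemma HserE : Hser t N = 2 * \sum_(1 <= n < N) (chi n)%:~R * t ^+ (n ^ 2)%N *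
   (1 + 2 * \sum_(1 <= b < N) (-1) ^+ b * t ^+ (4 * n * b)%N).
Proof.
have hne n : (N <= n)%N -> hn t n = 0.
  by move=> Nn; rewrite -[hn t n]/(oddx (hn t) n) (supp_h tN).
rewrite /Hser bsum_even; last first.
  by move=> i; rewrite !oddxN ?mulrNN // /chiR.
rewrite /= mul0r add0r; congr (_ * _).
rewrite (@big_nat_trim _ _ 1 N); first last.
- by move=> n /andP[nN _]; rewrite hne ?mul0r.
- by rewrite N0 /=.
transitivity (\sum_(1 <= n < N) (chi n)%:~R * hn t n).
  by apply: eq_bigr => n _; rewrite mulrC.
under [LHS]eq_bigr => n _ do rewrite hn_chi mulrDr.
under [RHS]eq_bigr => n _ do rewrite mulrDr mulr1.
rewrite !big_split /=; congr (_ + _).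
transitivity (2 * \sum_(1 <= e < N) \sum_(1 <= b < N | (2 * b < e)%N) (chi e)%:~R * t ^+ (e ^ 2 - 4 * b ^ 2)%N).
  by rewrite [RHS]mulr_sumr; apply: eq_bigr => e _; rewrite mulrCA; congr (_ * _); rewrite mulr_sumr.
transitivity (2 * \sum_(1 <= n < N) \sum_(1 <= b < N) (chi n)%:~R * t ^+ (n ^ 2)%N * ((-1) ^+ b * t ^+ (4 * n * b)%N)); last first.
  by rewrite [LHS]mulr_sumr; apply: eq_bigr => e _; rewrite [RHS]mulrCA; congr (_ * _); rewrite [RHS]mulr_sumr.
congr (_ * _).
rewrite (exchange_big_dep xpredT) //= [RHS]exchange_big /=.
apply: eq_big_nat => b /andP[b1 bN].
(* As 2 b < 2 N, the bound 3 N on e still leaves every d = e - 2 b below N in range. *)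
transitivity (\sum_(1 <= e < 3 * N | (2 * b < e)%N) (chi e)%:~R * t ^+ (e ^ 2 - 4 * b ^ 2)%N).
  rewrite big_mkcond [RHS]big_mkcond /=; apply/esym/big_nat_trim; first lia.
  move=> e /andP[Ne _]; case: ifP => // be; rewrite (expt0 tN) ?mulr0 //; nia.
transitivity (\sum_(1 + 2 * b <= e < 3 * N) (chi e)%:~R * t ^+ (e ^ 2 - 4 * b ^ 2)%N).
  rewrite (big_cat_nat _ (n := (1 + 2 * b)%N)) /=; [|lia|lia].
  rewrite big_nat_cond big1 ?add0r; last by move=> e; lia.
  by rewrite big_nat_cond [RHS]big_nat_cond; apply: eq_bigl => e; lia.
rewrite big_addn (@big_nat_trim _ _ _ N); first last.
- by move=> d /andP[Nd _]; rewrite (expt0 tN) ?mulr0 //; nia.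
- lia.
apply: eq_big_nat => d /andP[d1 dN].
rewrite chi_shift rmorphM rmorphXn /= rmorphN1 -mulrA mulrACA -mulrA.
have -> : ((d + 2 * b) ^ 2 - 4 * b ^ 2 = d ^ 2 + 4 * d * b)%N by nia.
rewrite exprD; ring.
Qed.

End Hseries.

Section ThreeSquares.
Variables (R : comNzRingType) (t : R) (N : nat) (cf : nat -> R -> int).
Hypothesis tN : t ^+ N = 0.
Hypothesis N0 : (0 < N)%N.
Hypothesis cfB : forall K, zmod_morphism (cf K).
Hypothesis cft : forall m K, (K < N)%N -> cf K (t ^+ m) = (m == K)%:R.
Hypothesis cf_inj : forall x, (forall K, (K < N)%N -> cf K x = 0) -> x = 0.

(* Both twist lemmas substitute zeta t for t in a series supported on exponents 1 mod 4, where
   zeta is a primitive 8th root of unity, and divide by zeta. *)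
Lemma Hser_twist K : (K < N)%N -> cf K (Hser t N) = (-1) ^+ (K %/ 4) * cf K (Cser t N).
Proof.
move=> KN; rewrite HserE // Cser_eq //.
rewrite -[2 * \sum_(1 <= n < N) _]/((2 : int)%:~R * _) (cfMz (cfB K)).
rewrite -[2 * \sum_(1 <= n < N) _]/((2 : int)%:~R * _) (cfMz (cfB K)).
rewrite [RHS]mulrCA; congr (_ * _); rewrite !(cf_sum (cfB K)) mulr_sumr.
apply: eq_bigr => n _; rewrite -!mulrA !(cfMz (cfB K)) [RHS]mulrCA.
have [n2|n2] := boolP (odd n); last by rewrite chi_even ?mul0r.
congr (_ * _); rewrite !mulrDr !mulr1 !(cfD (cfB K)) mulrDr.
have [k kn] : exists k, (n ^ 2 = 8 * k + 1)%N.
  case: (sqrz_mod n) => -[k]; first by rewrite /= n2.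
  by move=> _ kn; exists `|k|%N; nia.
congr (_ + _).
  rewrite cft //; case: eqP => [<-|]; last by rewrite mulr0.
  rewrite kn; have -> : ((8 * k + 1) %/ 4 = 2 * k)%N by lia.
  by rewrite exprM sqrrN !expr1n mul1r.
rewrite mulrCA [X in _ = _ * cf K X]mulrCA.
rewrite -[2 * (_ * \sum_(_ <= _ < _) _)]/((2 : int)%:~R * _) (cfMz (cfB K)).
rewrite -[2 * (_ * lam _ _ _)]/((2 : int)%:~R * _) (cfMz (cfB K)) [RHS]mulrCA; congr (_ * _).
rewrite /lam -(big_mkord xpredT (fun b => t ^+ (4 * n * b.+1)%N)) !mulr_sumr.
have -> : \sum_(1 <= b < N) t ^+ (n ^ 2)%N * ((-1) ^+ b * t ^+ (4 * n * b)%N) =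
          \sum_(0 <= b < N) t ^+ (n ^ 2)%N * ((-1) ^+ b.+1 * t ^+ (4 * n * b.+1)%N).
  case: N N0 tN => // M _ tM; rewrite [RHS]big_nat_recr //= big_add1 /=.
  have nM : (M.+1 <= 4 * n * M.+1)%N by case: n n2 {kn} => // n _; nia.
  by rewrite [t ^+ (4 * n * M.+1)%N](expt0 tM nM) !mulr0 addr0.
rewrite !(cf_sum (cfB K)) mulr_sumr; apply: eq_bigr => b _.
rewrite mulrCA -!exprD; have -> : (-1) ^+ b.+1 = ((-1) ^+ b.+1 : int)%:~R :> R by rewrite rmorphXn /= rmorphN1.
rewrite (cfMz (cfB K)) cft //; case: eqP => [<-|]; last by rewrite !mulr0.
congr (_ * _); have -> : (n ^ 2 + 4 * n * b.+1 = 4 * (2 * k + n * b.+1) + 1)%N by rewrite kn; nia.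
have -> : ((4 * (2 * k + n * b.+1) + 1) %/ 4 = 2 * k + n * b.+1)%N by lia.
rewrite exprD exprM sqrrN !expr1n mul1r exprM.
by rewrite -[(-1) ^+ n]signr_odd n2.
Qed.

Lemma th24_twist K : (K < N)%N ->
  cf K (th2 t N * th4 t N) = (-1) ^+ (K %/ 4) * cf K (th2 t N * th3 t N).
Proof.
move=> KN; rewrite /th2 /th3 /th4 !bsumE !big_distrlr /= !(cf_sum (cfB K)) mulr_sumr.
apply: eq_bigr => x _; rewrite !(cf_sum (cfB K)) mulr_sumr; apply: eq_bigr => y _.
case: ifP => x2; last by rewrite !mul0r (cf0 (cfB K)) mulr0.
rewrite mulrCA -exprD; have -> : (-1) ^+ `|y| = ((-1) ^+ `|y| : int)%:~R :> R by rewrite rmorphXn /= rmorphN1.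
rewrite (cfMz (cfB K)) cft //; case: eqP => [<-|]; last by rewrite !mulr0.
congr (_ * _).
have [k kn] : exists k, (`|x| ^ 2 = 8 * k + 1)%N.
  case: (sqrz_mod x) => -[k]; first by rewrite x2.
  by move=> _ kn; exists `|k|%N; nia.
rewrite kn; have -> : ((8 * k + 1 + 4 * `|y| ^ 2) %/ 4 = 2 * k + `|y| ^ 2)%N by lia.
rewrite exprD exprM sqrrN !expr1n mul1r.
by rewrite -signr_odd -[in RHS]signr_odd oddX.
Qed.

Lemma Hser_th24 : Hser t N = th2 t N * th4 t N.
Proof.
apply/eqP; rewrite -subr_eq0; apply/eqP/cf_inj => K KN.
by rewrite cfB Hser_twist // th24_twist // Cser_th23 // subrr.
Qed.

Lemma Fser_th233 : Fser t N = th2 t N * th3 t N ^+ 2.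
Proof.
have [s sE] := th4_1t t N0.
apply/eqP; rewrite -subr_eq0; apply/eqP/(unipotent_mulI tN (s := s)).
rewrite -sE mulrC mulrBl Fser_th4 // Pser_th3 // Hser_th24; ring.
Qed.

(* [Fser] is a sum of monomials, and its term e = 1 involves every exponent 1 mod 4. *)
Definition monsum (x : R) := exists s : seq nat, x = \sum_(i <- s) t ^+ i.

Lemma monsumD x y : monsum x -> monsum y -> monsum (x + y).
Proof. by move=> [s ->] [s' ->]; exists (s ++ s'); rewrite big_cat. Qed.

Lemma monsumM x y : monsum x -> monsum y -> monsum (x * y).
Proof.
move=> [s ->] [s' ->]; exists [seq (i + j)%N | i <- s, j <- s'].
rewrite big_distrlr big_allpairs_dep /=.
by apply: eq_bigr => i _; apply: eq_bigr => j _; rewrite exprD.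
Qed.

Lemma monsumX m : monsum (t ^+ m). Proof. by exists [:: m]; rewrite big_seq1. Qed.
Lemma monsum0 : monsum 0. Proof. by exists [::]; rewrite big_nil. Qed.
Lemma monsum1 : monsum 1. Proof. exact: (monsumX 0). Qed.

Lemma monsum_sum I (s : seq I) (P : pred I) F : (forall i, P i -> monsum (F i)) ->
  monsum (\sum_(i <- s | P i) F i).
Proof. by move=> H; apply: big_ind => //; [exact: monsum0|exact: monsumD]. Qed.

Lemma monsum_ge0 K x : (K < N)%N -> monsum x -> 0 <= cf K x.
Proof.
move=> KN [s ->]; rewrite (cf_sum (cfB K)) sumr_ge0 // => i _.
by rewrite cft // ler0n.
Qed.

Lemma Fser_gt0 K : (K < N)%N -> (K %% 4 = 1)%N -> 0 < cf K (Fser t N).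
Proof.
move=> KN K4; have N1 : (1 < N)%N by case: K KN K4 => [|K]; lia.
rewrite /Fser bsum_even; last by move=> i; rewrite !oddxN // mulrNN.
rewrite /= mul0r add0r -[2 * _]/((2 : int)%:~R * _) (cfMz (cfB K)) mulr_gt0 //.
rewrite big_ltn; last lia.
rewrite (cfD (cfB K)).
have mlam e : monsum (lam t N e) by apply: monsum_sum => i _; exact: monsumX.
have m2 x : monsum x -> monsum (2 * x) by move=> mx; rewrite mulr_natl mulr2n; apply: monsumD.
apply: ltr_wpDr.
  apply: monsum_ge0 => //; rewrite big_nat_cond; apply: monsum_sum => e /andP[/andP[e1 _] _].
  apply: monsumM.
    rewrite /hn; case: ifP => _; last exact: monsum0.
    by rewrite /hp bsumE; apply: monsum_sum => i _; exact: monsumX.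
  by rewrite gnE ?(ltnW e1) //; apply: monsumD; [exact: monsum1|exact: m2].
rewrite h1 gnE // mulrDr mulr1 (cfD (cfB K)) mulrCA -[2 * _]/((2 : int)%:~R * _) (cfMz (cfB K)).
rewrite -{1}[t]expr1 cft //.
have [->|K1] := eqVneq 1%N K.
  apply: ltr_wpDr => //; apply: mulr_ge0 => //; apply: monsum_ge0 => //.
  by apply: monsumM => //; rewrite -[t]expr1; exact: monsumX.
rewrite add0r mulr_gt0 // /lam mulr_sumr.
have kN : ((K %/ 4).-1 < N)%N by lia.
rewrite (bigD1 (Ordinal kN)) //= (cfD (cfB K)).
apply: ltr_wpDr.
  apply: monsum_ge0 => //; apply: monsum_sum => i _.
  by rewrite -exprS; exact: monsumX.
rewrite -exprS cft //.
by have -> : ((4 * 1 * ((K %/ 4).-1).+1).+1 == K)%N by lia.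
Qed.

End ThreeSquares.

Lemma three_squares_1mod4 K : (K %% 4 = 1)%N ->
  exists x y z : int, x ^+ 2 + 4 * y ^+ 2 + 4 * z ^+ 2 = K%:Z.
Proof.
move=> K4; pose N := K.+1; have N1 : (1 < N)%N by rewrite /N; case: K K4 @N.
have N0 := ltnW N1; have KN : (K < N)%N by [].
have [R [t [cf [tN cfB cft cfi]]]] := truncated_ring N1.
pose B := zrange N.
(* If this finite search fails, no monomial of th2 th3^2 has exponent K, against the positivity of
   that coefficient of F. *)
case: (boolP (has (fun x => has (fun y => has (fun z => x ^+ 2 + 4 * y ^+ 2 + 4 * z ^+ 2 == K%:Z) B) B) B)).
  by case/hasP => x _ /hasP[y _ /hasP[z _ /eqP E]]; exists x, y, z.
move=> /hasPn H; have := Fser_gt0 N0 cfB cft KN K4.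
rewrite (Fser_th233 tN N0 cfB cft cfi) expr2 /th2 /th3 !bsumE -/B.
rewrite big_distrl (cf_sum (cfB K)) big_seq big1 //= => x xB.
rewrite big_distrlr /= mulr_sumr (cf_sum (cfB K)) big_seq big1 // => y yB.
rewrite mulr_sumr (cf_sum (cfB K)) big_seq big1 // => z zB.
case: ifP => x2; last by rewrite mul0r (cf0 (cfB K)).
rewrite /usq -!exprD cft //; case: eqP => // E.
have := H x xB => /hasPn/(_ y yB)/hasPn/(_ z zB)/eqP[].
by rewrite -E !PoszD -(absz_sqrE x) -(absz_sqrE y) -(absz_sqrE z); lia.
Qed.

Lemma odd_of_3squares (x y z K : int) : x ^+ 2 + 4 * y ^+ 2 + 4 * z ^+ 2 = K ->
  odd `|K| -> exists u, x = 2 * u + 1.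
Proof.
move=> E K2; exists ((x - 1) %/ 2)%Z; have : odd `|x|; last lia.
by apply/negPn/negP => x2; case: (sqrz_mod x) => -[k e xE]; [lia|rewrite e in x2].
Qed.

(** * Sums of values of binary quadratic forms *)

Definition qf (k b c : int) (p : int * int) : int :=
  k * p.1 ^+ 2 + b * p.1 * p.2 + c * p.2 ^+ 2.

Definition sumq (k b c : int) (g r : nat) : Prop :=
  exists2 s : seq (int * int), size s = g & \sum_(p <- s) qf k b c p = r%:Z.

Lemma qf0 k b c : qf k b c (0, 0) = 0.
Proof. by rewrite /qf /=; ring. Qed.

Lemma sumq_leq k b c g g' r : (g <= g')%N -> sumq k b c g r -> sumq k b c g' r.
Proof.
move=> gg [s sg sr]; exists (s ++ nseq (g' - g) (0, 0)).
  by rewrite size_cat size_nseq sg subnKC.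
by rewrite big_cat /= sr big1_seq ?addr0 // => p /andP[_ /nseqP[-> _]]; exact: qf0.
Qed.

Lemma sumqN k b c g r : sumq k b c g r -> sumq k (- b) c g r.
Proof.
move=> [s sg sr]; exists [seq (- p.1, p.2) | p <- s]; first by rewrite size_map.
by rewrite big_map -sr; apply: eq_bigr => p _; rewrite /qf /=; ring.
Qed.

(** Lagrange's theorem from the class 1 mod 4: multiples of 4 by descent, 2 mod 4 by subtracting 1,
    and 3 mod 4 through 2 n - 1. *)
Lemma four_squares (n : nat) : exists x y z w : int,
  x ^+ 2 + y ^+ 2 + z ^+ 2 + w ^+ 2 = n%:Z.
Proof.
elim/ltn_ind: n => n IH.
have [n4|[n4|[n4|n4]]] : (n %% 4 = 0 \/ n %% 4 = 1 \/ n %% 4 = 2 \/ n %% 4 = 3)%N by lia.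
- case: (posnP n) => [->|n0]; first by exists 0, 0, 0, 0.
  have [|x [y [z [w E]]]] := IH (n %/ 4)%N; first lia.
  exists (2 * x), (2 * y), (2 * z), (2 * w).
  have -> : n%:Z = 4 * (n %/ 4)%N%:Z by lia.
  by rewrite -E; ring.
- have [x [y [z E]]] := three_squares_1mod4 n4.
  by exists x, (2 * y), (2 * z), 0; rewrite -E; ring.
- have [|x [y [z E]]] := three_squares_1mod4 (K := n.-1); first lia.
  exists x, (2 * y), (2 * z), 1.
  have -> : n%:Z = n.-1%:Z + 1 by lia.
  by rewrite -E; ring.
(* Halving 2 n = (x^2 + 1) + 4 y^2 + 4 z^2 with x = 2 u + 1 uses (x^2 + 1) / 2 = (u + 1)^2 + u^2 and
   2 y^2 + 2 z^2 = (y + z)^2 + (y - z)^2. *)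
- have [|x [y [z E]]] := three_squares_1mod4 (K := (2 * n).-1); first lia.
  have [|u xE] := odd_of_3squares E; first lia.
  exists (u + 1), u, (y + z), (y - z).
  have H : 2 * n%:Z = (2 * n).-1%:Z + 1 by lia.
  apply: (mulfI (x := 2)) => //.
  by rewrite H -E xE; ring.
Qed.

(** With second coordinate 0 the form is a plain square; this settles the principal class whenever g
    >= 4. *)
Lemma sumq_four_squares b c r : sumq 1 b c 4 r.
Proof.
have [x [y [z [w E]]]] := four_squares r.
exists [:: (x, 0); (y, 0); (z, 0); (w, 0)] => //.
by rewrite !big_cons big_nil /qf /= -E; ring.
Qed.

(** * Computing sumsets and covering all large numbers *)

Fixpoint orl (a e : bitseq) : bitseq :=
  match a, e with x :: a', y :: e' => (x || y) :: orl a' e' | _, _ => [::] end.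

Lemma size_orl a e : (size a <= size e)%N -> size (orl a e) = size a.
Proof. by elim: a e => [|x a IH] [|y e] //= ae; rewrite IH. Qed.

Lemma nth_orl a e i : (size a <= size e)%N -> (i < size a)%N ->
  nth false (orl a e) i = nth false a i || nth false e i.
Proof. by elim: a e i => [|x a IH] [|y e] [|i] //= ae ia; apply: IH. Qed.

(* A set of naturals is stored as its characteristic bit list: [sumset vs s] is
   the sumset [vs + s], and [sums vs L g] lists the sums of [g] elements of [vs]
   up to [L]. *)
Definition sumset (vs : seq nat) (s : bitseq) : bitseq :=
  foldr (fun v acc => orl acc (nseq v false ++ s)) (nseq (size s) false) vs.

Lemma size_sumset vs s : size (sumset vs s) = size s.
Proof.
elim: vs => [|v vs IH] /=; first by rewrite size_nseq.
by rewrite size_orl IH // size_cat leq_addl.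
Qed.

Lemma nth_sumset vs s r : (r < size s)%N ->
  nth false (sumset vs s) r = has (fun v => (v <= r)%N && nth false s (r - v)) vs.
Proof.
move=> rs; elim: vs => [|v vs IH] /=; first by rewrite nth_nseq rs.
rewrite nth_orl ?size_sumset ?size_cat ?leq_addl // IH orbC; congr (_ || _).
by rewrite nth_cat size_nseq nth_nseq ltnNge; case: (leqP v r) => //= ->.
Qed.

Definition sums vs L g : bitseq := iter g (sumset vs) (true :: nseq L false).

Lemma size_sums vs L g : size (sums vs L g) = L.+1.
Proof. by elim: g => [|g IH] /=; rewrite ?size_nseq // size_sumset. Qed.

Lemma sumsP vs L g r : nth false (sums vs L g) r ->
  exists s, [/\ size s = g, {subset s <= vs} & sumn s = r].
Proof.
elim: g r => [|g IH] r.
  case: r => [_|r /=]; first by exists [::].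
  by rewrite nth_nseq if_same.
have [rL|rL] := ltnP r L.+1; last by rewrite nth_default // size_sums.
rewrite /= nth_sumset ?size_sums // => /hasP[v vv /andP[vr /IH[s [sg sv sr]]]].
exists (v :: s); split; rewrite /= ?sg ?sr ?subnKC // => w.
by rewrite inE => /predU1P[-> //|/sv].
Qed.

(* Binary integers keep the evaluation of the checks short in the kernel. *)
Definition qfZ (k b c z y : Z) : Z :=
  Z.add (Z.add (Z.mul (Z.mul k z) z) (Z.mul (Z.mul b z) y)) (Z.mul (Z.mul c y) y).

Definition zvals (k b c : int) (X Y : nat) (B : Z) : seq Z :=
  let k' := Z_of_int k in let b' := Z_of_int b in let c' := Z_of_int c in
  [seq v <- [seq qfZ k' b' c' (Z.sub (Z.of_nat i) (Z.of_nat X)) (Z.of_nat j) | i <- iota 0 (2 * X + 1), j <- iota 0 Y.+1]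
  | (Z.leb Z0 v && Z.leb v B)].

Lemma zvalsP k b c X Y B v : v \in zvals k b c X Y B ->
  [/\ Z.le Z0 v, Z.le v B & exists p, qf k b c p = (Z.to_nat v)%:Z].
Proof.
rewrite mem_filter => /andP[/andP[/Z.leb_le v0 /Z.leb_le vB] /allpairsP[[i j] [_ _ vE]]].
split=> //; exists (i%:Z - X%:Z, j%:Z); rewrite /qf /=.
by move: vE v0 {vB}; rewrite /qfZ /= => ->; lia.
Qed.

(* Write r = m K + i. It suffices to find a value u K + i of the form with m - u a sum of three
   squares, as K is itself a value. For large m a value with m - u = 1 mod 4 or 4 mod 16 does it;
   for m <= M the sums of three squares are tabulated, and r < L is checked directly. *)
Definition full_check (K : nat) (b c : int) (X Y M L : nat) g r0 (ex : seq nat) : bool :=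
  let k' := Z.of_nat K in
  let vs := zvals K b c X Y (Z.pred (Z.mul k' (Z.of_nat (M - 3)))) in
  let ps := [seq (Z.modulo v k', Z.to_nat (Z.div v k')) | v <- vs] in
  let T := sums [seq (i ^ 2)%N | i <- iota 0 22] M 3 in
  let S := sums [seq Z.to_nat v | v <- vs & Z.leb v (Z.of_nat L)] L g in
  [&& (4 <= g)%N, (0 < K)%N, (4 < M)%N,
    all (fun r => (r \in ex) || nth false S r) (iota r0 (L - r0)) &
    all (fun i =>
      let us := [seq p.2 | p <- ps & Z.eqb p.1 (Z.of_nat i)] in
      let rs := [seq (u %% 16)%N | u <- us] in
      all (fun q => q.2 || (q.1 * K + i < L)%N) (zip (iota 0 M.+1) (sumset us T)) &&
      all (fun j => has (fun u => ((u + 1) %% 4 == j %% 4)%N || ((u + 4) %% 16 == j)%N) rs)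
        (iota 0 16))
    (iota 0 K)].

Lemma full_checkP K b c X Y M L g r0 ex : full_check K b c X Y M L g r0 ex ->
  forall r, (r0 <= r)%N -> r \notin ex -> sumq K b c g r.
Proof.
move=> /and5P[g4 K0 M4 /allP small /allP large] r r0r rex.
have [rL|Lr] := ltnP r L.
  have /small : r \in iota r0 (L - r0) by rewrite mem_iota; lia.
  rewrite (negbTE rex) => /sumsP[s [<- sv <-]].
  elim: s sv => [|v s IH] sv; first by exists [::] => //; rewrite big_nil.
  have [|t ts tE] := IH; first by move=> w ws; apply: sv; rewrite inE ws orbT.
  have /mapP[w] : v \in [seq Z.to_nat v | v <- zvals K b c X Y (Z.pred (Z.mul (Z.of_nat K) (Z.of_nat (M - 3)))) & Z.leb v (Z.of_nat L)].
    by apply: sv; rewrite mem_head.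
  rewrite mem_filter => /andP[_ /zvalsP[_ _ [p pE]] wE].
  exists (p :: t); first by rewrite /= ts.
  by rewrite big_cons tE pE -wE.
apply: sumq_leq g4 _.
pose i := (r %% K)%N; pose m := (r %/ K)%N.
have rE : r = (m * K + i)%N by rewrite /m /i -divn_eq.
have /large /andP[/allP mask /allP res] : i \in iota 0 K by rewrite mem_iota ltn_mod.
(* Values below K (M - 3) have u <= M - 4, so for m > M the difference m - u is a genuine one and
   exceeds 4. *)
have usP u : u \in [seq p.2 | p <- [seq (Z.modulo v (Z.of_nat K), Z.to_nat (Z.div v (Z.of_nat K)))
      | v <- zvals K b c X Y (Z.pred (Z.mul (Z.of_nat K) (Z.of_nat (M - 3))))] & Z.eqb p.1 (Z.of_nat i)] ->
    (u + 4 <= M)%N /\ exists p, qf K b c p = (u * K + i)%N%:Z.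
  move=> /mapP[q]; rewrite mem_filter => /andP[/Z.eqb_eq qi /mapP[v /zvalsP[v0 vB [p pE]] qE]] ->.
  rewrite qE /= in qi *.
  have vE := Z_div_mod_eq_full v (Z.of_nat K); rewrite qi in vE.
  move: (Z.div v (Z.of_nat K)) vE => w vE.
  have iK : (i < K)%N by rewrite ltn_mod.
  have w0 : Z.le Z0 w by nia.
  have wM : Z.lt w (Z.of_nat (M - 3)) by nia.
  split; first lia.
  exists p; rewrite pE; congr Posz; nia.
have [mM|Mm] := leqP m M.
  (* The table uses the squares below 22^2 = 484, which covers every M supplied later, at most 421.
     A missing square could only make the check fail. *)
  have TP n : nth false (sums [seq (j ^ 2)%N | j <- iota 0 22] M 3) n ->
      exists x y z, (x ^ 2 + (y ^ 2 + z ^ 2) = n)%N.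
    move=> /sumsP[s [s3 sv <-]]; case: s s3 sv => [|x' [|y' [|z' []]]] //= _ sv.
    have /mapP[x _ xE] : x' \in [seq (j ^ 2)%N | j <- iota 0 22] by apply: sv; rewrite !inE eqxx.
    have /mapP[y _ yE] : y' \in [seq (j ^ 2)%N | j <- iota 0 22] by apply: sv; rewrite !inE eqxx orbT.
    have /mapP[z _ zE] : z' \in [seq (j ^ 2)%N | j <- iota 0 22] by apply: sv; rewrite !inE eqxx !orbT.
    by exists x, y, z; rewrite -xE -yE -zE addn0.
  move: mask usP TP; set us := [seq p.2 | p <- _ & _]; set T := sums _ M 3.
  have sT : size T = M.+1 by apply: size_sums.
  move: us T sT => us T sT mask usP TP.
  have /mask /= : (m, nth false (sumset us T) m) \in zip (iota 0 M.+1) (sumset us T).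
    have sz : size (iota 0 M.+1) = size (sumset us T) by rewrite size_iota size_sumset sT.
    have <- : nth (0%N, false) (zip (iota 0 M.+1) (sumset us T)) m = (m, nth false (sumset us T) m).
      by rewrite nth_zip // nth_iota.
    by rewrite mem_nth // size_zip -sz minnn size_iota.
  rewrite -rE ltnNge Lr orbF nth_sumset ?sT //.
  move=> /hasP[u /usP[_ [p pE]] /andP[um /TP[x [y [z xyz]]]]].
  exists [:: p; (x%:Z, 0); (y%:Z, 0); (z%:Z, 0)] => //.
  rewrite !big_cons big_nil pE /qf /= rE.
  have -> : (m * K + i)%N%:Z = (u * K + i)%N%:Z + K%:Z * (m - u)%N%:Z by rewrite -[in LHS](subnK um) !PoszD !PoszM PoszD; ring.
  by rewrite -xyz !PoszD -!(absz_sqrE (Posz _)) /=; ring.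
have /res /hasP[_ /mapP[u /usP[uM [p pE]] ->] /= E] : (m %% 16)%N \in iota 0 16 by rewrite mem_iota ltn_mod.
have {}E : ((m - u) %% 4 = 1 \/ (m - u) %% 16 = 4)%N by case/orP: E => /eqP E; [left|right]; lia.
have rE' : r%:Z = (u * K + i)%N%:Z + K%:Z * (m - u)%N%:Z.
  by rewrite rE -[in LHS](subnK (_ : u <= m)%N) ?PoszD ?PoszM ?PoszD; [ring|lia].
case: E => [/three_squares_1mod4[x [y [z S]]]|E].
  exists [:: p; (x, 0); (2 * y, 0); (2 * z, 0)] => //.
  by rewrite !big_cons big_nil pE rE' -S /qf /=; ring.
have [|x [y [z S]]] := three_squares_1mod4 (K := ((m - u) %/ 4)%N); first lia.
exists [:: p; (2 * x, 0); (4 * y, 0); (4 * z, 0)] => //.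
have E4 : (m - u)%N%:Z = 4 * ((m - u) %/ 4)%N%:Z by lia.
by rewrite !big_cons big_nil pE rE' E4 -S /qf /=; ring.
Qed.

(** * Finite checks for positive definite forms *)

Section Positive.
Variables (k b c : int) (D : nat).
Hypothesis k0 : 0 < k.
Hypothesis c0 : 0 < c.
Hypothesis kD : 4 * k * c - b ^+ 2 = D%:Z.

Lemma qf_square p : 4 * k * qf k b c p = (2 * k * p.1 + b * p.2) ^+ 2 + D%:Z * p.2 ^+ 2.
Proof. by rewrite -kD /qf; ring. Qed.

Lemma qf_square' p : 4 * c * qf k b c p = (2 * c * p.2 + b * p.1) ^+ 2 + D%:Z * p.1 ^+ 2.
Proof. by rewrite -kD /qf; ring. Qed.

Lemma qf_ge0 p : 0 <= qf k b c p.
Proof.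
rewrite -(pmulr_rge0 (x := 4 * k)) ?mulr_gt0 // qf_square.
by rewrite addr_ge0 ?sqr_ge0 // mulr_ge0 // sqr_ge0.
Qed.

Lemma qf_bound p M X : qf k b c p <= M%:Z ->
  4 * k * M%:Z < D%:Z * X.+1%:Z ^+ 2 -> 4 * c * M%:Z < D%:Z * X.+1%:Z ^+ 2 ->
  (`|p.1| <= X)%N /\ (`|p.2| <= X)%N.
Proof.
move=> pM kM cM.
have H (e z w : int) : 0 < e -> 4 * e * qf k b c p = w ^+ 2 + D%:Z * z ^+ 2 ->
    4 * e * M%:Z < D%:Z * X.+1%:Z ^+ 2 -> (`|z| <= X)%N.
  move=> e0 E eM; rewrite leqNgt; apply/negP => zX.
  have : 4 * e * qf k b c p <= 4 * e * M%:Z by rewrite ler_wpM2l // mulr_ge0 // ltW.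
  rewrite E => /le_lt_trans/(_ eM); apply/negP; rewrite -leNgt.
  apply: ler_wpDl; first exact: sqr_ge0.
  by rewrite ler_wpM2l // -(absz_sqrE z); nia.
by split; [apply: H c0 (qf_square' p) cM|apply: H k0 (qf_square p) kM].
Qed.

Definition qvals X B : seq nat :=
  [seq `|qf k b c p|%N | p <- box X & (`|qf k b c p| <= B)%N].

Definition bound_check X M : bool :=
  (4 * k * M%:Z < D%:Z * X.+1%:Z ^+ 2) && (4 * c * M%:Z < D%:Z * X.+1%:Z ^+ 2).

Lemma sums_sumq X L g r : nth false (sums (qvals X L) L g) r -> sumq k b c g r.
Proof.
move=> /sumsP[s [<- sv <-]].
elim: s sv => [|v s IH] sv; first by exists [::] => //; rewrite big_nil.
have [|t ts tE] := IH; first by move=> w ws; apply: sv; rewrite inE ws orbT.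
have /mapP[p _ vE] : v \in qvals X L by apply: sv; rewrite mem_head.
exists (p :: t); first by rewrite /= ts.
by rewrite big_cons tE -[qf k b c p]gez0_abs ?qf_ge0 // -vE.
Qed.

Lemma qvals_complete X M p : bound_check X M -> (`|qf k b c p| <= M)%N ->
  `|qf k b c p|%N \in qvals X M.
Proof.
move=> /andP[kM cM] pM; apply: map_f; rewrite mem_filter pM mem_box.
have [|-> ->] // := qf_bound (p := p) (M := M) (X := X) _ kM cM.
by rewrite -[qf k b c p]gez0_abs ?qf_ge0.
Qed.

Lemma sumq_cons g r : sumq k b c g.+1 r ->
  exists p r', sumq k b c g r' /\ r = (`|qf k b c p| + r')%N.
Proof.
move=> [[|p s] // [sg]]; rewrite big_cons => E.
have s0 : 0 <= \sum_(p <- s) qf k b c p by apply: sumr_ge0 => q _; apply: qf_ge0.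
exists p, `|(\sum_(p <- s) qf k b c p)%R|%N; split; first by exists s; rewrite // gez0_abs.
by move: E s0 (qf_ge0 p); move: (qf k b c p) (\sum_(_ <- _) _) => x y; lia.
Qed.

Lemma sumq_sums X L g r : bound_check X L -> (r <= L)%N -> sumq k b c g r ->
  nth false (sums (qvals X L) L g) r.
Proof.
move=> XL; elim: g r => [|g IH] r rL.
  by move=> [[|//] _]; rewrite big_nil => /esym/eqP; rewrite eqz_nat => /eqP ->.
move=> /sumq_cons[p [r' [sr' rE]]].
rewrite /= nth_sumset ?size_sums //; apply/hasP; exists `|qf k b c p|%N.
  by apply: qvals_complete => //; lia.
by rewrite rE leq_addr addKn IH //; lia.
Qed.

Definition good r0 (ex : seq nat) r : bool := (r == 0)%N || (r0 <= r)%N && (r \notin ex).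

(* The good numbers are closed under adding a value of the form: for values and summands above M
   this is automatic, since M bounds [r0] and [ex]. *)
Definition semigroup_check X M r0 ex : bool :=
  [&& bound_check X M, (r0 <= M)%N, all (fun e => e <= M)%N ex &
      all (fun v => all (fun s => good r0 ex s ==> good r0 ex (v + s)) (iota 0 M.+1))
        (undup (qvals X M))].

Lemma semigroup_checkP X M r0 ex g r : semigroup_check X M r0 ex ->
  sumq k b c g r -> good r0 ex r.
Proof.
move=> /and4P[XM r0M exM gs].
have big r' : (M < r')%N -> good r0 ex r'.
  move=> Mr; rewrite /good; apply/orP; right; apply/andP; split; first lia.
  by apply/negP => /(allP exM); lia.
elim: g r => [|g IH] r.
  by move=> [[|//] _]; rewrite big_nil => /esym/eqP; rewrite eqz_nat => /eqP ->.
move=> /sumq_cons[p [r' [/IH gr' ->]]]; move: gr'.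
have [Mp|pM] := ltnP M `|qf k b c p|; first by move=> _; apply: big; lia.
have [Mr|rM] := ltnP M r'; first by move=> _; apply: big; lia.
have /(allP gs)/allP H : `|qf k b c p|%N \in undup (qvals X M).
  by rewrite mem_undup; exact: qvals_complete.
by apply/implyP/H; rewrite mem_iota; lia.
Qed.

End Positive.

(* A reduced form with discriminant -d has leading coefficient a with 3 a^2 <= d < 1200. *)
Definition reduced_check (d k : nat) (a2 a3 : int) : bool :=
  (d < 3 * 20 ^ 2)%N &&
  all (fun a : nat => (3 * a ^ 2 <= d)%N ==>
    all (fun t : int => let n := (t ^+ 2 + t + ((d + 1) %/ 4)%N%:Z)%R in
      [&& - a%:Z < 2 * t + 1, 2 * t + 1 <= a%:Z, (a%:Z %| n)%Z & a%:Z ^+ 2 <= n] ==>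
      ((a == 1)%N || (a == k) && ((k%:Z %| t - a2)%Z || (k%:Z %| t - a3)%Z)))
    (zrange a)) (iota 1 20).

(** The inequalities are those of a reduced form with coefficients a, 2 t + 1, n / a and
    discriminant -d. For a = k the class of t mod k already determines the ideal, see
    [latt_shift]. *)
Definition reduced_forms (d k : nat) (a2 a3 : int) : Prop :=
  forall (a : nat) (t : int), let n := t ^+ 2 + t + ((d + 1) %/ 4)%N%:Z in
    (0 < a)%N -> - a%:Z < 2 * t + 1 <= a%:Z -> (a%:Z %| n)%Z -> a%:Z ^+ 2 <= n ->
    a = 1%N \/ a = k /\ ((k%:Z %| t - a2)%Z \/ (k%:Z %| t - a3)%Z).

Lemma reduced_checkP d k a2 a3 : (d %% 4 = 3)%N -> reduced_check d k a2 a3 -> reduced_forms d k a2 a3.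
Proof.
move=> d4 /andP[d20 /allP H] a t n a0 /andP[ta1 ta2] an an2.
have da : (3 * a ^ 2 <= d)%N.
  have E : 4 * n = (2 * t + 1) ^+ 2 + d%:Z.
    have -> : d%:Z = 4 * ((d + 1) %/ 4)%N%:Z - 1 by lia.
    by rewrite /n; ring.
  have : (2 * t + 1) ^+ 2 <= a%:Z ^+ 2 by nia.
  lia.
have /H/implyP/(_ da)/allP : a \in iota 1 20 by rewrite mem_iota; nia.
move=> /(_ t); rewrite mem_zrange => /(_ _)/implyP.
rewrite ta1 ta2 an an2 => /(_ _ isT) -/(_ _)/orP.
case=> [|/eqP ->|/andP[/eqP -> /orP]]; [lia|by left|by right].
Qed.

(** * The arithmetic facts for the sixteen discriminants *)

Record class3_facts (d k : nat) (a2 a3 : int) (r0 : nat) (ex : seq nat) (g : nat)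
    (c : int) : Prop := Class3Facts {
  facts_mod4 : (d %% 4 = 3)%N;
  facts_k : (0 < k)%N;
  facts_c : k%:Z * c = a2 ^+ 2 + a2 + ((d + 1) %/ 4)%N%:Z;
  facts_conj : a3 = - 1 - a2;
  facts_reduced : reduced_forms d k a2 a3;
  facts_sumq1 : forall r, sumq 1 1 ((d + 1) %/ 4)%N g r;
  facts_sumq2 : forall r, (r0 <= r)%N -> r \notin ex -> sumq k (- (2 * a2 + 1)) c g r;
  facts_good : forall m r, sumq k (- (2 * a2 + 1)) c m r -> good r0 ex r;
  facts_min : forall g', (g' < g)%N ->
    (exists2 r, (0 < r)%N & ~ sumq 1 1 ((d + 1) %/ 4)%N g' r) \/
    (exists2 r, (0 < r)%N && good r0 ex r & ~ sumq k (- (2 * a2 + 1)) c g' r)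
}.

Definition arith_check (d k : nat) (a2 a3 c : int) : bool :=
  [&& (d %% 4 == 3)%N, (0 < k)%N, k%:Z * c == a2 ^+ 2 + a2 + ((d + 1) %/ 4)%N%:Z,
      a3 == - 1 - a2 & reduced_check d k a2 a3].

Definition unrepresented (k b c : int) (D m g : nat) : bool :=
  bound_check k c D 2 m && ~~ nth false (sums (qvals k b c 2 m) m g) m.

Lemma unrepresentedP (k b c : int) (D m g g' : nat) :
  0 < k -> 0 < c -> 4 * k * c - b ^+ 2 = D%:Z ->
  unrepresented k b c D m g -> (g' <= g)%N -> ~ sumq k b c g' m.
Proof.
move=> k0 c0 kD /andP[bm /negP H] gg /(sumq_leq gg) S; apply: H.
by apply: (sumq_sums k0 c0 kD bm) => //.
Qed.

Section Facts.
Variables (d k : nat) (a2 a3 : int) (r0 : nat) (ex : seq nat) (g : nat) (c : int).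
Hypothesis arith : arith_check d k a2 a3 c.

Lemma discr : 4 * k%:Z * c - (- (2 * a2 + 1)) ^+ 2 = d%:Z.
Proof.
case/and5P: arith => /eqP d4 _ /eqP kc _ _; rewrite -mulrA kc.
have -> : d%:Z = 4 * ((d + 1) %/ 4)%N%:Z - 1 by lia.
by ring.
Qed.

Lemma discr1 : 4 * 1 * ((d + 1) %/ 4)%N%:Z - 1 ^+ 2 = d%:Z :> int.
Proof. by case/and5P: arith => /eqP d4 _ _ _ _; lia. Qed.

Lemma class3_facts_of (M m : nat) :
  (0 < c) ->
  (forall r, sumq 1 1 ((d + 1) %/ 4)%N g r) ->
  (forall r, (r0 <= r)%N -> r \notin ex -> sumq k (- (2 * a2 + 1)) c g r) ->
  semigroup_check k (- (2 * a2 + 1)) c d 2 M r0 ex ->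
  unrepresented 1 1 ((d + 1) %/ 4)%N d m.+1 g.-1 ||
    good r0 ex m.+1 && unrepresented k (- (2 * a2 + 1)) c d m.+1 g.-1 ->
  class3_facts d k a2 a3 r0 ex g c.
Proof.
move=> c0 s1 s2 sg un; have := arith => /and5P[/eqP d4 k0 /eqP kc /eqP conj red].
have n0 : 0 < ((d + 1) %/ 4)%N%:Z by lia.
split=> //.
- exact: reduced_checkP.
- by move=> g' r; apply: semigroup_checkP sg; rewrite ?discr.
- move=> g' gg'; have {}gg' : (g' <= g.-1)%N by lia.
  case/orP: un => [un|/andP[gm un]]; [left|right].
    by exists m.+1 => //; apply: unrepresentedP un gg' => //; exact: discr1.
  exists m.+1; first by rewrite gm.
  by apply: unrepresentedP un gg' => //; exact: discr.
Qed.

End Facts.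

Lemma class3_facts_of_checks d k a2 a3 r0 ex g c X Y L M M' m :
  [&& arith_check d k a2 a3 c, 0 < c, full_check k (- (2 * a2 + 1)) c X Y M L g r0 ex,
      semigroup_check k (- (2 * a2 + 1)) c d 2 M' r0 ex &
      unrepresented 1 1 ((d + 1) %/ 4)%N d m.+1 g.-1 ||
        good r0 ex m.+1 && unrepresented k (- (2 * a2 + 1)) c d m.+1 g.-1] ->
  class3_facts d k a2 a3 r0 ex g c.
Proof.
move=> /and5P[ar c0 full sg un]; have g4 : (4 <= g)%N by case/and5P: full.
apply: (@class3_facts_of _ _ _ _ _ _ _ _ ar M' m) => //.
  by move=> r; apply: sumq_leq g4 (sumq_four_squares _ _ _).
by move=> r; apply: full_checkP full r.
Qed.

(* For X, Y in Z^3 the value is r iff [4 r = |2 X + Y| ^ 2 + 23 |Y| ^ 2]; take Y = (1, 0, 0). *)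
Lemma sumq_23_1 r : sumq 1 1 6 3 r.
Proof.
have [r6|r6] := ltnP r 6.
  apply: (@sums_sumq 1 1 6 23 _ _ 2 6) => //.
  by move: r r6; do 6!case=> //.
have [|x [y [z E]]] := three_squares_1mod4 (K := (4 * r - 23)%N); first lia.
have [|u xE] := odd_of_3squares E; first lia.
exists [:: (u, 1); (y, 0); (z, 0)] => //; rewrite !big_cons big_nil /qf /=.
apply: (mulfI (x := 4)) => //.
have -> : 4 * r%:Z = (4 * r - 23)%N%:Z + 23 by lia.
by rewrite -E xE; ring.
Qed.

(* Now [8 r = |4 X - Y| ^ 2 + 23 |Y| ^ 2] with Y = (1, 2, 0): the squares in 8 r - 115 fall
   into the residue classes required of 4 X - Y, up to signs and order. *)
Lemma sumq_23_2 r : (2 <= r)%N -> sumq 2 (- 1) 3 3 r.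
Proof.
move=> r2; have [r15|r15] := ltnP r 15.
  apply: (@sums_sumq 2 (- 1) 3 23 _ _ 2 15) => //.
  by move: r r2 r15; do 15!case=> //.
have [|x [y [z]]] := three_squares_1mod4 (K := (8 * r - 115)%N); first lia.
(* As 8 r - 115 = 5 mod 8 and x is odd, exactly one of y and z is odd. The odd one becomes 2 v - 1,
   the even one 2 w, and a sign brings x into the class -1 mod 4. *)
wlog y2 : y z / odd `|y| => [H E|E].
  have [|u xE] := odd_of_3squares E; first lia.
  have : odd `|y| || odd `|z|.
    apply/norP => -[y2 z2]; move: E.
    case: (sqrz_mod x) (sqrz_mod y) (sqrz_mod z) => -[k e ->] [] [k' e' ->] [] [k'' e'' ->]; try lia.
  case/orP => h; first exact: (H y z).
  by apply: (H z y) => //; rewrite -E; ring.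
have [|u xE] := odd_of_3squares E; first lia.
have z2 : ~~ odd `|z|.
  apply/negP => z2; move: E; rewrite xE.
  case: (sqrz_mod y) (sqrz_mod z) => -[k' e' ->] [] [k'' e'' ->]; try lia.
  have : (2 %| u * (u + 1))%Z by rewrite dvdzE abszM dvdn2 oddM; lia.
  by move=> /dvdzP[l el]; lia.
have [v yE] : exists v, y = 2 * v - 1 by exists ((y + 1) %/ 2)%Z; lia.
have [w zE] : exists w, z = 2 * w by exists (z %/ 2)%Z; lia.
have [s [e [ee sE]]] : exists s e : int, e ^+ 2 = 1 /\ 4 * s - 1 = e * x.
  have [l [ul|ul]] : exists l, u = 2 * l \/ u = 2 * l + 1 by exists (u %/ 2)%Z; lia.
    by exists (- l), (- 1); split; lia.
  by exists (l + 1), 1; split; lia.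
exists [:: (s, 1); (v, 2); (w, 0)] => //; rewrite !big_cons big_nil /qf /=.
apply: (mulfI (x := 8)) => //.
have -> : 8 * r%:Z = (8 * r - 115)%N%:Z + 115 by lia.
have xs : x ^+ 2 = (4 * s - 1) ^+ 2 by rewrite sE exprMn ee mul1r.
by rewrite -E xs yE zE; ring.
Qed.

(** The witness is c = N(a2 + w) / k. The last two parameters of each check are the largest excluded
    number and the predecessor of a number that g - 1 values miss. That number is 7 for the entries
    with g = 4: it is not a sum of three squares, and the other values of the principal form are at
    least (d + 1) / 4 >= 8. For d = 23 it is 3; for d = 907 it is 81, missed by four values of the
    nonprincipal form. *)
Lemma class3_dataP d k a2 a3 r0 ex g : class3_data d k a2 a3 r0 ex g ->
  exists c, class3_facts d k a2 a3 r0 ex g c.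
Proof.
case.
- have ar : arith_check 23 2 0 (-1) 3 by vm_compute.
  exists 3; apply: (@class3_facts_of _ _ _ _ _ _ _ _ ar 2 2) => //.
  + exact: sumq_23_1.
  + by move=> r r2 _; exact: sumq_23_2.
- by exists 4; apply: (@class3_facts_of_checks _ _ _ _ _ _ _ _ 3 2 4 16 3 6); vm_compute.
- by exists 5; apply: (@class3_facts_of_checks _ _ _ _ _ _ _ _ 9 7 5 89 4 6); vm_compute.
- by exists 7; apply: (@class3_facts_of_checks _ _ _ _ _ _ _ _ 11 7 9 145 8 6); vm_compute.
- by exists 9; apply: (@class3_facts_of_checks _ _ _ _ _ _ _ _ 12 7 11 157 10 6); vm_compute.
- by exists 7; apply: (@class3_facts_of_checks _ _ _ _ _ _ _ _ 10 8 43 111 9 6); vm_compute.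
- by exists 11; apply: (@class3_facts_of_checks _ _ _ _ _ _ _ _ 12 8 47 164 17 6); vm_compute.
- by exists 11; apply: (@class3_facts_of_checks _ _ _ _ _ _ _ _ 14 11 79 189 19 6); vm_compute.
- by exists 11; apply: (@class3_facts_of_checks _ _ _ _ _ _ _ _ 13 10 67 172 27 6); vm_compute.
- by exists 17; apply: (@class3_facts_of_checks _ _ _ _ _ _ _ _ 13 7 67 175 33 6); vm_compute.
- by exists 19; apply: (@class3_facts_of_checks _ _ _ _ _ _ _ _ 12 6 59 171 36 6); vm_compute.
- by exists 25; apply: (@class3_facts_of_checks _ _ _ _ _ _ _ _ 13 6 105 183 42 6); vm_compute.
- by exists 13; apply: (@class3_facts_of_checks _ _ _ _ _ _ _ _ 15 13 179 220 36 6); vm_compute.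
- by exists 23; apply: (@class3_facts_of_checks _ _ _ _ _ _ _ _ 13 7 129 195 55 6); vm_compute.
- by exists 17; apply: (@class3_facts_of_checks _ _ _ _ _ _ _ _ 20 17 579 421 66 6); vm_compute.
- by exists 19; apply: (@class3_facts_of_checks _ _ _ _ _ _ _ _ 21 17 359 409 63 80); vm_compute.
Qed.

(** * Imaginary quadratic integers *)

Section ImaginaryQuadratic.
Variable d : nat.
Hypothesis d4 : (d %% 4 = 3)%N.
Local Notation E := (imquad d).
Local Notation w := (omega d).
Let n0 : nat := ((d + 1) %/ 4)%N.

Lemma imquad_int_eq0 (z : int) : (z%:~R == 0 :> E) = (z == 0).
Proof.
by rewrite -(inj_eq val_inj) rmorph_int rmorph0 intr_eq0.
Qed.

Lemma imquad_nat_eq0 (n : nat) : (n%:R == 0 :> E) = (n == 0%N).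
Proof. exact: (imquad_int_eq0 n). Qed.

Lemma imquad_ratr (r k : nat) : ratr (r%:R / k%:R) = r%:R / k%:R :> E.
Proof.
apply: val_inj; rewrite fmorph_rat [RHS]fmorph_div fmorph_div.
by rewrite !rmorph_nat.
Qed.

Lemma sqrtNE_sqr : sqrtNE d ^+ 2 = - d%:R.
Proof.
apply: val_inj; rewrite [LHS]rmorphXn [RHS]raddfN [X in _ = - X]rmorph_nat.
exact: sqrtN_sqr.
Qed.

Lemma conj_sqrtNE : conjE (sqrtNE d) = - sqrtNE d.
Proof. by apply: val_inj; rewrite [RHS]raddfN; exact: conj_sqrtN. Qed.

Lemma omegaE : w = (1 + sqrtNE d) / 2.
Proof. by rewrite /omega d4 eqxx. Qed.

Lemma two_neq0 : 2 != 0 :> E. Proof. by rewrite imquad_nat_eq0. Qed.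

Lemma omega_double : 2 * w = 1 + sqrtNE d.
Proof. by rewrite omegaE mulrC divfK // two_neq0. Qed.

Lemma d_n0 : d%:R = 4 * n0%:R - 1 :> E.
Proof.
have -> : d = (4 * n0 - 1)%N by rewrite /n0; lia.
by rewrite natrB ?natrM // /n0; lia.
Qed.

Lemma omega_sqr : w ^+ 2 = w - n0%:R.
Proof.
apply: (mulfI (x := 4)); first by rewrite imquad_nat_eq0.
have -> : 4 * w ^+ 2 = (2 * w) ^+ 2 by ring.
have -> : 4 * (w - n0%:R) = 2 * (2 * w) - 4 * n0%:R by ring.
rewrite omega_double; have := sqrtNE_sqr; rewrite d_n0 => S; ring: S.
Qed.

Lemma conj_omega : conjE w = 1 - w.
Proof.
apply: (mulfI two_neq0).
have -> : 2 * conjE w = conjE (2 * w) by rewrite rmorphM rmorph_nat.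
have -> : 2 * (1 - w) = 2 - 2 * w by ring.
by rewrite omega_double rmorphD rmorph1 /= conj_sqrtNE; ring.
Qed.

Lemma sqrtNE_neq0 : sqrtNE d != 0.
Proof.
apply/eqP => s0; have := sqrtNE_sqr; rewrite s0 expr0n /= => /esym/eqP.
by rewrite oppr_eq0 imquad_nat_eq0; lia.
Qed.

Lemma omega_free (p q : int) : p%:~R + q%:~R * w = 0 :> E -> p = 0 /\ q = 0.
Proof.
move=> H; have H' : p%:~R + q%:~R * (1 - w) = 0.
  by rewrite -conj_omega -(rmorph0 (@conjE d)) -H rmorphD rmorphM !rmorph_int.
have q0 : q%:~R * sqrtNE d = 0.
  have -> : sqrtNE d = 2 * w - 1 by rewrite omega_double; ring.
  by rewrite -[RHS](subrr 0) -{1}H -H'; ring.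
move/eqP: q0; rewrite mulf_eq0 (negbTE sqrtNE_neq0) orbF imquad_int_eq0 => /eqP q0.
by move/eqP: H; rewrite q0 mul0r addr0 imquad_int_eq0 => /eqP.
Qed.

Lemma omega_inj (p q p' q' : int) :
  p%:~R + q%:~R * w = p'%:~R + q'%:~R * w :> E -> p = p' /\ q = q'.
Proof.
move=> H; have [|/eqP] := omega_free (p := p - p') (q := q - q').
  by rewrite !rmorphB /= mulrBl addrACA -opprD H subrr.
by rewrite subr_eq0 => /eqP -> /eqP; rewrite subr_eq0 => /eqP ->.
Qed.

Lemma ringO_int (z : int) : ringO (z%:~R : E).
Proof. by exists z, 0; rewrite mul0r addr0. Qed.

Lemma ringO_nat (n : nat) : ringO (n%:R : E).
Proof. exact: (ringO_int n). Qed.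

Lemma ringO_omega : ringO w.
Proof. by exists 0, 1; rewrite mul1r add0r. Qed.

Lemma ringOD (x y : E) : ringO x -> ringO y -> ringO (x + y).
Proof.
move=> [p [q ->]] [p' [q' ->]]; exists (p + p'), (q + q').
by rewrite !rmorphD /=; ring.
Qed.

Lemma ringOM (x y : E) : ringO x -> ringO y -> ringO (x * y).
Proof.
move=> [p [q ->]] [p' [q' ->]]; exists (p * p' - n0%:Z * q * q'), (p * q' + q * p' + q * q').
have := omega_sqr; rewrite !(rmorphD, rmorphN, rmorphM) /= => W; ring: W.
Qed.

Lemma ringO_conj (x : E) : ringO x -> ringO (conjE x).
Proof.
move=> [p [q ->]]; exists (p + q), (- q).
by rewrite rmorphD rmorphM !rmorph_int /= conj_omega rmorphD rmorphN /=; ring.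
Qed.

Lemma normO (p q : int) : (p%:~R + q%:~R * w) * conjE (p%:~R + q%:~R * w) =
  (p ^+ 2 + p * q + n0%:Z * q ^+ 2)%:~R :> E.
Proof.
rewrite rmorphD rmorphM !rmorph_int /= conj_omega.
by have := omega_sqr; rewrite !(rmorphD, rmorphM, rmorphXn) /= => W; ring: W.
Qed.

Section Lattice.
Variables (k : nat) (a c : int).
Hypothesis k0 : (0 < k)%N.
Hypothesis kc : k%:Z * c = a ^+ 2 + a + n0%:Z.
Local Notation b := (- (2 * a + 1)).

(** The ideal is given by a Z-basis; closure under O is [lattM], where k c = N(a + w) enters. *)
Definition latt : set E :=
  [set x | exists p q : int, x = p%:~R * k%:R + q%:~R * (a%:~R + w)].

Lemma kcE : k%:R * c%:~R = a%:~R ^+ 2 + a%:~R + n0%:R :> E.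
Proof.
have := congr1 (fun z : int => z%:~R : E) kc.
by rewrite !(rmorphD, rmorphM, rmorphXn).
Qed.

Lemma k_neq0 : k%:R != 0 :> E.
Proof. by rewrite imquad_nat_eq0 -lt0n. Qed.

Lemma latt_k : latt k%:R.
Proof. by exists 1, 0; rewrite mul0r mul1r addr0. Qed.

Lemma latt_w : latt (a%:~R + w).
Proof. by exists 0, 1; rewrite mul0r mul1r add0r. Qed.

Lemma lattD x y : latt x -> latt y -> latt (x + y).
Proof.
move=> [p [q ->]] [p' [q' ->]]; exists (p + p'), (q + q').
by rewrite !rmorphD /=; ring.
Qed.

Lemma lattM s x : ringO s -> latt x -> latt (s * x).
Proof.
move=> [u [v ->]] [p [q ->]].
exists (u * p - v * p * a - c * v * q), (u * q + v * p * k%:Z + v * q * (a + 1)).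
rewrite !(rmorphD, rmorphN, rmorphM, rmorph1) /=.
have W := omega_sqr; have K := kcE; ring: W K.
Qed.

Lemma latt_ideal2 : ideal2 k%:R (a%:~R + w) = latt.
Proof.
apply/seteqP; split=> x /=.
  move=> [s [t [Os Ot ->]]].
  by apply: lattD; apply: lattM => //; [exact: latt_k|exact: latt_w].
by move=> [p [q ->]]; exists p%:~R, q%:~R; split=> //; exact: ringO_int.
Qed.

Lemma latt_mul_conj x y : latt x -> latt y -> exists2 z, ringO z & x * conjE y = k%:R * z.
Proof.
move=> [p [q ->]] [p' [q' ->]].
exists ((p * p' * k%:Z + p * q' * (a + 1) + q * p' * a + q * q' * c)%:~R
        + (q * p' - p * q')%:~R * w).
  by exists (p * p' * k%:Z + p * q' * (a + 1) + q * p' * a + q * q' * c), (q * p' - p * q').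
rewrite rmorphD !rmorphM rmorphD !rmorph_int /= rmorph_nat conj_omega.
rewrite !(rmorphD, rmorphN, rmorphM, rmorph1) /=.
have W := omega_sqr; have K := kcE; ring: W K.
Qed.

Lemma latt_norm p q :
  (p%:~R * k%:R + q%:~R * (a%:~R + w)) * conjE (p%:~R * k%:R + q%:~R * (a%:~R + w)) =
  k%:R * (qf k (- b) c (p, q))%:~R :> E.
Proof.
rewrite rmorphD !rmorphM rmorphD !rmorph_int /= rmorph_nat conj_omega /qf /=.
rewrite !(rmorphD, rmorphN, rmorphM, rmorph1, rmorphXn) /=.
have W := omega_sqr; have K := kcE; ring: W K.
Qed.

(** The hypothesis places x in the conjugate ideal: comparing coefficients of w gives x = t k - v (a
    + 1 - w), and a + 1 - w is the conjugate of a + w. *)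
Lemma codivisor x : ringO x -> (exists2 s, ringO s & (a%:~R + w) * x = k%:R * s) ->
  exists p, x * conjE x = k%:R * (qf k b c p)%:~R.
Proof.
move=> [u [v ->]] [_ [s [t ->]] E1].
have [|e1 e2] := omega_inj (p := a * u - n0%:Z * v) (q := u + a * v + v)
    (p' := k%:Z * s) (q' := k%:Z * t).
  move: E1; rewrite !(rmorphD, rmorphN, rmorphM) /= => E1.
  have -> : k%:R * s%:~R + k%:R * t%:~R * w = k%:R * (s%:~R + t%:~R * w) :> E by ring.
  by rewrite -E1; have W := omega_sqr; ring: W.
exists (t, v); rewrite normO; have -> : u = k%:Z * t - (a + 1) * v by lia.
rewrite -[k%:R]/(k%:Z%:~R) -rmorphM /=; congr (_%:~R).
rewrite /qf /=; have -> : n0%:Z = k%:Z * c - a ^+ 2 - a by lia.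
ring.
Qed.

(** Here x runs through the inverse ideal, with Z-basis 1 and (a + 1 - w) / k. *)
Lemma codivisor_of (z y : int) : exists x : E,
  [/\ forall s, latt s -> ringO (s * x) & x * conjE x * k%:R = (qf k b c (z, y))%:~R].
Proof.
pose x : E := z%:~R - y%:~R * (a%:~R + 1 - w) / k%:R.
have xk : k%:R * x = k%:R * z%:~R - y%:~R * (a%:~R + 1 - w).
  by rewrite /x mulrBr mulrC [k%:R * (_ / _)]mulrC divfK ?k_neq0.
exists x; split.
  move=> _ [p [q ->]].
  have -> : (p%:~R * k%:R + q%:~R * (a%:~R + w)) * x =
     p%:~R * (k%:R * x) + q%:~R * (z%:~R * (a%:~R + w) - y%:~R * c%:~R).
    rewrite mulrDl mulrA; congr (_ + _); rewrite -mulrA; congr (_ * _).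
    apply: (mulfI k_neq0); rewrite mulrCA xk.
    by have W := omega_sqr; have K := kcE; ring: W K.
  apply: ringOD; apply: ringOM; try exact: ringO_int.
    rewrite xk; exists (k%:Z * z - y * (a + 1)), y.
    by rewrite !(rmorphD, rmorphN, rmorphM, rmorph1) /=; ring.
  exists (z * a - y * c), z.
  by rewrite !(rmorphD, rmorphN, rmorphM) /=; ring.
apply: (mulfI k_neq0).
have -> : k%:R * (x * conjE x * k%:R) = (k%:R * x) * conjE (k%:R * x).
  by rewrite rmorphM rmorph_nat; ring.
rewrite xk !(rmorphD, rmorphN, rmorphM, rmorph1) /= !rmorph_int rmorph_nat conj_omega.
rewrite /qf /=.
have W := omega_sqr; have K := kcE; ring: W K.
Qed.

End Lattice.

End ImaginaryQuadratic.

(** * Unary Hermitian lattices *)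

Section Representations.
Variable d : nat.
Local Notation E := (imquad d).
Local Notation w := (omega d).
Local Notation n0 := ((d + 1) %/ 4)%N.

Lemma hermZ (V : lmodType E) (h : {hermitian V for false & @conjE d}) (x y : E) (v : V) :
  h (x *: v) (y *: v) = x * conjE y * h v v.
Proof. by rewrite linearZl_LR linearZr_LR /= mulrA. Qed.

Lemma represented_isometric (V W U : lmodType E) (hV : {hermitian V for false & @conjE d})
    (hW : {hermitian W for false & @conjE d}) (hU : {hermitian U for false & @conjE d})
    (L : set V) (K : set W) (M : set U) :
  isometric hV L hW K -> represented hW K hU M -> represented hV L hU M.
Proof.
move=> [f [fK fD fZ fI fh] _] [f' [fM fD' fZ' fI' fh']].
exists (f' \o f); split=> /=.
- by move=> x Lx; apply/fM/fK.
- by move=> x y Lx Ly; rewrite fD // fD' //; exact: fK.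
- by move=> a x Oa Lx; rewrite fZ // fZ' //; exact: fK.
- by move=> x y Lx Ly /fI' E; apply: fI => //; apply: E; exact: fK.
- by move=> x y Lx Ly; rewrite fh' ?fh //; exact: fK.
Qed.

Hypothesis d4 : (d %% 4 = 3)%N.
Variables (k : nat) (a c : int).
Hypothesis k0 : (0 < k)%N.
Hypothesis kc : k%:Z * c = a ^+ 2 + a + n0%:Z.
Local Notation b := (- (2 * a + 1)).
Local Notation lat := (@latt d k a).

Lemma line_formE (r : nat) (x y : E^o) :
  line_form (r%:R / k%:R) x y = r%:R / k%:R * (x * conjE y) :> E.
Proof. by rewrite /line_form imquad_ratr. Qed.

Section OneLattice.
Variables (V : lmodType E) (h : {hermitian V for false & @conjE d}) (v : V).
Local Notation L := (scaled lat v).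

Let Lk : L (k%:R *: v).
Proof. by exists k%:R => //; exact: latt_k. Qed.

Let Lw : L ((a%:~R + w) *: v).
Proof. by exists (a%:~R + w) => //; exact: latt_w. Qed.

(** Let n = h(k v), an integer. Integrality of h(k v, (a + w) v) means that n (a + 1 - w) lies in k
    O, and the coefficient of w gives k | n; then r = n / k. *)
Lemma unary_norm : v != 0 -> posdef_integral h L ->
  exists2 r : nat, (0 < r)%N & h v v = r%:R / k%:R.
Proof.
move=> v0 [pos int]; have kE := k_neq0 d k0.
have [|n n1 nE] := pos _ Lk; first by rewrite scaler_eq0 negb_or kE.
have [x [y xy]] := int _ _ Lk Lw; rewrite hermZ in nE.
rewrite rmorph_nat in nE.
have H : n%:R * conjE (a%:~R + w) = k%:R * (x%:~R + y%:~R * w).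
  by rewrite -xy hermZ -nE; ring.
have [|_ /esym ky] := omega_inj d4 (p := n%:Z * (a + 1)) (q := - n%:Z) (p' := k%:Z * x) (q' := k%:Z * y).
  transitivity (k%:R * (x%:~R + y%:~R * w) : E).
    rewrite -H rmorphD rmorph_int /= conj_omega // !(rmorphD, rmorphN, rmorphM, rmorph1) /=.
    by ring.
  by rewrite !rmorphM /=; ring.
have nk : n = (k * `|y|)%N by nia.
exists `|y|%N; first by case: (posnP `|y|) => // y0; rewrite nk y0 muln0 in n1.
apply: (mulfI kE); apply: (mulfI kE).
by rewrite mulrA nE [k%:R * (_ / _)]mulrC divfK // nk natrM.
Qed.

Variable r : nat.
Hypothesis r0 : (0 < r)%N.
Hypothesis hvv : h v v = r%:R / k%:R.

Lemma hvv_neq0 : h v v != 0.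
Proof. by rewrite hvv mulf_neq0 ?invr_eq0 ?(k_neq0 d k0) // imquad_nat_eq0; lia. Qed.

Lemma represented_sumq m : represented h L (@std_form d m) (@std_lattice d m) ->
  sumq k b c m r.
Proof.
move=> [f [fK fD fZ _ fh]].
(* The vector v may lie outside L, so f is applied to k v. The relation (a + w) P = k f((a + w) v)
   turns every coordinate of P into a codivisor, and the norms of these add up to h(k v) = k r. *)
have [P Pe] : exists P, P = f (k%:R *: v) by exists (f (k%:R *: v)).
have fE : (a%:~R + w) *: P = k%:R *: f ((a%:~R + w) *: v).
  rewrite Pe -!fZ //.
  - by rewrite !scalerA mulrC.
  - exact: ringO_nat.
  - by apply: ringOD; [exact: ringO_int|exact: ringO_omega].
have H (i : 'I_m) : exists p, P 0 i * conjE (P 0 i) = k%:R * (qf k b c p)%:~R.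
  apply: codivisor => //; first by rewrite Pe; apply: fK.
  exists (f ((a%:~R + w) *: v) 0 i); first exact: fK.
  by have := congr1 (fun M : 'rV_m => M 0 i) fE; rewrite !mxE.
have [g gE] := fin_all_exists H.
exists [seq g i | i <- enum 'I_m]; first by rewrite size_map size_enum_ord.
rewrite big_map big_enum /=.
have kE := k_neq0 d k0.
have E1 : std_form P P = k%:R * r%:R.
  by rewrite Pe fh // hermZ hvv rmorph_nat -mulrA; congr (_ * _); rewrite mulrC divfK.
have E2 : std_form P P = k%:R * (\sum_(i < m) qf k b c (g i))%:~R.
  by rewrite /std_form rmorph_sum mulr_sumr; apply: eq_bigr => i _.
have := etrans (esym E1) E2 => /(mulfI kE) E3; apply/eqP.
rewrite -subr_eq0 -(imquad_int_eq0 d) rmorphB /= -E3.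
by rewrite -[r%:~R]/(r%:R) subrr.
Qed.

Lemma sumq_represented m : sumq k b c m r ->
  represented h L (@std_form d m) (@std_lattice d m).
Proof.
move=> [s sm sr]; have kE := k_neq0 d k0.
have H (p : int * int) : exists x : E, (forall s, lat s -> ringO (s * x)) /\
    x * conjE x * k%:R = (qf k b c p)%:~R.
  by case: p => z y; have [x [x1 x2]] := codivisor_of d4 k0 kc z y; exists x.
have [g gE] := choice H.
pose X : 'rV[E]_m := \row_i g (nth (0, 0) s i).
have XX : std_form X X = h v v.
  apply: (mulIf kE); rewrite hvv divfK // -[r%:R]/((r%:Z)%:~R) -sr /std_form mulr_suml.
  rewrite (big_nth (0, 0)) sm big_mkord rmorph_sum; apply: eq_bigr => i _.
  by rewrite !mxE (gE _).2.
have fE x : h (x *: v) v / h v v = x by rewrite linearZl_LR /= mulfK // hvv_neq0.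
(* The functional h(x, v) / h(v, v) recovers the coefficient of v on the line E v, and it is defined
   on all of V. *)
exists (fun x => (h x v / h v v) *: X); split.
- by move=> _ [x lx <-] i; rewrite fE !mxE; apply: (gE _).1.
- by move=> x y _ _; rewrite linearDl mulrDl scalerDl.
- by move=> e x _ _; rewrite linearZl_LR /= -mulrA scalerA.
- move=> _ _ [x lx <-] [y ly <-]; rewrite !fE => xy; congr (_ *: _).
  apply/eqP; rewrite -subr_eq0; apply/eqP.
  have : (x - y) *: X = 0 by rewrite scalerBl xy subrr.
  move/eqP; rewrite scaler_eq0 => /orP[/eqP //|/eqP X0].
  by move: hvv_neq0; rewrite -XX X0 linear0l eqxx.
- by move=> _ _ [x lx <-] [y ly <-]; rewrite !fE !hermZ; congr (_ * _); exact: XX.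
Qed.

Lemma isometric_line :
  isometric h L (line_form (r%:R / k%:R)) (scaled lat (1 : E^o)).
Proof.
have fE x : h (x *: v) v / h v v = x by rewrite linearZl_LR /= mulfK // hvv_neq0.
exists (fun x => (h x v / h v v : E^o)).
  split.
  - by move=> _ [x lx <-]; rewrite fE; exists x => //; exact: mulr1.
  - by move=> x y _ _; rewrite linearDl mulrDl.
  - by move=> e x _ _; rewrite linearZl_LR /= -mulrA.
  - by move=> _ _ [x lx <-] [y ly <-]; rewrite !fE => ->.
  - move=> _ _ [x lx <-] [y ly <-]; rewrite !fE hermZ hvv [RHS]mulrC.
    exact: line_formE.
move=> _ [x lx <-]; exists (x *: v); first by exists x.
by rewrite fE; exact/esym/mulr1.
Qed.

End OneLattice.

Lemma line_form_scaled (r : nat) (x y : E) :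
  line_form (r%:R / k%:R) (x *: (1 : E^o)) (y *: (1 : E^o)) = x * conjE y * (r%:R / k%:R) :> E.
Proof. by rewrite line_formE ![_ *: _]mulr1 mulrC. Qed.

Lemma line_form1 (r : nat) : line_form (r%:R / k%:R) (1 : E^o) (1 : E^o) = r%:R / k%:R :> E.
Proof. by rewrite line_formE rmorph1 !mulr1. Qed.

Lemma unary_line : unary (scaled lat (1 : E^o)).
Proof.
exists lat, 1; split=> //; last exact: oner_neq0.
split; last by exists k%:R; [exact: latt_k|exact: k_neq0].
exists 2%N, (fun i : 'I_2 => if i == ord0 then k%:R else a%:~R + w : E^o).
apply/seteqP; split=> x.
  move=> [p [q ->]]; exists (fun i : 'I_2 => if i == ord0 then p%:~R else q%:~R).
  split; first by move=> i; case: ifP => _; exact: ringO_int.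
  by rewrite !big_ord_recl big_ord0 addr0.
move=> [e [Oe ->]]; rewrite !big_ord_recl big_ord0 addr0 /=.
by apply: lattD; apply: (lattM d4 kc) => //; [exact: latt_k|exact: latt_w].
Qed.

Lemma posdef_integral_line (r : nat) : (0 < r)%N ->
  posdef_integral (line_form (r%:R / k%:R)) (scaled lat (1 : E^o)).
Proof.
move=> r0; have kE := k_neq0 d k0; split.
  move=> _ [x lx <-] x0.
  have [p [q xE]] := lx.
  have cD : 4 * k%:Z * c - (- b) ^+ 2 = d%:Z.
    have -> : d%:Z = 4 * n0%:Z - 1 by lia.
    by rewrite -mulrA kc; ring.
  have c0 : 0 < c by nia.
  have q0 : 0 <= qf k (- b) c (p, q) by apply: (qf_ge0 (D := d)).
  exists (r * `|qf k (- b) c (p, q)|)%N; last first.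
    apply: etrans (line_form_scaled r x x) _; rewrite xE (latt_norm d4 kc) natrM.
    have -> : (`|qf k (- b) c (p, q)|%N)%:R = (qf k (- b) c (p, q))%:~R :> E.
      by rewrite -{2}(gez0_abs q0).
    by rewrite mulrC mulrA divfK.
  rewrite muln_gt0 r0 /= absz_gt0; apply/eqP => qe.
  have := latt_norm d4 kc p q; rewrite -xE qe mulr0 => /eqP.
  rewrite mulf_eq0 fmorph_eq0 orbb => /eqP xz.
  by move: x0; rewrite xz scale0r eqxx.
move=> _ _ [x lx <-] [y ly <-].
suff : ringO (x * conjE y * (r%:R / k%:R)) by rewrite -line_form_scaled.
have [z Oz ->] := latt_mul_conj d4 kc lx ly.
have -> : k%:R * z * (r%:R / k%:R) = r%:R * z.
  by rewrite mulrC mulrA divfK.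
by apply: ringOM => //; exact: ringO_nat.
Qed.

End Representations.

(** * Reduction of fractional ideals *)

Lemma min_nat (P : nat -> Prop) : (exists n, P n) ->
  exists2 n, P n & forall m, P m -> (n <= m)%N.
Proof.
move=> [n Pn]; have exP : exists n, `[< P n >] by exists n; apply/asboolP.
case: (ex_minnP exP) => m /asboolP Pm mmin; exists m => // m' /asboolP; exact: mmin.
Qed.

Section Reduction.
Variable d : nat.
Local Notation E := (imquad d).
Local Notation w := (omega d).
Local Notation n0 := ((d + 1) %/ 4)%N.
Hypothesis d4 : (d %% 4 = 3)%N.

Lemma imquad_denominator (x : E) : exists2 D : nat, (0 < D)%N & ringO (D%:R * x).
Proof.
have [r [s xE]] : exists r s : rat, x = ratr r + ratr s * sqrtNE d.
  have /QsqrtP[r [s rs]] := valP x; exists r, s; apply: val_inj.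
  rewrite rs [RHS]rmorphD [X in _ = _ + X]rmorphM.
  by congr (_ + _ * _); apply/esym/fmorph_rat.
exists (`|denq r| * `|denq s|)%N; first by rewrite muln_gt0 !absz_gt0 !denq_neq0.
have den (q : rat) : (`|denq q|%N)%:R * ratr q = (numq q)%:~R :> E.
  rewrite -[(`|denq q|%N)%:R]/((`|denq q|%N%:Z)%:~R) gtz0_abs ?denq_gt0 //.
  by rewrite /ratr mulrC divfK // imquad_int_eq0 denq_neq0.
have -> : (`|denq r| * `|denq s|)%N%:R * x =
   (`|denq s|)%N%:R * ((`|denq r|)%N%:R * ratr r) + (`|denq r|)%N%:R * ((`|denq s|)%N%:R * ratr s) * (2 * w - 1).
  by rewrite omega_double // xE natrM; ring.
rewrite !den; apply: ringOD; apply: (ringOM d4).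
- exact: ringO_nat.
- exact: ringO_int.
- by apply: (ringOM d4); [exact: ringO_nat|exact: ringO_int].
- apply: ringOD; last exact: (ringO_int d (- 1)).
  by apply: (ringOM d4); [exact: ringO_nat|exact: ringO_omega].
Qed.

Lemma latt_shift (k : nat) (a a' : int) : (k%:Z %| a - a')%Z -> @latt d k a = latt k a'.
Proof.
suff H (b b' : int) : (k%:Z %| b - b')%Z -> (@latt d k b `<=` latt k b')%classic.
  by move=> ka; apply/seteqP; split; apply: H => //; rewrite dvdzE distnC -dvdzE.
move=> /dvdzP[m /eqP]; rewrite subr_eq => /eqP -> _ [p [q ->]].
exists (p + q * m), q; rewrite !(rmorphD, rmorphM) /=.
by rewrite -[k%:~R]/(k%:R); ring.
Qed.

Section MinimalVector.
Variables (V : E -> Prop) (n : nat).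
Hypothesis n0_gt0 : (0 < n)%N.
Hypothesis VD : forall x y, V x -> V y -> V (x + y).
Hypothesis VM : forall s x, ringO s -> V x -> V (s * x).
Hypothesis V1 : V 1.
Hypothesis Vden : forall x, V x -> ringO (n%:R * x).
Hypothesis Vmin : forall (x : E) (Q : nat) (p q : int),
  V x -> Q%:R * x = p%:~R + q%:~R * w -> x = 0 \/ (Q ^ 2)%N%:Z <= p ^+ 2 + p * q + n0%:Z * q ^+ 2.

Let nE : n%:R != 0 :> E. Proof. by rewrite imquad_nat_eq0 -lt0n. Qed.

Lemma V_int (z : int) : V z%:~R.
Proof. by rewrite -[z%:~R]mulr1; apply: VM => //; exact: ringO_int. Qed.

Lemma VB x y : V x -> V y -> V (x - y).
Proof.
move=> Vx Vy; apply: VD => //; rewrite -mulN1r; apply: VM => //.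
exact: (ringO_int d (- 1)).
Qed.

(** Subtracting the integer part leaves an element of V in [0, 1); if nonzero it would be shorter
    than 1. *)
Lemma V_rational (Q : nat) (p : int) (x : E) : (0 < Q)%N -> V x -> Q%:R * x = p%:~R ->
  exists2 z : int, x = z%:~R & p = z * Q%:Z.
Proof.
move=> Q0 Vx E1; have QE : Q%:R != 0 :> E by rewrite imquad_nat_eq0 -lt0n.
have pE := divz_eq p Q%:Z.
have H : Q%:R * (x - (p %/ Q%:Z)%Z%:~R) = (p %% Q%:Z)%Z%:~R + (0 : int)%:~R * w.
  rewrite mulrBr E1 {1}pE; move: (p %/ Q%:Z)%Z (p %% Q%:Z)%Z => u r.
  by rewrite intrD intrM mulr0z mul0r addr0 -[Q%:~R]/(Q%:R); ring.
case: (Vmin (VB Vx (V_int _)) H) => [/eqP|].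
  rewrite subr_eq0 => /eqP xE; exists (p %/ Q%:Z)%Z => //.
  have [pm _] : (p %% Q%:Z)%Z = 0 /\ 0 = 0 :> int.
    by apply: (omega_free d4); rewrite -H xE subrr mulr0.
  by rewrite {1}pE pm addr0.
have := ltz_pmod p (d := Q%:Z) Q0; have := modz_ge0 p (d := Q%:Z).
by move=> h1 h2; nia.
Qed.

Lemma min_vector_latt : exists (a : nat) (t : int), let N := t ^+ 2 + t + n0%:Z in
  [/\ (0 < a)%N, - a%:Z < 2 * t + 1 <= a%:Z, (a%:Z %| N)%Z, a%:Z ^+ 2 <= N &
      forall x, V x <-> latt a t (a%:R * x)].
Proof.
(* Below, J collects the positive coefficients of w in V over the denominator n. Its least element e
   divides all such coefficients, in particular n, the one of w itself; this defines a = n / e. *)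
have nX (y : E) : n%:R * (y / n%:R) = y by rewrite mulrC divfK.
pose J (q : nat) := (0 < q)%N /\ exists p : int, V ((p%:~R + q%:~R * w) / n%:R).
have Jn : J n.
  split=> //; exists 0; rewrite mulr0z add0r mulrAC divff // mul1r -[w]mulr1.
  by apply: VM => //; exact: ringO_omega.
have [e [e0 [p0 Vp0]] emin] := min_nat (ex_intro _ n Jn).
have emul x (p q : int) : V x -> n%:R * x = p%:~R + q%:~R * w -> exists m, q = m * e%:Z.
  move=> Vx xE; exists (q %/ e%:Z)%Z.
  have qE := divz_eq q e%:Z; rewrite {1}qE.
  have r0 : 0 <= (q %% e%:Z)%Z by apply: modz_ge0; lia.
  have re : (q %% e%:Z)%Z < e%:Z by apply: ltz_pmod.
  case: (posnP `|(q %% e%:Z)%Z|%N) => [/eqP|rp]; first by rewrite absz_eq0 => /eqP ->; rewrite addr0.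
  suff : J `|(q %% e%:Z)%Z|%N by move=> /emin; lia.
  split=> //; exists (p - (q %/ e%:Z)%Z * p0).
  have -> : ((p - (q %/ e%:Z)%Z * p0)%:~R + (`|(q %% e%:Z)%Z|%N)%:~R * w) / n%:R =
     x - (q %/ e%:Z)%Z%:~R * ((p0%:~R + e%:~R * w) / n%:R).
    apply: (mulfI nE); rewrite nX mulrBr xE [n%:R * (_ * _)]mulrCA nX gez0_abs //.
    rewrite {3}qE; move: (q %/ e%:Z)%Z (q %% e%:Z)%Z => u r'.
    by rewrite !(rmorphB, rmorphD, rmorphM) /=; ring.
  by apply: VB => //; apply: VM => //; exact: ringO_int.
have [a nea] : exists a : nat, n = (a * e)%N.
  have [||m nm] := emul w 0 n%:Z.
  - by rewrite -[w]mulr1; apply: VM => //; exact: ringO_omega.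
  - by rewrite mulr0z add0r -pmulrn.
  by exists `|m|%N; nia.
have a0 : (0 < a)%N by case: (a) nea n0_gt0 => // ->.
have aE : a%:R != 0 :> E by rewrite imquad_nat_eq0 -lt0n.
pose tau0 : E := (p0%:~R + e%:~R * w) / n%:R.
have ntau : n%:R * tau0 = p0%:~R + e%:~R * w by rewrite /tau0 nX.
have [t tE] : exists t : int, a%:R * tau0 = t%:~R + w.
  have VX : V (a%:R * tau0 - w).
    apply: VB; first by apply: VM => //; exact: ringO_nat.
    by rewrite -[w]mulr1; apply: VM => //; exact: ringO_omega.
  have [|z zE _] := V_rational (p := a%:Z * p0) n0_gt0 VX.
    rewrite mulrBr mulrCA ntau nea natrM rmorphM /= -[e%:~R]/(e%:R) -[a%:~R]/(a%:R); ring.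
  by exists z; rewrite -zE subrK.
have [j jE] : exists j, - a%:Z < 2 * (t - a%:Z * j) + 1 <= a%:Z.
  exists ((2 * t + a%:Z) %/ (2 * a%:Z))%Z.
  have := divz_eq (2 * t + a%:Z) (2 * a%:Z).
  have m0 : 0 <= ((2 * t + a%:Z) %% (2 * a%:Z))%Z by apply: modz_ge0; lia.
  have ma : ((2 * t + a%:Z) %% (2 * a%:Z))%Z < 2 * a%:Z by apply: ltz_pmod; lia.
  move: (_ %/ _)%Z (_ %% _)%Z m0 ma => j r m0 ma tE'; lia.
have [t' t'E] : exists t', t' = t - a%:Z * j by exists (t - a%:Z * j).
pose tau := tau0 - j%:~R.
have Vtau : V tau by apply: VB => //; exact: V_int.
have tauE : a%:R * tau = t'%:~R + w.
  by rewrite /tau mulrBr tE t'E rmorphB rmorphM /= -[a%:~R]/(a%:R); ring.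
have tauE' : a%:R * tau = t'%:~R + (1 : int)%:~R * w by rewrite tauE mul1r.
exists a, t'; split=> //; first by rewrite t'E.
(* The product of tau with the conjugate of t + w is N(t + w) / a, a rational element of V and hence
   an integer. *)
- have VN : V (conjE (t'%:~R + (1 : int)%:~R * w) * tau).
    apply: VM => //; apply: (ringO_conj d4).
    by exists t', 1.
  have [|z _ zE] := V_rational (p := t' ^+ 2 + t' + n0%:Z) a0 VN.
    rewrite mulrCA tauE' mulrC normO //; congr (_%:~R); ring.
  by apply/dvdzP; exists z.
- case: (Vmin Vtau tauE') => [tau_eq0|]; last by lia.
  have [_ //] : t' = 0 /\ 1 = 0 :> int.
  by apply: (omega_free d4); rewrite -tauE' tau_eq0 mulr0.
move=> x; split=> [Vx|[p [q xE]]].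
  have [p [q xE]] := Vden Vx; have [m qE] := emul _ _ _ Vx xE.
  have VX : V (x - m%:~R * tau) by apply: VB => //; apply: VM => //; exact: ringO_int.
  have [|z zE _] := V_rational (p := p - m * e%:Z * t') n0_gt0 VX.
    rewrite mulrBr xE qE nea natrM.
    have -> : a%:R * e%:R * (m%:~R * tau) = m%:~R * e%:R * (a%:R * tau) by ring.
    by rewrite tauE [RHS]rmorphB !rmorphM /= -[e%:~R]/(e%:R); ring.
  exists z, m; rewrite -tauE -zE; ring.
have -> : x = p%:~R + q%:~R * tau.
  apply: (mulfI aE); by rewrite xE [RHS]mulrDr [a%:R * (_ * tau)]mulrCA tauE; ring.
by apply: VD; [exact: V_int|apply: VM => //; exact: ringO_int].
Qed.

End MinimalVector.

Lemma fractional_ideal_latt (U : set E) : fractional_ideal U ->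
  exists (a : nat) (t : int) (e : E), let N := t ^+ 2 + t + n0%:Z in
  [/\ (0 < a)%N, - a%:Z < 2 * t + 1 <= a%:Z, (a%:Z %| N)%Z, a%:Z ^+ 2 <= N &
      e != 0 /\ U = [set e * x | x in latt a t]%classic].
Proof.
move=> [[m [g UE]] [u Uu u0]].
have UD x y : U x -> U y -> U (x + y).
  rewrite UE => -[c [Oc ->]] [c' [Oc' ->]]; exists (fun i => c i + c' i); split.
    by move=> i; apply: ringOD.
  by rewrite -big_split; apply: eq_bigr => i _; rewrite scalerDl.
have UM s x : ringO s -> U x -> U (s * x).
  rewrite UE => Os [c [Oc ->]]; exists (fun i => s * c i); split.
    by move=> i; apply: (ringOM d4).
  by rewrite mulr_sumr; apply: eq_bigr => i _; rewrite -scalerA.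
have [D D0 DU] : exists2 D : nat, (0 < D)%N & forall x, U x -> ringO (D%:R * x).
  have [D DE] := fin_all_exists2 (fun i => imquad_denominator (g i)).
  exists (\prod_i D i)%N; first by apply: prodn_gt0.
  move=> x; rewrite UE => -[c [Oc ->]]; rewrite mulr_sumr.
  apply: big_ind; [exact: (ringO_int d 0)|exact: ringOD|move=> i _].
  rewrite (bigD1 i) //= natrM.
  have -> : (D i)%:R * (\prod_(j < m | j != i) D j)%N%:R * (c i *: g i) =
    (\prod_(j < m | j != i) D j)%N%:R * (c i * ((D i)%:R * g i)).
    by rewrite -[_ *: _]/(_ * _); ring.
  by apply: (ringOM d4); [exact: ringO_nat|apply: (ringOM d4)].
(* Scaling by D makes the norms natural numbers, so a shortest nonzero vector exists by
   well-ordering. *)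
pose nrm (n : nat) := exists x, [/\ U x, x != 0 & (D%:R * x) * conjE (D%:R * x) = n%:R].
have norm_nat (x : E) : U x -> x != 0 -> exists n, (D%:R * x) * conjE (D%:R * x) = n%:R.
  move=> Ux x0; have [p [q xE]] := DU x Ux.
  exists `|(p ^+ 2 + p * q + n0%:Z * q ^+ 2)%R|%N; rewrite xE normO //.
  rewrite -{1}[p ^+ 2 + _ + _]gez0_abs //.
  have : 0 <= 4 * (p ^+ 2 + p * q + n0%:Z * q ^+ 2).
    have -> : 4 * (p ^+ 2 + p * q + n0%:Z * q ^+ 2) = (2 * p + q) ^+ 2 + (4 * n0%:Z - 1) * q ^+ 2 by ring.
    by rewrite addr_ge0 ?sqr_ge0 // mulr_ge0 ?sqr_ge0 //; lia.
  by rewrite pmulr_rge0.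
have [n [al [Ual al0 alE]] nmin] : exists2 n, nrm n & forall m, nrm m -> (n <= m)%N.
  by apply: min_nat; have [n nE] := norm_nat u Uu u0; exists n, u.
have DE : D%:R != 0 :> E by rewrite imquad_nat_eq0 -lt0n.
have n_gt0 : (0 < n)%N.
  rewrite lt0n; apply/eqP => n00; move: alE; rewrite n00 => /eqP.
  by rewrite mulf_eq0 fmorph_eq0 orbb mulf_eq0 (negbTE DE) (negbTE al0).
(* Division of U by the shortest vector al makes 1 shortest. The norm n of D al clears denominators
   there, because n x is the conjugate of D al times D (al x). *)
have [|||||a [t /= [a0 ta aN a2 H]]] := @min_vector_latt (fun x => U (al * x)) n n_gt0.
- by move=> x y Ux Uy; rewrite mulrDr; apply: UD.
- by move=> s x Os Ux; rewrite mulrCA; apply: UM.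
- by rewrite mulr1.
- move=> x Ux.
  have -> : n%:R * x = conjE (D%:R * al) * (D%:R * (al * x)) by rewrite -alE; ring.
  by apply: (ringOM d4); [apply: (ringO_conj d4); exact: DU|exact: DU].
- move=> x Q p q Ux xE; have [->|x0] := eqVneq x 0; [by left|right].
  have [|l lE] := norm_nat _ Ux; first by rewrite mulf_neq0.
  have nl : (n <= l)%N by apply: nmin; exists (al * x); split=> //; rewrite mulf_neq0.
  have : (n%:Z * (p ^+ 2 + p * q + n0%:Z * q ^+ 2))%:~R = (l%:Z * (Q ^ 2)%N%:Z)%:~R :> E.
    rewrite !rmorphM /= -normO // -xE -[n%:~R]/(n%:R) -[l%:~R]/(l%:R) -alE -lE !rmorphM /= !rmorph_nat.
    by rewrite -[Q%:~R]/(Q%:R); ring.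
  move/eqP; rewrite -subr_eq0 -rmorphB /= imquad_int_eq0 subr_eq0 => /eqP nN.
  rewrite -(ler_pM2l (x := n%:Z)) ?nN; last lia.
  by rewrite ler_wpM2r //; lia.
have aE : a%:R != 0 :> E by rewrite imquad_nat_eq0 -lt0n.
exists a, t, (al / a%:R); split=> //; split; first by rewrite mulf_neq0 ?invr_eq0.
apply/seteqP; split=> x.
  move=> Ux; exists (a%:R * (x / al)).
    by apply/H; rewrite mulrC divfK.
  by rewrite mulrA divfK // mulrC divfK.
move=> [y ly <-]; rewrite -mulrA; apply/H.
by rewrite mulVKf.
Qed.

End Reduction.

Lemma ringO_latt d : @ringO d = latt 1 0.
Proof.
apply/seteqP; split=> _ [p [q ->]]; exists p, q; first by rewrite mulr1 add0r.
by rewrite mulr1 add0r.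
Qed.

(** * Membership in S_d(1) and the value of g_d(1) *)

Section Main.
Variables (d k : nat) (a2 a3 : int) (r0 : nat) (ex : seq nat) (g : nat) (c : int).
Hypothesis facts : class3_facts d k a2 a3 r0 ex g c.
Local Notation E := (imquad d).
Local Notation n0 := ((d + 1) %/ 4)%N.

Let d4 : (d %% 4 = 3)%N := facts_mod4 facts.
Let k0 : (0 < k)%N := facts_k facts.

(* The three ideal classes, as lattices [latt k' a'], each with the [c'] such that
   [k' z ^ 2 - (2 a' + 1) z y + c' y ^ 2] is its norm form. *)
Definition ideal_class (k' : nat) (a' c' : int) (R : nat -> bool) : Prop :=
  [\/ [/\ k' = 1%N, a' = 0, c' = n0%:Z & R = leq 1],
      [/\ k' = k, a' = a2, c' = c & R = fun r => (r0 <= r)%N && (r \notin ex)] |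
      [/\ k' = k, a' = a3, c' = c & R = fun r => (r0 <= r)%N && (r \notin ex)]].

Lemma ideal_class_k k' a' c' R : ideal_class k' a' c' R -> (0 < k')%N.
Proof. by case=> -[-> _ _ _]. Qed.

Lemma ideal_class_c k' a' c' R : ideal_class k' a' c' R ->
  k'%:Z * c' = a' ^+ 2 + a' + n0%:Z.
Proof.
have kc := facts_c facts; have cj := facts_conj facts.
by case=> -[-> -> -> _] //; [ring|rewrite kc cj; ring].
Qed.

Lemma sumq_oppE k' b b' c' m r : b' = - b -> sumq k' b c' m r -> sumq k' b' c' m r.
Proof. by move=> ->; exact: sumqN. Qed.

Lemma ideal_class_sumq k' a' c' R r : ideal_class k' a' c' R -> R r ->
  sumq k' (- (2 * a' + 1)) c' g r.
Proof.
case=> -[-> -> -> ->].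
- by move=> _; apply: (sumq_oppE (b := 1)); [ring|exact: (facts_sumq1 facts)].
- by case/andP; exact: (facts_sumq2 facts).
- case/andP=> r1 r2; apply: (sumq_oppE (b := - (2 * a2 + 1))).
    by rewrite (facts_conj facts); ring.
  exact: (facts_sumq2 facts).
Qed.

Lemma ideal_class_R k' a' c' R m r : ideal_class k' a' c' R -> (0 < r)%N ->
  sumq k' (- (2 * a' + 1)) c' m r -> R r.
Proof.
have good2 s : (0 < r)%N -> sumq k (- (2 * a2 + 1)) c s r -> (r0 <= r)%N && (r \notin ex).
  by move=> r_gt0 /(facts_good facts)/orP[/eqP rz|//]; rewrite rz in r_gt0.
case=> -[-> -> -> ->] // r_gt0; first exact: good2.
move=> S; apply: good2 r_gt0 _; apply: sumq_oppE S.
by rewrite (facts_conj facts); ring.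
Qed.

(** The scalar produced by the reduction of the ideal is absorbed into the vector, so finitely many
    ideals serve all unary lattices. *)
Lemma unary_ideal_class (V : lmodType E) (L : set V) : unary L ->
  exists k' a' c' R (v : V), [/\ ideal_class k' a' c' R, v != 0 & L = scaled (latt k' a') v].
Proof.
move=> [U [v [fU v0 ->]]].
have [a [t [e [a_gt0 ta aN a2N [e0 UE]]]]] := fractional_ideal_latt d4 fU.
have LE : scaled U v = scaled (latt a t) (e *: v).
  rewrite UE; apply/seteqP; split=> x.
    by move=> [_ [y ly <-] <-]; exists y => //; rewrite scalerA mulrC.
  by move=> [y ly <-]; exists (e * y); [exists y|rewrite scalerA mulrC].
have ev0 : e *: v != 0 by rewrite scaler_eq0 negb_or e0.
rewrite LE; case: (facts_reduced facts a_gt0 ta aN a2N) => [a1|[ak [tk|tk]]].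
- exists 1%N, 0, n0%:Z, (leq 1), (e *: v); split=> //; first by constructor 1.
  by rewrite a1 (@latt_shift _ _ t 0) // dvd1z.
- exists k, a2, c, (fun r => (r0 <= r)%N && (r \notin ex)), (e *: v); split=> //.
    by constructor 2.
  by rewrite ak (@latt_shift _ _ t a2).
- exists k, a3, c, (fun r => (r0 <= r)%N && (r \notin ex)), (e *: v); split=> //.
    by constructor 3.
  by rewrite ak (@latt_shift _ _ t a3).
Qed.

Lemma in_S1_line k' a' c' R r : ideal_class k' a' c' R -> (0 < r)%N -> R r -> (0 < g)%N ->
  in_S1 (line_form (r%:R / k'%:R)) (scaled (latt k' a') (1 : E^o)).
Proof.
move=> cl r_gt0 Rr g0; have k'0 := ideal_class_k cl; have kc := ideal_class_c cl.
split; [exact: (unary_line d4 k'0 kc)|exact: (posdef_integral_line d4 k'0 kc)|exists g => //].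
apply: (sumq_represented d4 k'0 kc r_gt0); first exact: line_form1.
exact: ideal_class_sumq cl Rr.
Qed.

Lemma isometric_in_S1 (V : lmodType E) (h : {hermitian V for false & @conjE d}) (L : set V)
    k' a' c' R r : ideal_class k' a' c' R -> (0 < r)%N -> R r -> (0 < g)%N ->
  unary L -> posdef_integral h L ->
  isometric h L (line_form (r%:R / k'%:R)) (scaled (latt k' a') (1 : E^o)) -> in_S1 h L.
Proof.
move=> cl r_gt0 Rr g0 uL pL iso; split=> //; exists g => //.
apply: represented_isometric iso _.
have k'0 := ideal_class_k cl; have kc := ideal_class_c cl.
apply: (sumq_represented d4 k'0 kc r_gt0); first exact: line_form1.
exact: ideal_class_sumq cl Rr.
Qed.

Lemma g_gt0 : (0 < g)%N.
Proof.
have [s sg] := facts_sumq1 facts 1; rewrite -sg.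
by case: s {sg} => // /esym; rewrite big_nil.
Qed.

(** A representation by some I_m serves only to place r in the admissible set, every element of
    which is a sum of g values. *)
Lemma S1_represented : S1_represented_by d g.
Proof.
move=> V h L [uL pL [m _ repr]].
have [k' [a' [c' [R [v [cl v0 LE]]]]]] := unary_ideal_class uL.
have k'0 := ideal_class_k cl; have kc := ideal_class_c cl.
rewrite LE in pL repr *.
have [r r_gt0 hvv] := unary_norm d4 k'0 kc v0 pL.
apply: (sumq_represented d4 k'0 kc r_gt0 hvv); apply: ideal_class_sumq (cl) _.
exact: ideal_class_R cl r_gt0 (represented_sumq d4 k'0 kc hvv repr).
Qed.

Lemma S1_represented_min g' : S1_represented_by d g' -> (g <= g')%N.
Proof.
move=> rep; rewrite leqNgt; apply/negP => /(facts_min facts).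
case=> -[r].
- move=> r_gt0; apply; have cl : ideal_class 1 0 n0%:Z (leq 1) by constructor 1.
  have k'0 := ideal_class_k cl; have kc := ideal_class_c cl.
  have := rep _ _ _ (in_S1_line cl r_gt0 r_gt0 g_gt0).
  move=> /(represented_sumq d4 k'0 kc) S; apply: sumq_oppE (S r _); last exact: line_form1.
  by [].
- move=> /andP[r_gt0]; rewrite /good -[(r == 0)%N]negbK -lt0n r_gt0 /= => Rr; apply.
  have cl : ideal_class k a2 c (fun r => (r0 <= r)%N && (r \notin ex)) by constructor 2.
  have k'0 := ideal_class_k cl; have kc := ideal_class_c cl.
  have := rep _ _ _ (in_S1_line cl r_gt0 Rr g_gt0).
  by move=> /(represented_sumq d4 k'0 kc) S; apply: S; exact: line_form1.
Qed.

End Main.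

Theorem theorem2 (d k : nat) (a2 a3 : int) (r0 : nat) (ex : seq nat) (g : nat)
    (hd : class3_data d k a2 a3 r0 ex g) :
  let U1 : set (imquad d) := @ringO d in
  let U2 : set (imquad d) := ideal2 k%:R (a2%:~R + omega d) in
  let U3 : set (imquad d) := ideal2 k%:R (a3%:~R + omega d) in
  let v : (imquad d)^o := 1 in
  (forall (V : lmodType (imquad d)) (h : {hermitian V for false & @conjE d})
          (L : set V),
     unary L -> posdef_integral h L ->
     (in_S1 h L <->
        (exists2 r1 : nat, (1 <= r1)%N &
           isometric h L (line_form r1%:R) (scaled U1 v)) \/
        (exists2 r : nat, (r0 <= r)%N && (r \notin ex) &
           isometric h L (line_form (r%:R / k%:R)) (scaled U2 v) \/
           isometric h L (line_form (r%:R / k%:R)) (scaled U3 v))))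
  /\ is_g1 d g.
Proof.
move=> U1 U2 U3 v; have [c facts] := class3_dataP hd.
have d4 := facts_mod4 facts.
pose R2 r := (r0 <= r)%N && (r \notin ex).
have cl1 : ideal_class d k a2 a3 r0 ex c 1 0 ((d + 1) %/ 4)%N%:Z (leq 1) by constructor 1.
have cl2 : ideal_class d k a2 a3 r0 ex c k a2 c R2 by constructor 2.
have cl3 : ideal_class d k a2 a3 r0 ex c k a3 c R2 by constructor 3.
have U2E : U2 = latt k a2 by apply: (latt_ideal2 d4 (ideal_class_c facts cl2)).
have U3E : U3 = latt k a3 by apply: (latt_ideal2 d4 (ideal_class_c facts cl3)).
have g0 := g_gt0 facts.
have r0_gt0 : (0 < r0)%N by case: hd.
split; last first.
  split; [by []|exact: S1_represented facts|].
  by move=> g' _; exact: (S1_represented_min facts).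
move=> V h L uL pL; rewrite {}/U1 U2E U3E ringO_latt; split.
  move=> [_ _ [m _ repr]].
  have [k' [a' [c' [R [u [cl u0 LE]]]]]] := unary_ideal_class facts uL.
  have k'0 := ideal_class_k facts cl; have kc := ideal_class_c facts cl.
  rewrite LE in pL repr *.
  have [r r_gt0 huu] := unary_norm d4 k'0 kc u0 pL.
  have Rr := ideal_class_R facts cl r_gt0 (represented_sumq d4 k'0 kc huu repr).
  have iso := isometric_line d4 k'0 kc r_gt0 huu.
  case: cl Rr iso => -[-> -> _ ->] Rr iso.
  - by left; exists r => //; rewrite divr1 in iso.
  - by right; exists r => //; left.
  - by right; exists r => //; right.
case=> [[r r1 iso]|[r Rr [iso|iso]]].
- by apply: (isometric_in_S1 facts cl1 r1) => //; rewrite divr1.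
- by apply: (isometric_in_S1 facts cl2 (r := r)) => //; case/andP: Rr; lia.
- by apply: (isometric_in_S1 facts cl3 (r := r)) => //; case/andP: Rr; lia.
Qed.
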